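(* Consider the $M/M/1$ queue with balking $b_n=1/(n+1)$ (service rate $1$, arrival rate $\rho>0$), with unconditional sojourn time density for the PS model $p_{_{PS}}(t)=\sum_{n=0}^\infty\frac{\rho^n}{n!}e^{-\rho}p_n(t)$ and waiting time density for the ROS model $p(t)=(1-e^{-\rho})\,p_{_{PS}}(t)$. Put $\Lambda_0=\frac12\big(-\rho+\sqrt{\rho^2+4\rho}\,\big)$. Then the following asymptotic expansions hold. (1) For $\rho$ fixed and $t\to\infty$, $$p_{_{PS}}(t)=\frac{p(t)}{1-e^{-\rho}}\sim\frac{\sqrt{\rho+4}-\sqrt{\rho}}{2\sqrt{\rho+4}}\,e^{-1-\rho}\,e^{\rho/\Lambda_0}\,e^{-t}\,e^{\Lambda_0 t}.$$ (2) For $\rho\to0^+$: (a) if $t=\zeta/\rho$ with $\zeta>0$ fixed, $$p_{_{PS}}(t)\sim\rho^{-1}p(t)\sim\frac12\,e^{-1}\,e^{-\zeta/2}\,e^{-(1-\sqrt{\rho})t};$$ (b) if $t=\omega/\sqrt{\rho}$ with $\omega>0$ fixed, $$p_{_{PS}}(t)\sim\rho^{-1}p(t)\sim e^{-t}Q_0(\omega),\qquad Q_0(\omega)=\sum_{m=1}^\infty\frac{m^{m-1}}{m!}\,e^{-m}\cosh(\omega/\sqrt{m});$$ (c) if $t$ is fixed ($t=O(1)$), $$p_{_{PS}}(t)=e^{-t}\Big[1+\frac{\rho}{4}(t^2-2)+O(\rho^2)\Big],\qquad p(t)=\rho\,e^{-t}\Big[1+\frac{\rho}{4}(t^2-4)+O(\rho^2)\Big].$$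 (3) For $\rho\to\infty$ with $t=T\rho$, $T>0$ fixed, $$p_{_{PS}}(t)\sim p(t)\sim\frac{1}{\rho}\,e^{-T}.$$
   Context: $\mathcal{V}_n$ denotes the sojourn time of a tagged customer who enters the PS queue and finds $n$ other customers present, and $\mathbf{V}_n(t)=\mathrm{Prob}[\mathcal{V}_n>t]$. With $b_n=1/(n+1)$, the functions $\mathbf{V}_n$ ($n\ge 0$, $t\ge 0$, $0\le \mathbf V_n\le 1$) are the bounded solution of $$\mathbf{V}'_n(t)=\frac{n}{n+1}\mathbf{V}_{n-1}(t)-\Big(1+\frac{\rho}{n+1}\Big)\mathbf{V}_n(t)+\frac{\rho}{n+1}\mathbf{V}_{n+1}(t),\qquad \mathbf{V}_n(0)=1.$$ The conditional sojourn time density is $p_n(t)=-\mathbf{V}_n'(t)$; equivalently $$p'_n(t)=\frac{n}{n+1}p_{n-1}(t)-\Big(1+\frac{\rho}{n+1}\Big)p_n(t)+\frac{\rho}{n+1}p_{n+1}(t),\quad t>0,\qquad p_n(0)=\frac{1}{n+1},\quad n\ge 0$$ (the term with $p_{n-1}$ is absent for $n=0$). The densities $p_{_{PS}}$ and $p$ are by definition given by the formulas in the claim; $p$ is the density of the positive part of the waiting time in the random order of service (ROS) model, whose full law also has an atom $e^{-\rho}$ at $0$. The notation $f\sim g$ means $f/g\to1$ in the stated limit. *)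

(* Defs.v *)
From Stdlib Require Import Reals Factorial.
From Coquelicot Require Import Coquelicot.
Open Scope R_scope.

(* One-sided at [t = 0], where only increments [s > 0] are allowed; the ordinary
   derivative for [t > 0].  The values of [f] at negative times are irrelevant. *)
Definition is_derive_nonneg (f : R -> R) (t l : R) : Prop :=
  filterlim (fun s => (f s - f t) / (s - t))
            (within (fun s => 0 <= s) (locally' t)) (locally l).

Definition balking (n : nat) : R := 1 / (INR n + 1).

(* [V n t] is the probability that the sojourn time of a tagged customer finding
   [n] others exceeds [t].  For [n = 0] the first summand vanishes
   because [INR 0 = 0], so [pred 0 = 0] does no harm. *)
Definition sojourn_tail (rho : R) (V : nat -> R -> R) : Prop :=
  forall n : nat,
    V n 0 = 1 /\
    forall t : R, 0 <= t ->
      0 <= V n t <= 1 /\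
      is_derive_nonneg (V n) t
        (INR n / (INR n + 1) * V (pred n) t
         - (1 + rho * balking n) * V n t
         + rho * balking n * V (S n) t).

Definition sojourn_density (V p : nat -> R -> R) : Prop :=
  forall (n : nat) (t : R), 0 <= t -> is_derive_nonneg (V n) t (- p n t).

Definition pPS (rho : R) (p : nat -> R -> R) (t : R) : R :=
  Series (fun n => rho ^ n / INR (fact n) * exp (- rho) * p n t).

Definition pROS (rho : R) (p : nat -> R -> R) (t : R) : R :=
  (1 - exp (- rho)) * pPS rho p t.

Definition Lambda0 (rho : R) : R := / 2 * (- rho + sqrt (rho ^ 2 + 4 * rho)).

(* The summation index is shifted: [m = k + 1]. *)
Definition Q0 (omega : R) : R :=
  Series (fun k => let m := S k in
    INR m ^ (m - 1) / INR (fact m) * exp (- INR m)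
    * cosh (omega / sqrt (INR m))).

Definition asymp_equiv (F : (R -> Prop) -> Prop) (f g : R -> R) : Prop :=
  filterlim (fun x => f x / g x) F (locally 1).

Definition is_bigO (F : (R -> Prop) -> Prop) (f g : R -> R) : Prop :=
  exists C : R, F (fun x => Rabs (f x) <= C * Rabs (g x)).

(* Main.v *)
Require Import Defs.
From Stdlib Require Import Reals Ranalysis5 Factorial Lra Lia Psatz.
From Coquelicot Require Import Coquelicot.
Open Scope R_scope.

(** Put [d = sqrt rho] and measure time by [w = d t].  The rescaled densities
    [u_n(w) = d^n e^t p_n(t)] satisfy

      [(n + 1) u_n' = n u_{n-1} - d u_n + u_{n+1}],   [u_n(0) = d^n / (n + 1)],

    a system whose generator is symmetric for the weight [(n + 1) / n!],
    whatever the load.  In the corresponding inner product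
    [e^(rho + t) pPS(t)] is [<u(0), u(w)>] (the function [mass]), so all the
    claims concern one matrix element of a symmetric semigroup.  The symmetry
    enters only through [pairing]: a product [<u(T - s), v(s)>] of two solutions
    is constant in [s] (up to the difference of their parameters [d]).

    The ground state is [l^-n], where [l^2 + d l = 1] and [d l = Lambda0].
    Writing [<u(0), u(2 w)>] as the squared norm of [u(w)], the Cauchy-Schwarz
    inequality bounds it below by the ground state contribution [c e^(2 l w)],
    and the representation of [l - generator] as a sum of squares bounds it above by
    [<u(0), u(0)> e^(2 l w)] ([mass_lower], [mass_upper]).  For large [rho] the
    two bounds agree to first order, which is the heavy traffic claim.

    For fixed [rho] one needs that the rest of the spectrum lies strictly
    below [l].  Dividing by the ground state gives a system without killing;
    the differences of consecutive components solve a cooperative system, and a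
    maximum principle in a slightly growing geometric weight shows that they
    decay exponentially ([mass_gap]).  The rate is explicit in [d] and stays
    bounded away from zero as [d] tends to zero, so the same estimate settles
    the scale [t = zeta / rho].

    On the scale [t = omega / sqrt rho], [w = omega] is fixed and [d] tends to
    zero.  The limiting generator has the eigenvalues [1 / sqrt m] and
    [- 1 / sqrt m], [m >= 1], with eigenvectors made of Charlier polynomials of
    degree [m - 1] for the Poisson law of mean [m], and of squared norm
    [2 m! e^m / m^(m-1)] ([phi_norm]).  The reciprocals of these norms sum to
    one, because the tree function takes the value [1] at [e^(-1)]
    ([borel_mass]); hence the expansion of the initial state in these
    eigenvectors is complete, without any appeal to a spectral theorem, and it
    yields [Q0] ([mass_limit]).  At fixed [t], integrating the first two
    equations is enough ([short_time]). *)

(** * The weighted inner product *)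

Lemma fact_pos (n : nat) : 0 < INR (fact n).
Proof. apply lt_0_INR, lt_O_fact. Qed.

Lemma fact_S_INR (n : nat) : INR (fact (S n)) = (INR n + 1) * INR (fact n).
Proof. now rewrite fact_simpl, mult_INR, S_INR. Qed.

Lemma INR_succ_pos (n : nat) : 0 < INR n + 1.
Proof. pose proof (pos_INR n); lra. Qed.

Lemma exp_series (x : R) : is_series (fun n => x ^ n / INR (fact n)) (exp x).
Proof.
  generalize (is_exp_Reals x); unfold is_pseries.
  apply is_series_ext; intro n.
  rewrite pow_n_pow; unfold scal; simpl; unfold mult; simpl.
  unfold Rdiv; ring.
Qed.

Lemma exp_series_index (x : R) :
  is_series (fun n => INR n * (x ^ n / INR (fact n))) (x * exp x).
Proof.
  apply is_series_decr_1.
  apply is_series_ext with (fun n => scal x (x ^ n / INR (fact n))).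
  - intro n; rewrite S_INR, fact_S_INR; unfold scal; simpl; unfold mult; simpl.
    pose proof (fact_pos n); pose proof (INR_succ_pos n).
    field; split; lra.
  - replace (plus (x * exp x) _) with (scal x (exp x)).
    + apply (is_series_scal_l (V := R_NormedModule)), exp_series.
    + unfold scal, plus, opp; simpl; unfold mult; simpl; ring.
Qed.

(** The generator of the slow-time system below is symmetric for this weight,
    and the weight does not depend on the load. *)
Definition wt (n : nat) : R := (INR n + 1) / INR (fact n).

Lemma wt_pos (n : nat) : 0 < wt n.
Proof. apply Rdiv_lt_0_compat; [apply INR_succ_pos | apply fact_pos]. Qed.

Lemma wt_series (x : R) : is_series (fun n => wt n * x ^ n) ((1 + x) * exp x).
Proof.
  replace ((1 + x) * exp x) with (plus (x * exp x) (exp x))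
    by (unfold plus; simpl; ring).
  apply is_series_ext with
    (fun n => plus (INR n * (x ^ n / INR (fact n))) (x ^ n / INR (fact n))).
  - intro n; unfold wt, plus; simpl; field; apply not_eq_sym, Rlt_not_eq, fact_pos.
  - apply (is_series_plus (V := R_NormedModule)); [apply exp_series_index | apply exp_series].
Qed.

(** Geometric growth is beaten by the factorial in [wt], so every weighted sum
    of such sequences converges absolutely. *)
Definition geo (f : nat -> R) : Prop :=
  exists B r, 0 <= B /\ 1 <= r /\ forall n, Rabs (f n) <= B * r ^ n.

Definition ip (f g : nat -> R) : R := Series (fun n => wt n * (f n * g n)).

Lemma geo_mult f g : geo f -> geo g -> geo (fun n => f n * g n).
Proof.
  intros (B & r & HB & Hr & Hf) (B' & r' & HB' & Hr' & Hg).
  exists (B * B'), (r * r'); repeat split; [nra | nra |].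
  intro n; rewrite Rabs_mult, Rpow_mult_distr.
  replace (B * B' * (r ^ n * r' ^ n)) with ((B * r ^ n) * (B' * r' ^ n)) by ring.
  apply Rmult_le_compat; auto using Rabs_pos.
Qed.

Lemma geo_plus f g : geo f -> geo g -> geo (fun n => f n + g n).
Proof.
  intros (B & r & HB & Hr & Hf) (B' & r' & HB' & Hr' & Hg).
  exists (B + B'), (r * r'); repeat split; [nra | nra |].
  intro n; rewrite Rpow_mult_distr.
  pose proof (Rabs_triang (f n) (g n)); specialize (Hf n); specialize (Hg n).
  pose proof (pow_R1_Rle r n Hr); pose proof (pow_R1_Rle r' n Hr').
  assert (B * r ^ n <= B * (r ^ n * r' ^ n)) by (apply Rmult_le_compat_l; nra).
  assert (B' * r' ^ n <= B' * (r ^ n * r' ^ n)) by (apply Rmult_le_compat_l; nra).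
  nra.
Qed.

Lemma geo_scal c f : geo f -> geo (fun n => c * f n).
Proof.
  intros (B & r & HB & Hr & Hf); exists (Rabs c * B), r; repeat split; auto.
  - apply Rmult_le_pos; auto using Rabs_pos.
  - intro n; rewrite Rabs_mult, Rmult_assoc.
    apply Rmult_le_compat_l; auto using Rabs_pos.
Qed.

Lemma geo_sub_scal c f g : geo f -> geo g -> geo (fun n => f n - c * g n).
Proof.
  intros Hf Hg.
  destruct (geo_plus _ _ Hf (geo_scal (- c) _ Hg)) as (B & r & HB & Hr & H).
  exists B, r; repeat split; auto; intro n; specialize (H n).
  now replace (f n - c * g n) with (f n + - c * g n) by ring.
Qed.

Lemma geo_pow c : geo (fun n => c ^ n).
Proof.
  exists 1, (1 + Rabs c); pose proof (Rabs_pos c); repeat split; try lra.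
  intro n; rewrite <- RPow_abs, Rmult_1_l; apply pow_incr; lra.
Qed.

Lemma geo_INR : geo INR.
Proof.
  exists 1, 2; repeat split; try lra; intro n; rewrite Rabs_pos_eq by apply pos_INR.
  induction n as [|n IH]; [simpl; lra|].
  rewrite S_INR; pose proof (pow_R1_Rle 2 n ltac:(lra)); simpl; lra.
Qed.

Lemma geo_pred f : geo f -> geo (fun n => f (pred n)).
Proof.
  intros (B & r & HB & Hr & Hf); exists B, r; repeat split; auto; intro n.
  eapply Rle_trans; [apply Hf|]; apply Rmult_le_compat_l; auto.
  apply Rle_pow; auto; lia.
Qed.

Lemma geo_succ f : geo f -> geo (fun n => f (S n)).
Proof.
  intros (B & r & HB & Hr & Hf); exists (B * r), r; repeat split; auto; [nra|].
  intro n; eapply Rle_trans; [apply Hf|]; simpl; lra.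
Qed.

Lemma geo_summable f : geo f -> ex_series (fun n => wt n * f n).
Proof.
  intros (B & r & HB & Hr & Hf).
  apply (ex_series_le (V := R_CompleteNormedModule)) with (fun n => scal B (wt n * r ^ n)).
  - intro n; unfold norm, scal; simpl; unfold abs, mult; simpl.
    rewrite Rabs_mult, (Rabs_pos_eq (wt n)) by (left; apply wt_pos).
    specialize (Hf n); pose proof (wt_pos n); nra.
  - apply (ex_series_scal (V := R_NormedModule)); eexists; apply wt_series.
Qed.

Lemma ip_summable f g : geo f -> geo g -> ex_series (fun n => wt n * (f n * g n)).
Proof. intros; apply geo_summable, geo_mult; auto. Qed.

Lemma ip_comm f g : ip f g = ip g f.
Proof. apply Series_ext; intro; ring. Qed.

Lemma ip_ext f f' g g' :
  (forall n, f n = f' n) -> (forall n, g n = g' n) -> ip f g = ip f' g'.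
Proof. intros H H'; apply Series_ext; intro; rewrite H, H'; auto. Qed.

Lemma ip_scal_l c f h : ip (fun n => c * f n) h = c * ip f h.
Proof. unfold ip; rewrite <- Series_scal_l; apply Series_ext; intro; ring. Qed.

Lemma ip_sub_scal_l c f g h :
  geo f -> geo g -> geo h ->
  ip (fun n => f n - c * g n) h = ip f h - c * ip g h.
Proof.
  intros Hf Hg Hh; unfold ip.
  rewrite <- Series_scal_l, <- Series_minus.
  - apply Series_ext; intro; ring.
  - now apply ip_summable.
  - apply (ex_series_scal (V := R_NormedModule) c (fun n => wt n * (g n * h n))).
    now apply ip_summable.
Qed.

Lemma ip_sub_scal_r c f g h :
  geo f -> geo g -> geo h ->
  ip h (fun n => f n - c * g n) = ip h f - c * ip h g.
Proof. intros; rewrite ip_comm, ip_sub_scal_l, !(ip_comm h); auto. Qed.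

Lemma ip_self_pos f : geo f -> 0 <= ip f f.
Proof.
  intro Hf.
  assert (H0 : Series (fun _ => 0) = 0).
  { apply is_series_unique.
    apply filterlim_ext with (fun _ : nat => 0).
    - intro n; rewrite sum_n_const; simpl; ring.
    - apply filterlim_const. }
  rewrite <- H0; apply Series_le; [|now apply ip_summable].
  intro n; split; [lra|]; pose proof (wt_pos n); nra.
Qed.

Lemma ip_cauchy_schwarz f g :
  geo f -> geo g -> ip f g ^ 2 <= ip f f * ip g g.
Proof.
  intros Hf Hg.
  assert (H : forall c, 0 <= ip f f - 2 * c * ip f g + c ^ 2 * ip g g).
  { intro c; pose proof (ip_self_pos _ (geo_sub_scal c f g Hf Hg)) as H.
    rewrite ip_sub_scal_l in H; auto using geo_sub_scal.
    rewrite !ip_sub_scal_r in H; auto.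
    rewrite (ip_comm g f) in H; lra. }
  pose proof (ip_self_pos f Hf); pose proof (ip_self_pos g Hg).
  destruct (Req_dec (ip g g) 0) as [Hz|Hnz].
  - destruct (Req_dec (ip f g) 0) as [->|Hn]; [nra|].
    (* At this multiplier the quadratic takes the value [-1]. *)
    specialize (H ((ip f f + 1) / (2 * ip f g))); rewrite Hz in H.
    replace (2 * ((ip f f + 1) / (2 * ip f g)) * ip f g) with (ip f f + 1) in H
      by (field; auto).
    lra.
  - specialize (H (ip f g / ip g g)).
    apply Rmult_le_compat_r with (r := ip g g) in H; auto.
    replace ((ip f f - 2 * (ip f g / ip g g) * ip f g + (ip f g / ip g g) ^ 2 * ip g g)
              * ip g g) with (ip f f * ip g g - ip f g ^ 2) in H by (field; auto).
    lra.
Qed.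

Lemma ip_le f g A B :
  geo f -> geo g -> 0 <= A -> 0 <= B -> ip f f <= A ^ 2 -> ip g g <= B ^ 2 ->
  Rabs (ip f g) <= A * B.
Proof.
  intros Hf Hg HA HB HfA HgB.
  pose proof (ip_cauchy_schwarz f g Hf Hg) as H.
  pose proof (ip_self_pos f Hf); pose proof (ip_self_pos g Hg).
  rewrite <- (Rabs_pos_eq (A * B)) by nra.
  apply Rsqr_le_abs_0; unfold Rsqr; nra.
Qed.

Definition e0 (n : nat) : R := match n with O => 1 | S _ => 0 end.

Lemma geo_e0 : geo e0.
Proof.
  exists 1, 1; repeat split; try lra; intro n; rewrite pow1.
  destruct n; simpl; [rewrite Rabs_R1 | rewrite Rabs_R0]; lra.
Qed.

Lemma ip_e0 f : ip e0 f = f O.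
Proof.
  apply is_series_unique, is_series_decr_1.
  replace (plus _ _) with (0 : R).
  - apply filterlim_ext with (fun _ : nat => 0).
    + intro n; symmetry; rewrite (sum_n_ext _ (fun _ => 0)).
      * rewrite sum_n_const; ring.
      * intro k; simpl; ring.
    + apply filterlim_const.
  - unfold plus, opp, wt; simpl; field.
Qed.

Lemma partial_sum_le (a : nat -> R) (l : R) (N : nat) :
  (forall n, 0 <= a n) -> is_series a l -> sum_n a N <= l.
Proof.
  intros Ha Hl.
  apply (is_lim_seq_incr_compare (sum_n a) l Hl).
  intro n; rewrite sum_Sn; unfold plus; simpl; specialize (Ha (S n)); lra.
Qed.

Lemma sum_n_succ (a : nat -> R) (n : nat) : sum_n a (S n) = sum_n a n + a (S n).
Proof. apply (sum_Sn a n). Qed.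

(** Equations between values of [sum_n] live in the carrier of an abelian
    monoid; [ring] and [field] recognize them only after this change of type. *)
Ltac in_R := match goal with |- @eq _ ?a ?b => change (@eq R a b) end.

Lemma exp_le (x y : R) : x <= y -> exp x <= exp y.
Proof. intros [H| ->]; [left; now apply exp_increasing | right; reflexivity]. Qed.

(** * Differential inequalities and symmetric evolution *)

Lemma derive_nonneg_le (f f' : R -> R) (T : R) :
  0 <= T -> (forall t, 0 <= t <= T -> is_derive f t (f' t)) ->
  (forall t, 0 <= t <= T -> 0 <= f' t) -> f 0 <= f T.
Proof.
  intros HT Hd Hpos.
  destruct (MVT_gen f 0 T f') as (c & Hc & Heq);
    rewrite ?Rmin_left, ?Rmax_right in * by lra.
  - intros x Hx; apply Hd; lra.
  - intros x Hx; apply continuity_pt_filterlim.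
    apply (ex_derive_continuous (V := R_NormedModule)); exists (f' x); now apply Hd.
  - specialize (Hpos c Hc); nra.
Qed.

Lemma derive_dominated (f f' g g' : R -> R) (T : R) :
  0 <= T -> (forall t, 0 <= t <= T -> is_derive f t (f' t)) ->
  (forall t, 0 <= t <= T -> is_derive g t (g' t)) ->
  (forall t, 0 <= t <= T -> Rabs (f' t) <= g' t) ->
  Rabs (f 0) <= g 0 -> Rabs (f T) <= g T.
Proof.
  intros HT Hf Hg Hle H0.
  assert (g 0 - f 0 <= g T - f T).
  { apply (derive_nonneg_le (fun t => g t - f t) (fun t => g' t - f' t)); auto.
    - intros; apply (is_derive_minus (V := R_NormedModule)); auto.
    - intros t Ht; specialize (Hle t Ht); apply Rabs_le_between in Hle; lra. }
  assert (g 0 + f 0 <= g T + f T).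
  { apply (derive_nonneg_le (fun t => g t + f t) (fun t => g' t + f' t)); auto.
    - intros; apply (is_derive_plus (V := R_NormedModule)); auto.
    - intros t Ht; specialize (Hle t Ht); apply Rabs_le_between in Hle; lra. }
  apply Rabs_le_between in H0; apply Rabs_le_between; lra.
Qed.

Lemma derive_bounded (f f' : R -> R) (T M : R) :
  0 <= T -> (forall t, 0 <= t <= T -> is_derive f t (f' t)) ->
  (forall t, 0 <= t <= T -> Rabs (f' t) <= M) -> Rabs (f T - f 0) <= T * M.
Proof.
  intros HT Hf HM.
  apply (derive_dominated (fun t => f t - f 0) f' (fun t => t * M) (fun _ => M)); auto.
  - intros t Ht; replace (f' t) with (f' t - 0) by ring.
    apply (is_derive_minus (V := R_NormedModule)); auto; apply (is_derive_const (V := R_NormedModule)).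
  - intros t _; auto_derive; auto; ring.
  - rewrite Rminus_diag, Rabs_R0; lra.
Qed.

Lemma pow_fact_lim (x : R) : is_lim_seq (fun n => x ^ n / INR (fact n)) 0.
Proof. apply ex_series_lim_0; eexists; apply exp_series. Qed.

Lemma lim_seq_const_le (u : nat -> R) (l c : R) :
  is_lim_seq u l -> (forall n, c <= u n) -> c <= l.
Proof.
  intros Hu Hc.
  exact (is_lim_seq_le (fun _ => c) u c l Hc (is_lim_seq_const c) Hu).
Qed.

(** A maximum principle for infinite linear systems.  Inserting a bound [S(t)]
    for all components into the differential inequality and integrating turns
    the crude bound [B] into [X e^(L t) + B (L t)^k / k!] after [k] rounds, and
    the second term dies. *)
Lemma comparison (x x' : nat -> R -> R) (T L X B : R) :
  0 <= L ->
  (forall n t, 0 <= t <= T -> is_derive (x n) t (x' n t)) ->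
  (forall n, Rabs (x n 0) <= X) ->
  (forall n t, 0 <= t <= T -> Rabs (x n t) <= B) ->
  (forall S t, 0 <= t <= T -> (forall n, Rabs (x n t) <= S) ->
     forall n, Rabs (x' n t) <= L * S) ->
  forall n t, 0 <= t <= T -> Rabs (x n t) <= X * exp (L * t).
Proof.
  intros HL Hd HX HB Hx'.
  assert (H : forall k n t, 0 <= t <= T ->
    Rabs (x n t) <= X * exp (L * t) + B * ((L * t) ^ k / INR (fact k))).
  { induction k as [|k IH]; intros n t Ht.
    - simpl; specialize (HB n t Ht); pose proof (HX n).
      pose proof (Rabs_pos (x n 0)); pose proof (exp_pos (L * t)).
      replace (1 / 1) with 1 by field; nra.
    - apply (derive_dominated (x n) (x' n)
        (fun t => X * exp (L * t) + B * ((L * t) ^ S k / INR (fact (S k))))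
        (fun t => L * (X * exp (L * t) + B * ((L * t) ^ k / INR (fact k))))).
      + lra.
      + intros; apply Hd; lra.
      + intros s _; auto_derive; auto.
        change (Init.Nat.pred (S k)) with k.
        change (fact k + k * fact k)%nat with (fact (S k)).
        rewrite fact_S_INR.
        change (match k with O => 1 | S _ => INR k + 1 end) with (INR (S k)).
        rewrite S_INR.
        pose proof (fact_pos k); pose proof (INR_succ_pos k).
        simpl; field; lra.
      + intros s Hs; apply Hx'; [lra|]; intro m; apply IH; lra.
      + rewrite Rmult_0_r, exp_0, pow_i by lia; unfold Rdiv.
        rewrite Rmult_0_l, Rmult_0_r; specialize (HX n); lra. }
  intros n t Ht.
  apply (lim_seq_const_le (fun k => X * exp (L * t) + B * ((L * t) ^ k / INR (fact k)))).
  - replace (Finite (X * exp (L * t))) with (Finite (X * exp (L * t) + B * 0))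
      by (f_equal; ring).
    apply is_lim_seq_plus'; [apply is_lim_seq_const|].
    apply is_lim_seq_mult'; [apply is_lim_seq_const | apply pow_fact_lim].
  - intro k; apply H; auto.
Qed.

(** With slow time [w = d t] and [u_n(w) = d^n e^t p_n(t)], where [d^2 = rho],
    the density equations become [u_n' = flow d u n]: the load survives only in
    the diagonal term. *)
Definition flow (d : R) (f : nat -> R) (n : nat) : R :=
  (INR n * f (pred n) - d * f n + f (S n)) / (INR n + 1).

Definition solution (d : R) (u : nat -> R -> R) : Prop :=
  forall n t, 0 <= t -> is_derive (u n) t (flow d (fun k => u k t) n).

(** Solutions are only required to grow geometrically in [n], with constants
    that may depend on the time horizon. *)
Definition tame (u : nat -> R -> R) : Prop :=
  forall T, 0 <= T -> exists B r, 0 <= B /\ 1 <= r /\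
    forall n t, 0 <= t <= T -> Rabs (u n t) <= B * r ^ n.

Lemma tame_geo u t : tame u -> 0 <= t -> geo (fun n => u n t).
Proof.
  intros Hu Ht; destruct (Hu t Ht) as (B & r & HB & Hr & H).
  exists B, r; repeat split; auto; intro n; apply H; lra.
Qed.

Definition eigenvector (d l : R) (f : nat -> R) : Prop :=
  geo f /\ forall n, flow d f n = l * f n.

Lemma eigenvector_solution d l f :
  eigenvector d l f -> solution d (fun n t => f n * exp (l * t)).
Proof.
  intros (_ & Hf) n t _.
  replace (flow d (fun k => f k * exp (l * t)) n) with (flow d f n * exp (l * t))
    by (unfold flow; pose proof (INR_succ_pos n); field; lra).
  rewrite Hf; auto_derive; auto; ring.
Qed.

Lemma eigenvector_tame d l f :
  eigenvector d l f -> tame (fun n t => f n * exp (l * t)).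
Proof.
  intros ((B & r & HB & Hr & Hf) & _) T HT.
  exists (B * exp (Rabs l * T)), r; repeat split; auto.
  - apply Rmult_le_pos; auto; left; apply exp_pos.
  - intros n t Ht; rewrite Rabs_mult, (Rabs_pos_eq (exp _)) by (left; apply exp_pos).
    replace (B * exp (Rabs l * T) * r ^ n) with (B * r ^ n * exp (Rabs l * T)) by ring.
    apply Rmult_le_compat; auto using Rabs_pos; [left; apply exp_pos|].
    apply exp_le; pose proof (Rle_abs l); pose proof (Rabs_pos l); nra.
Qed.

Lemma solution_shift d u T :
  0 <= T -> solution d u -> solution d (fun n t => u n (T + t)).
Proof.
  intros HT Hu n t Ht.
  pose proof (Hu n (T + t) ltac:(lra)) as Hd.
  evar_last.
  - apply (is_derive_comp (u n) (fun t => T + t)); [exact Hd|].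
    auto_derive; auto.
  - unfold scal; simpl; unfold mult; simpl; unfold flow; ring.
Qed.

Lemma tame_shift u T : 0 <= T -> tame u -> tame (fun n t => u n (T + t)).
Proof.
  intros HT Hu T' HT'; destruct (Hu (T + T')) as (B & r & HB & Hr & H); [lra|].
  exists B, r; repeat split; auto; intros; apply H; lra.
Qed.

(** Discrete Green formula: for the weight [wt] the off-diagonal parts of the two
    flows cancel in pairs, which leaves a Wronskian at the cut-off [N] and the
    difference of the diagonal terms. *)
Lemma wronskian_sum (d d' : R) (f g : nat -> R) (N : nat) :
  sum_n (fun n => wt n * (- flow d f n * g n + f n * flow d' g n)) N
  = (f N * g (S N) - f (S N) * g N) / INR (fact N)
    + (d - d') * sum_n (fun n => f n * g n / INR (fact n)) N.
Proof.
  induction N as [|N IH].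
  - rewrite !sum_O; unfold wt, flow; simpl; in_R; field.
  - rewrite !sum_n_succ, IH.
    unfold wt, flow; rewrite fact_S_INR, S_INR; cbn [pred].
    pose proof (fact_pos N); pose proof (pos_INR N).
    in_R; field; lra.
Qed.

(** The derivative in [s] of the pairing of [u(T - s)] with [v(s)] is given by
    [wronskian_sum].  Working with truncated sums avoids differentiating under
    an infinite sum: the Wronskian at level [N] is at most a power over [N!] and
    disappears as [N] grows.  Unequal parameters [d], [d'] are allowed in order
    to compare a small load with load zero. *)
Lemma pairing (d d' D T : R) (u v : nat -> R -> R) :
  0 <= T -> solution d u -> solution d' v -> tame u -> tame v ->
  (forall N s, 0 <= s <= T ->
     Rabs (sum_n (fun n => u n (T - s) * v n s / INR (fact n)) N) <= D) ->
  Rabs (ip (fun n => u n T) (fun n => v n 0) - ip (fun n => u n 0) (fun n => v n T))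
    <= T * (Rabs (d - d') * D).
Proof.
  intros HT Hu Hv Tu Tv HD.
  destruct (Tu T HT) as (B & r & HB & Hr & Bu).
  destruct (Tv T HT) as (B' & r' & HB' & Hr' & Bv).
  set (F := fun N s => sum_n (fun n => wt n * (u n (T - s) * v n s)) N).
  (* Bound for the Wronskian at the cut-off [N]. *)
  set (eps := fun N => B * B' * (r + r') * ((r * r') ^ N / INR (fact N))).
  assert (HF : forall N, Rabs (F N T - F N 0) <= T * (eps N + Rabs (d - d') * D)).
  { intro N.
    apply (derive_bounded (F N) (fun s => sum_n (fun n => wt n *
       (- flow d (fun k => u k (T - s)) n * v n s
        + u n (T - s) * flow d' (fun k => v k s) n)) N)); auto.
    - intros s Hs.
      apply (is_derive_sum_n (fun n s => wt n * (u n (T - s) * v n s))).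
      intros n _.
      pose proof (Hu n (T - s) ltac:(lra)) as Hdu.
      pose proof (Hv n s ltac:(lra)) as Hdv.
      apply is_derive_scal.
      apply (is_derive_mult (fun s => u n (T - s)) (v n)); auto.
      + evar_last.
        * apply (is_derive_comp (u n) (fun s => T - s)); [exact Hdu|].
          auto_derive; auto.
        * unfold scal; simpl; unfold mult; simpl; ring.
      + intros; apply Rmult_comm.
    - intros s Hs; rewrite (wronskian_sum d d' (fun k => u k (T - s)) (fun k => v k s)).
      eapply Rle_trans; [apply Rabs_triang|]; apply Rplus_le_compat.
      + unfold eps, Rdiv; rewrite Rabs_mult, Rabs_inv, (Rabs_pos_eq (INR _))
          by (left; apply fact_pos).
        rewrite <- (Rmult_assoc (B * B' * (r + r'))).
        apply Rmult_le_compat_r.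
        { left; apply Rinv_0_lt_compat, fact_pos. }
        pose proof (Bu N (T - s) ltac:(lra)) as H1.
        pose proof (Bu (S N) (T - s) ltac:(lra)) as H2.
        pose proof (Bv N s ltac:(lra)) as H3.
        pose proof (Bv (S N) s ltac:(lra)) as H4.
        pose proof (Rabs_pos (u N (T - s))); pose proof (Rabs_pos (u (S N) (T - s))).
        pose proof (Rabs_pos (v N s)); pose proof (Rabs_pos (v (S N) s)).
        eapply Rle_trans; [apply Rabs_triang|]; rewrite Rabs_Ropp, !Rabs_mult.
        replace (B * B' * (r + r') * (r * r') ^ N)
          with ((B * r ^ N) * (B' * r' ^ S N) + (B * r ^ S N) * (B' * r' ^ N))
          by (rewrite Rpow_mult_distr; simpl; ring).
        apply Rplus_le_compat; apply Rmult_le_compat; auto.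
      + rewrite Rabs_mult; apply Rmult_le_compat_l; [apply Rabs_pos|].
        apply HD; lra. }
  assert (HF0 : is_lim_seq (fun N => F N 0) (ip (fun n => u n T) (fun n => v n 0))).
  { apply is_lim_seq_ext with
      (fun N => sum_n (fun n => wt n * (u n T * v n 0)) N).
    - intro N; unfold F; apply sum_n_ext; intro n; now rewrite Rminus_0_r.
    - apply (Series_correct (fun n => wt n * (u n T * v n 0))).
      apply (ip_summable (fun n => u n T) (fun n => v n 0)); apply tame_geo; auto; lra. }
  assert (HFT : is_lim_seq (fun N => F N T) (ip (fun n => u n 0) (fun n => v n T))).
  { apply is_lim_seq_ext with
      (fun N => sum_n (fun n => wt n * (u n 0 * v n T)) N).
    - intro N; unfold F; apply sum_n_ext; intro n; now rewrite Rminus_diag.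
    - apply (Series_correct (fun n => wt n * (u n 0 * v n T))).
      apply (ip_summable (fun n => u n 0) (fun n => v n T)); apply tame_geo; auto; lra. }
  rewrite Rabs_minus_sym.
  refine (is_lim_seq_le _ _ (Rabs (_ - _)) (T * (Rabs (d - d') * D)) HF _ _).
  - apply is_lim_seq_abs with (l := Finite _).
    now apply is_lim_seq_minus'.
  - replace (T * (Rabs (d - d') * D)) with
      (T * (B * B' * (r + r') * 0 + Rabs (d - d') * D)) by ring.
    apply is_lim_seq_mult'; [apply is_lim_seq_const|].
    apply is_lim_seq_plus'; [|apply is_lim_seq_const].
    apply is_lim_seq_mult'; [apply is_lim_seq_const | apply pow_fact_lim].
Qed.

Lemma pairing_sym (d T : R) (u v : nat -> R -> R) :
  0 <= T -> solution d u -> solution d v -> tame u -> tame v ->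
  ip (fun n => u n T) (fun n => v n 0) = ip (fun n => u n 0) (fun n => v n T).
Proof.
  intros HT Hu Hv Tu Tv.
  destruct (Tu T HT) as (B & r & HB & Hr & Bu).
  destruct (Tv T HT) as (B' & r' & HB' & Hr' & Bv).
  assert (HD : forall N s, 0 <= s <= T ->
     Rabs (sum_n (fun n => u n (T - s) * v n s / INR (fact n)) N)
       <= B * B' * exp (r * r')).
  { intros N s Hs.
    eapply Rle_trans; [apply (norm_sum_n_m (V := R_NormedModule))|].
    apply Rle_trans with (sum_n (fun n => B * B' * ((r * r') ^ n / INR (fact n))) N).
    - apply sum_n_m_le; intro n; unfold norm; simpl; unfold abs; simpl.
      unfold Rdiv; rewrite !Rabs_mult, Rabs_inv, (Rabs_pos_eq (INR _))
        by (left; apply fact_pos).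
      rewrite <- Rmult_assoc; apply Rmult_le_compat_r.
      + left; apply Rinv_0_lt_compat, fact_pos.
      + replace (B * B' * (r * r') ^ n) with ((B * r ^ n) * (B' * r' ^ n))
          by (rewrite Rpow_mult_distr; ring).
        apply Rmult_le_compat; auto using Rabs_pos; apply Bu; lra.
    - rewrite (sum_n_mult_l (K := R_AbsRing) (B * B')).
      change (@mult R_AbsRing) with Rmult; apply Rmult_le_compat_l; [nra|].
      apply partial_sum_le; [|apply exp_series].
      intro n; apply Rdiv_le_0_compat; [apply pow_le; nra | apply fact_pos]. }
  pose proof (pairing d d _ T u v HT Hu Hv Tu Tv HD) as H.
  rewrite Rminus_diag, Rabs_R0, Rmult_0_l, Rmult_0_r in H.
  pose proof (Rabs_pos (ip (fun n => u n T) (fun n => v n 0)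
     - ip (fun n => u n 0) (fun n => v n T))).
  apply Rminus_diag_uniq; destruct (Req_dec (ip (fun n => u n T) (fun n => v n 0)
     - ip (fun n => u n 0) (fun n => v n T)) 0) as [|Hn]; auto.
  apply Rabs_pos_lt in Hn; lra.
Qed.

Lemma derive_zero (f : R -> R) (T : R) :
  0 <= T -> (forall t, 0 <= t <= T -> is_derive f t 0) -> f T = f 0.
Proof.
  intros HT Hd.
  pose proof (derive_bounded f (fun _ => 0) T 0 HT Hd) as H.
  rewrite Rmult_0_r, Rabs_R0 in H; specialize (H ltac:(intros; lra)).
  pose proof (Rabs_pos (f T - f 0)).
  apply Rminus_diag_uniq; destruct (Req_dec (f T - f 0) 0) as [|Hn]; auto.
  apply Rabs_pos_lt in Hn; lra.
Qed.

(** * The ground state and two-sided bounds *)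

(** Ground state representation.  Since [d = / l - l], the quadratic form of
    [flow d - l] is minus the sum of the squares
    [(f n - l f (n + 1))^2 / (n! l)], up to a boundary term at the cut-off; the
    squares vanish on [f n = l^-n]. *)
Lemma dirichlet_sum (d l : R) (f : nat -> R) (N : nat) :
  0 < l -> l ^ 2 + d * l = 1 ->
  sum_n (fun n => wt n * (f n * (flow d f n - l * f n))) N
  <= (l * f (S N) ^ 2 - f N * f (S N)) / INR (fact N).
Proof.
  intros Hl Heq.
  assert (Hd : d = / l - l) by (apply Rmult_eq_reg_r with l; [field_simplify; lra | lra]).
  induction N as [|N IH].
  - rewrite sum_O; unfold wt, flow; simpl; apply Rminus_le.
    replace (_ - _) with (- (/ l * (f 0%nat - l * f 1%nat) ^ 2)).
    + pose proof (pow2_ge_0 (f 0%nat - l * f 1%nat)); pose proof (Rinv_0_lt_compat l Hl); nra.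
    + rewrite Hd; in_R; field; lra.
  - rewrite sum_n_succ; apply Rle_trans with
      ((l * f (S N) ^ 2 - f N * f (S N)) / INR (fact N)
       + wt (S N) * (f (S N) * (flow d f (S N) - l * f (S N)))); [lra|].
    apply Rminus_le.
    replace (_ - _) with (- (/ l * (f (S N) - l * f (S (S N))) ^ 2 / INR (fact (S N)))).
    + pose proof (pow2_ge_0 (f (S N) - l * f (S (S N)))).
      pose proof (Rinv_0_lt_compat l Hl); pose proof (fact_pos (S N)).
      assert (0 <= / l * (f (S N) - l * f (S (S N))) ^ 2 / INR (fact (S N)));
        [apply Rdiv_le_0_compat; nra | lra].
    + unfold wt, flow; rewrite fact_S_INR, S_INR, Hd; cbn [pred].
      pose proof (fact_pos N); pose proof (pos_INR N).
      in_R; field; lra.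
Qed.

Lemma energy_rate_sum (l : R) (f g : nat -> R) (N : nat) :
  sum_n (fun n => wt n * (g n * f n + f n * g n)) N
  = 2 * sum_n (fun n => wt n * (f n * (g n - l * f n))) N
    + 2 * l * sum_n (fun n => wt n * (f n * f n)) N.
Proof.
  induction N as [|N IH]; [rewrite !sum_O; in_R; ring|].
  rewrite !sum_n_succ, IH; in_R; ring.
Qed.

(** No solution grows faster in norm than the ground state, because the
    quadratic form in [dirichlet_sum] is nonpositive. *)
Lemma energy_decay (d l T : R) (u : nat -> R -> R) :
  0 < l -> l ^ 2 + d * l = 1 -> 0 <= T -> solution d u -> tame u ->
  ip (fun n => u n T) (fun n => u n T)
    <= exp (2 * l * T) * ip (fun n => u n 0) (fun n => u n 0).
Proof.
  intros Hl Heq HT Hu Tu.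
  destruct (Tu T HT) as (B & r & HB & Hr & Bu).
  set (F := fun N s => exp (- (2 * l * s)) * sum_n (fun n => wt n * (u n s * u n s)) N).
  (* Bound for the boundary term of [dirichlet_sum]. *)
  set (eps := fun N => B ^ 2 * (l * r ^ 2 + r) * ((r ^ 2) ^ N / INR (fact N))).
  assert (HF : forall N, F N T <= F N 0 + 2 * eps N * T).
  { intro N.
    assert (H : 2 * eps N * 0 - F N 0 <= 2 * eps N * T - F N T); [|lra].
    apply (derive_nonneg_le (fun s => 2 * eps N * s - F N s)
      (fun s => 2 * eps N - 2 * exp (- (2 * l * s)) *
         sum_n (fun n => wt n * (u n s * (flow d (fun k => u k s) n - l * u n s))) N)); auto.
    - intros s Hs.
      apply (is_derive_minus (V := R_NormedModule)); [auto_derive; auto; ring|].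
      evar_last.
      + apply (is_derive_mult (fun s => exp (- (2 * l * s)))
          (fun s => sum_n (fun n => wt n * (u n s * u n s)) N)).
        * auto_derive; auto.
        * apply (is_derive_sum_n (fun n s => wt n * (u n s * u n s))).
          intros n _; apply is_derive_scal.
          pose proof (Hu n s (proj1 Hs)) as Hd.
          apply (is_derive_mult (u n) (u n) s _ _ Hd Hd Rmult_comm).
        * exact Rmult_comm.
      + set (e := exp (- (2 * l * s))).
        change (- (2 * l * 1) * e * sum_n (fun n => wt n * (u n s * u n s)) N
          + e * sum_n (fun n => wt n * (flow d (fun k => u k s) n * u n s
              + u n s * flow d (fun k => u k s) n)) N
          = 2 * e * sum_n (fun n => wt n *
              (u n s * (flow d (fun k => u k s) n - l * u n s))) N).
        rewrite (energy_rate_sum l (fun k => u k s)); ring.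
    - intros s Hs.
      pose proof (dirichlet_sum d l (fun k => u k s) N Hl Heq) as H.
      assert (Hb : (l * u (S N) s ^ 2 - u N s * u (S N) s) / INR (fact N) <= eps N).
      { unfold eps, Rdiv; rewrite <- Rmult_assoc; apply Rmult_le_compat_r.
        { left; apply Rinv_0_lt_compat, fact_pos. }
        pose proof (Bu N s Hs) as H1; pose proof (Bu (S N) s Hs) as H2.
        pose proof (Rabs_pos (u N s)); pose proof (Rabs_pos (u (S N) s)).
        apply Rle_trans with (l * (B * r ^ S N) ^ 2 + (B * r ^ N) * (B * r ^ S N)).
        - apply Rplus_le_compat.
          + apply Rmult_le_compat_l; [lra|]; rewrite <- (pow2_abs (u (S N) s)).
            apply pow_incr; lra.
          + eapply Rle_trans; [apply Rle_abs|].
            rewrite Rabs_Ropp, Rabs_mult; apply Rmult_le_compat; auto.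
        - right; rewrite <- pow_mult, (Nat.mul_comm 2), pow_mult; simpl; ring. }
      pose proof (exp_pos (- (2 * l * s))).
      assert (exp (- (2 * l * s)) <= 1) by (rewrite <- exp_0; apply exp_le; nra).
      assert (0 <= eps N).
      { apply Rmult_le_pos; [apply Rmult_le_pos; nra|].
        apply Rdiv_le_0_compat; [apply pow_le; nra | apply fact_pos]. }
      assert (HX : forall X, X <= eps N -> 0 <= 2 * eps N - 2 * exp (- (2 * l * s)) * X).
      { intros X HX; assert (exp (- (2 * l * s)) * X <= exp (- (2 * l * s)) * eps N);
          nra. }
      apply HX, (Rle_trans _ _ _ H Hb). }
  assert (HL : forall s, 0 <= s <= T -> is_lim_seq (fun N => F N s)
     (exp (- (2 * l * s)) * ip (fun n => u n s) (fun n => u n s))).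
  { intros s Hs; apply is_lim_seq_mult'; [apply is_lim_seq_const|].
    apply (Series_correct (fun n => wt n * (u n s * u n s))).
    apply (ip_summable (fun n => u n s) (fun n => u n s)); apply tame_geo; auto; lra. }
  assert (H : exp (- (2 * l * T)) * ip (fun n => u n T) (fun n => u n T)
    <= exp (- (2 * l * 0)) * ip (fun n => u n 0) (fun n => u n 0)
       + 2 * (B ^ 2 * (l * r ^ 2 + r) * 0) * T).
  { refine (is_lim_seq_le _ _ (Finite _) (Finite _) HF (HL T _) _); [lra|].
    apply is_lim_seq_plus'; [apply HL; lra|].
    apply is_lim_seq_mult'; [|apply is_lim_seq_const].
    apply is_lim_seq_mult'; [apply is_lim_seq_const|].
    apply is_lim_seq_mult'; [apply is_lim_seq_const | apply pow_fact_lim]. }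
  replace (- (2 * l * 0)) with 0 in H by ring; rewrite exp_0, exp_Ropp in H.
  pose proof (exp_pos (2 * l * T)) as He.
  apply Rmult_le_compat_l with (r := exp (2 * l * T)) in H; [|lra].
  rewrite <- Rmult_assoc, Rinv_r in H by lra; lra.
Qed.

(** The largest eigenvalue of the slow-time system, that is the positive root of
    [l^2 + d l = 1]; [Lambda0 rho] is [sqrt rho * rate (sqrt rho)]. *)
Definition rate (d : R) : R := (sqrt (d ^ 2 + 4) - d) / 2.

Lemma rate_pos d : 0 < rate d.
Proof.
  unfold rate; assert (d < sqrt (d ^ 2 + 4)); [|lra].
  apply Rle_lt_trans with (Rabs d); [apply Rle_abs|].
  rewrite <- sqrt_Rsqr_abs; unfold Rsqr; apply sqrt_lt_1; nra.
Qed.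

Lemma rate_eq d : rate d ^ 2 + d * rate d = 1.
Proof.
  unfold rate; assert (H : sqrt (d ^ 2 + 4) ^ 2 = d ^ 2 + 4).
  { rewrite <- Rsqr_pow2; apply Rsqr_sqrt; nra. }
  nra.
Qed.

Lemma rate_lt_1 d : 0 < d -> rate d < 1.
Proof. intro; pose proof (rate_pos d); pose proof (rate_eq d); nra. Qed.

Lemma rate_inv_sq d : (/ rate d) ^ 2 = 1 + d / rate d.
Proof.
  pose proof (rate_pos d); pose proof (rate_eq d).
  apply Rmult_eq_reg_r with (rate d ^ 2); [field_simplify; nra | nra].
Qed.

Lemma ground_eigenvector (d : R) : eigenvector d (rate d) (fun n => (/ rate d) ^ n).
Proof.
  split; [apply geo_pow|]; intro n.
  pose proof (rate_pos d) as Hl; pose proof (rate_eq d) as Heq; set (l := rate d) in *.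
  assert (Hd : d = / l - l) by (apply Rmult_eq_reg_r with l; [field_simplify; lra | lra]).
  unfold flow; rewrite Hd.
  destruct n as [|n]; cbn [pred pow].
  - simpl INR; field; lra.
  - rewrite S_INR; pose proof (pos_INR n); field; lra.
Qed.

(** The rescaled conditional densities of the queue with load [d^2].  The bound
    [B d^n] records that the densities themselves are bounded. *)
Definition queue (d : R) (u : nat -> R -> R) : Prop :=
  solution d u /\
  (forall T, 0 <= T -> exists B, 0 <= B /\
     forall n t, 0 <= t <= T -> Rabs (u n t) <= B * d ^ n) /\
  (forall n, u n 0 = d ^ n / (INR n + 1)).

(** Because [u_n(0) = d^n / (n + 1)], this pairing is the Poisson average that
    defines [pPS], up to the factor [e^(- rho - t)]; see [mass_series]. *)
Definition mass (u : nat -> R -> R) (t : R) : R := ip (fun n => u n 0) (fun n => u n t).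

Lemma queue_tame d u : 0 < d -> queue d u -> tame u.
Proof.
  intros Hd (_ & Hb & _) T HT; destruct (Hb T HT) as (B & HB & H).
  exists B, (1 + d); repeat split; auto; [lra|].
  intros n t Ht; eapply Rle_trans; [now apply H|].
  apply Rmult_le_compat_l; auto; apply pow_incr; lra.
Qed.

Lemma mass_series d u t :
  queue d u -> mass u t = Series (fun n => d ^ n / INR (fact n) * u n t).
Proof.
  intros (_ & _ & H0); apply Series_ext; intro n.
  rewrite H0; unfold wt; pose proof (fact_pos n); pose proof (INR_succ_pos n).
  field; lra.
Qed.

Lemma ip_initial_pow d c u :
  queue d u -> ip (fun n => u n 0) (fun n => c ^ n) = exp (d * c).
Proof.
  intros (_ & _ & H0); apply is_series_unique.
  apply is_series_ext with (fun n => (d * c) ^ n / INR (fact n)); [|apply exp_series].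
  intro n; rewrite H0, Rpow_mult_distr; unfold wt.
  pose proof (fact_pos n); pose proof (INR_succ_pos n); in_R; field; lra.
Qed.

Lemma ip_pow c c' : ip (fun n => c ^ n) (fun n => c' ^ n) = (1 + c * c') * exp (c * c').
Proof.
  apply is_series_unique, is_series_ext with (fun n => wt n * (c * c') ^ n);
    [|apply wt_series].
  intro n; now rewrite Rpow_mult_distr.
Qed.

(** The ground state component evolves by a pure exponential, by symmetry of the
    pairing with the explicit solution [l^-n e^(l t)]. *)
Lemma queue_ground d u t : 0 < d -> queue d u -> 0 <= t ->
  ip (fun n => u n t) (fun n => (/ rate d) ^ n) = exp (d / rate d) * exp (rate d * t).
Proof.
  intros Hd Hq Ht; set (f := fun n => (/ rate d) ^ n).
  pose proof (ground_eigenvector d) as Hf; fold f in Hf.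
  transitivity (ip (fun n => u n t) (fun n => f n * exp (rate d * 0))).
  { apply ip_ext; intro n; auto; rewrite Rmult_0_r, exp_0; ring. }
  rewrite (pairing_sym d t u (fun n t => f n * exp (rate d * t)) Ht).
  - transitivity (exp (rate d * t) * ip f (fun n => u n 0)).
    { rewrite ip_comm, <- ip_scal_l; apply ip_ext; intro n; auto; ring. }
    rewrite ip_comm; unfold f; rewrite (ip_initial_pow d); auto; unfold Rdiv; ring.
  - apply Hq.
  - now apply eigenvector_solution.
  - apply (queue_tame d); auto.
  - now apply (eigenvector_tame d).
Qed.

(** Moving half of the elapsed time onto the other factor of the pairing turns
    [mass] into a squared norm, which makes it accessible to the Cauchy-Schwarz
    inequality and to the energy estimate. *)
Lemma mass_double d u t : 0 < d -> queue d u -> 0 <= t ->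
  mass u (2 * t) = ip (fun n => u n t) (fun n => u n t).
Proof.
  intros Hd Hq Ht; pose proof (queue_tame d u Hd Hq) as Tu; destruct Hq as (Hu & _).
  pose proof (pairing_sym d t u (fun n s => u n (t + s)) Ht Hu
    (solution_shift d u t Ht Hu) Tu (tame_shift u t Ht Tu)) as H.
  unfold mass; replace (2 * t) with (t + t) by ring.
  rewrite <- H; apply ip_ext; intro; auto; now rewrite Rplus_0_r.
Qed.

(** The squared ground state component of the initial vector, divided by the
    squared norm of the ground state: the coefficient of [e^(l t)] in [mass]. *)
Definition ground_weight (d : R) : R := exp (d / rate d - 1) / (2 + d / rate d).

Lemma ground_weight_pos d : 0 < d -> 0 < ground_weight d.
Proof.
  intro Hd; pose proof (rate_pos d).
  apply Rdiv_lt_0_compat; [apply exp_pos|].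
  pose proof (Rdiv_lt_0_compat d (rate d)); lra.
Qed.

(** The squared norm dominates the contribution of the ground state alone. *)
Lemma mass_lower d u t : 0 < d -> queue d u -> 0 <= t ->
  ground_weight d * exp (rate d * t) <= mass u t.
Proof.
  intros Hd Hq Ht.
  replace t with (2 * (t / 2)) by field; set (s := t / 2).
  assert (Hs : 0 <= s) by (unfold s; lra).
  rewrite (mass_double d u s Hd Hq Hs).
  pose proof (ip_cauchy_schwarz (fun n => u n s) (fun n => (/ rate d) ^ n)
    (tame_geo u s (queue_tame d u Hd Hq) Hs) (geo_pow _)) as H.
  rewrite (queue_ground d u s Hd Hq Hs), ip_pow in H.
  replace (/ rate d * / rate d) with (1 + d / rate d) in H
    by (rewrite <- rate_inv_sq; ring).
  pose proof (rate_pos d) as Hl; pose proof (Rdiv_lt_0_compat d (rate d) Hd Hl) as Hx.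
  unfold ground_weight; set (x := d / rate d) in *.
  set (M := ip _ _) in *.
  replace ((exp x * exp (rate d * s)) ^ 2)
    with (exp (x - 1) * exp (rate d * (2 * s)) * exp (1 + x)) in H.
  - pose proof (exp_pos (1 + x)).
    apply Rmult_le_reg_r with ((2 + x) * exp (1 + x)); [nra|].
    replace (M * ((2 + x) * exp (1 + x))) with (M * ((1 + (1 + x)) * exp (1 + x))) by ring.
    eapply Rle_trans; [right|exact H]; field; lra.
  - simpl; rewrite Rmult_1_r, <- !exp_plus; f_equal; ring.
Qed.

Lemma mass_upper d u t : 0 < d -> queue d u -> 0 <= t ->
  mass u t <= mass u 0 * exp (rate d * t).
Proof.
  intros Hd Hq Ht.
  replace t with (2 * (t / 2)) by field; set (s := t / 2).
  assert (Hs : 0 <= s) by (unfold s; lra).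
  rewrite (mass_double d u s Hd Hq Hs).
  eapply Rle_trans;
    [apply (energy_decay d (rate d)); auto using rate_pos, rate_eq;
     [apply Hq | apply (queue_tame d); auto]|].
  unfold mass; right; rewrite Rmult_comm; do 2 f_equal; ring.
Qed.

Lemma mass_initial d u : 0 < d -> queue d u -> mass u 0 = (exp (d ^ 2) - 1) / d ^ 2.
Proof.
  intros Hd (_ & _ & H0); apply is_series_unique.
  apply is_series_ext with (fun n => scal (/ d ^ 2) ((d ^ 2) ^ S n / INR (fact (S n)))).
  - intro n; rewrite !H0, fact_S_INR; unfold scal, wt; simpl; unfold mult; simpl.
    rewrite Rmult_1_r, Rpow_mult_distr.
    pose proof (fact_pos n); pose proof (INR_succ_pos n); in_R; field; lra.
  - unfold Rdiv; rewrite Rmult_comm.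
    apply (is_series_scal_l (V := R_NormedModule) (/ d ^ 2)
      (fun n => (d ^ 2) ^ S n / INR (fact (S n)))).
    apply (is_series_incr_1 (V := R_NormedModule) (fun n => (d ^ 2) ^ n / INR (fact n))).
    replace (plus _ _) with (exp (d ^ 2)); [apply exp_series|].
    unfold plus; simpl; field.
Qed.

(** * The spectral gap *)

(** The row sums of the system for the differences [df] below, measured in the
    geometric weight [s^n] and with [k = n + 1].  With [s = 1] they would only be
    below [1 + a] by a quantity of order [/ n^2]; a ratio [s] slightly above one
    yields a gap uniform in [n]. *)
Lemma drift_bound (a e s k : R) :
  0 < a -> e = / (1 + a ^ 2) -> s = 1 + e -> 1 <= k ->
  a * s / (k + 1) + (k - 1) / (k * s) + (1 + a - k / (k + 1) - a / k)
    <= 1 + a - e / 8.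
Proof.
  intros Ha He Hs Hk.
  assert (He0 : 0 < e) by (rewrite He; apply Rinv_0_lt_compat; nra).
  (* This choice of [e] makes [e (a k - k^2 / 4 + 1 / 2) <= 1 + a] for every [k]. *)
  assert (He1 : e * (1 + a ^ 2) = 1) by (rewrite He; apply Rinv_l; nra).
  assert (He2 : e <= 1) by nra.
  (* [1 / (1 + e) <= 1 - e / 2] for [0 <= e <= 1]. *)
  assert (H1 : (k - 1) / (k * s) <= (k - 1) / k * (1 - e / 2)).
  { replace ((k - 1) / (k * s)) with ((k - 1) / k * / s) by (field; nra).
    apply Rmult_le_compat_l; [apply Rdiv_le_0_compat; lra|].
    apply Rmult_le_reg_r with s; [lra|]; rewrite Rinv_l by lra; nra. }
  enough (H2 : a * s / (k + 1) + (k - 1) / k * (1 - e / 2) - k / (k + 1) - a / k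
               <= - (e / 8)) by lra.
  assert (Hkk : 0 < k * (k + 1)) by nra.
  apply Rmult_le_reg_r with (k * (k + 1)); auto.
  replace ((a * s / (k + 1) + (k - 1) / k * (1 - e / 2) - k / (k + 1) - a / k)
            * (k * (k + 1)))
    with (a * s * k + (k ^ 2 - 1) * (1 - e / 2) - k ^ 2 - a * (k + 1))
    by (field; lra).
  rewrite Hs.
  assert (e * (a * k - k ^ 2 / 4) <= e * a ^ 2).
  { apply Rmult_le_compat_l; [lra|]; pose proof (pow2_ge_0 (k / 2 - a)); nra. }
  assert (e * (k * (k + 1)) <= e * (2 * k ^ 2)) by (apply Rmult_le_compat_l; nra).
  nra.
Qed.

Section Gap.

Context (d : R) (u : nat -> R -> R) (Hd : 0 < d) (Hq : queue d u).

Let l := rate d.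
Let a := (/ l) ^ 2.
Let e := / (1 + a ^ 2).
Let s := 1 + e.
Let K := l * (1 + a).

(** Dividing by the ground state [l^-n e^(l t)] gives [y], which solves a
    backward equation without killing.  The differences [df] obey a cooperative
    system again, and [x] measures them in the weight [s^n]; the factor
    [e^(K t)] makes all coefficients of the system for [x] nonnegative, so that
    [comparison] applies. *)
Let y n t := l ^ n * exp (- (l * t)) * u n t.
Let df n t := y (S n) t - y n t.
Let x n t := exp (K * t) * (df n t / s ^ n).

Let Hl : 0 < l.
Proof. apply rate_pos. Qed.

Let Hl1 : l * d < 1.
Proof. pose proof (rate_eq d); fold l in H; nra. Qed.

Let Ha : 0 < a.
Proof. apply pow_lt, Rinv_0_lt_compat, Hl. Qed.

Let He : 0 < e.
Proof. apply Rinv_0_lt_compat; nra. Qed.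

Let He1 : e <= 1.
Proof. unfold e; rewrite <- Rinv_1; apply Rinv_le_contravar; nra. Qed.

Let Hs : 1 < s.
Proof. unfold s; lra. Qed.

Let y_derive n t : 0 <= t ->
  is_derive (y n) t (l * (a * df n t - INR n * df (pred n) t) / (INR n + 1)).
Proof.
  intro Ht; destruct Hq as (Hu & _).
  assert (Hdl : d = / l - l).
  { pose proof (rate_eq d) as H; fold l in H.
    apply Rmult_eq_reg_r with l; [field_simplify; lra | lra]. }
  evar_last.
  - apply (is_derive_mult (fun t => l ^ n * exp (- (l * t))) (u n) t
      (l ^ n * (- l * exp (- (l * t)))) (flow d (fun k => u k t) n)); [auto_derive; auto; ring | now apply Hu |].
    exact Rmult_comm.
  - unfold plus, mult; simpl; unfold flow, df, y, a; rewrite Hdl.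
    destruct n as [|n]; cbn [pred pow].
    + simpl INR; field; lra.
    + rewrite S_INR; pose proof (pos_INR n); field; lra.
Qed.

Let x' n t := l * ((1 + a - (INR n + 1) / (INR n + 1 + 1) - a / (INR n + 1)) * x n t
  + a * s / (INR n + 1 + 1) * x (S n) t
  + (INR n + 1 - 1) / ((INR n + 1) * s) * x (pred n) t).

Let x_derive n t : 0 <= t -> is_derive (x n) t (x' n t).
Proof.
  intro Ht.
  evar_last.
  - apply (is_derive_mult (fun t => exp (K * t)) (fun t => df n t / s ^ n) t
      (K * exp (K * t))
      ((l * (a * df (S n) t - INR (S n) * df n t) / (INR (S n) + 1)
       - l * (a * df n t - INR n * df (pred n) t) / (INR n + 1)) / s ^ n)).
    + auto_derive; auto; ring.
    + apply is_derive_ext with (fun t => / s ^ n * (y (S n) t - y n t)).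
      { intro; unfold df, Rdiv; in_R; ring. }
      evar_last.
      * apply is_derive_scal, (is_derive_minus (V := R_NormedModule));
          apply y_derive; auto.
      * unfold minus, plus, opp; simpl; unfold Rdiv; ring.
    + exact Rmult_comm.
  - match goal with |- @eq _ (plus (mult ?p ?q) (mult ?v ?w)) ?r =>
      change (p * q + v * w = r) end.
    unfold x', x, K; rewrite S_INR.
    assert (s ^ n <> 0) by (apply pow_nonzero; lra).
    destruct n as [|n]; cbn [pred].
    + simpl; field; lra.
    + rewrite S_INR; pose proof (pos_INR n).
      assert (s ^ n <> 0) by (apply pow_nonzero; lra).
      cbn [pow]; field; repeat split; auto; lra.
Qed.

Let x_bounded T : 0 <= T ->
  exists B, forall n t, 0 <= t <= T -> Rabs (x n t) <= B.
Proof.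
  intro HT; destruct Hq as (_ & Hb & _); destruct (Hb T HT) as (B & HB & H).
  assert (Hy : forall n t, 0 <= t <= T -> Rabs (y n t) <= B).
  { intros n t Ht; unfold y; rewrite !Rabs_mult.
    rewrite (Rabs_pos_eq (l ^ n)) by (apply pow_le; lra).
    rewrite (Rabs_pos_eq (exp _)) by (left; apply exp_pos).
    specialize (H n t Ht).
    assert (exp (- (l * t)) <= 1) by (rewrite <- exp_0; apply exp_le; nra).
    assert ((l * d) ^ n <= 1 ^ n) by (apply pow_incr; nra); rewrite pow1 in *.
    rewrite Rpow_mult_distr in *.
    pose proof (exp_pos (- (l * t))); pose proof (Rabs_pos (u n t)).
    assert (0 < l ^ n) by (apply pow_lt; lra).
    apply Rle_trans with (l ^ n * 1 * (B * d ^ n)); [|nra].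
    apply Rmult_le_compat; auto; nra. }
  exists (exp (K * T) * (2 * B)); intros n t Ht; unfold x.
  rewrite Rabs_mult, (Rabs_pos_eq (exp _)) by (left; apply exp_pos).
  apply Rmult_le_compat; auto using Rabs_pos.
  - left; apply exp_pos.
  - apply exp_le; unfold K; apply Rmult_le_compat_l; nra.
  - unfold Rdiv; rewrite Rabs_mult, Rabs_inv, (Rabs_pos_eq (s ^ n)) by (apply pow_le; lra).
    pose proof (Hy n t Ht); pose proof (Hy (S n) t Ht).
    assert (Rabs (df n t) <= 2 * B).
    { unfold df, Rminus; eapply Rle_trans; [apply Rabs_triang|]; rewrite Rabs_Ropp; lra. }
    assert (1 <= s ^ n) by (apply pow_R1_Rle; lra).
    assert (/ s ^ n <= 1) by (rewrite <- Rinv_1; apply Rinv_le_contravar; lra).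
    assert (0 < / s ^ n) by (apply Rinv_0_lt_compat; lra).
    pose proof (Rabs_pos (df n t)); nra.
Qed.

Let x_initial n : Rabs (x n 0) <= 1.
Proof.
  destruct Hq as (_ & _ & H0).
  assert (Hy : forall n, 0 <= y n 0 <= 1).
  { intro m; unfold y; rewrite H0, Rmult_0_r, Ropp_0, exp_0.
    pose proof (INR_succ_pos m); pose proof (pos_INR m).
    replace (l ^ m * 1 * (d ^ m / (INR m + 1))) with ((l * d) ^ m / (INR m + 1))
      by (rewrite Rpow_mult_distr; field; lra).
    assert (0 <= (l * d) ^ m) by (apply pow_le; nra).
    assert ((l * d) ^ m <= 1 ^ m) by (apply pow_incr; nra); rewrite pow1 in *.
    split; [apply Rdiv_le_0_compat; lra|].
    apply Rmult_le_reg_r with (INR m + 1); auto; field_simplify; lra. }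
  unfold x; rewrite Rmult_0_r, exp_0, Rmult_1_l.
  unfold Rdiv; rewrite Rabs_mult, Rabs_inv, (Rabs_pos_eq (s ^ n)) by (apply pow_le; lra).
  assert (Rabs (df n 0) <= 1).
  { unfold df; apply Rabs_le; pose proof (Hy n); pose proof (Hy (S n)); lra. }
  assert (1 <= s ^ n) by (apply pow_R1_Rle; lra).
  assert (/ s ^ n <= 1) by (rewrite <- Rinv_1; apply Rinv_le_contravar; lra).
  assert (0 < / s ^ n) by (apply Rinv_0_lt_compat; lra).
  pose proof (Rabs_pos (df n 0)); nra.
Qed.

Let x_growth n t : 0 <= t -> Rabs (x n t) <= exp ((K - l * e / 8) * t).
Proof.
  intro Ht; destruct (x_bounded t Ht) as (B & HB).
  rewrite <- (Rmult_1_l (exp _)).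
  apply (comparison x x' t _ 1 B); auto; [|intros; apply x_derive; lra | |lra].
  - unfold K; assert (0 < l * (1 + a - e / 8)); [apply Rmult_lt_0_compat; lra | lra].
  - intros S r Hr HS m; unfold x'.
    pose proof (pos_INR m) as Hm; set (k := INR m + 1) in *.
    assert (Hk : 1 <= k) by (unfold k; lra).
    pose proof (drift_bound a e s k Ha eq_refl eq_refl Hk) as Hdrift.
    assert (Hc1 : 0 <= 1 + a - k / (k + 1) - a / k).
    { assert (k / (k + 1) <= 1)
        by (apply Rmult_le_reg_r with (k + 1); [lra | field_simplify; lra]).
      assert (a / k <= a)
        by (apply Rmult_le_reg_r with k; [lra | field_simplify; nra]).
      lra. }
    assert (Hc2 : 0 <= a * s / (k + 1)) by (apply Rdiv_le_0_compat; nra).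
    assert (Hc3 : 0 <= (k - 1) / (k * s)) by (apply Rdiv_le_0_compat; nra).
    set (c1 := 1 + a - k / (k + 1) - a / k) in *.
    set (c2 := a * s / (k + 1)) in *; set (c3 := (k - 1) / (k * s)) in *.
    pose proof (HS m) as H1; pose proof (HS (Datatypes.S m)) as H2.
    pose proof (HS (pred m)) as H3.
    pose proof (Rabs_pos (x m r)).
    rewrite Rabs_mult, (Rabs_pos_eq l) by lra.
    replace ((K - l * e / 8) * S) with (l * ((1 + a - e / 8) * S))
      by (unfold K; field).
    apply Rmult_le_compat_l; [lra|].
    eapply Rle_trans; [apply Rabs_triang|].
    eapply Rle_trans; [apply Rplus_le_compat_r, Rabs_triang|].
    rewrite !Rabs_mult, (Rabs_pos_eq c1), (Rabs_pos_eq c2), (Rabs_pos_eq c3) by auto.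
    apply Rle_trans with (c1 * S + c2 * S + c3 * S); nra.
Qed.

Let y_close n t : 0 <= t -> Rabs (y n t - y O t) <= 2 ^ n * exp (- (l * e / 8 * t)).
Proof.
  intro Ht; set (v := exp (- (l * e / 8 * t))).
  assert (Hv : 0 < v) by apply exp_pos.
  assert (Hdf : forall n, Rabs (df n t) <= 2 ^ n * v).
  { intro m; pose proof (x_growth m t Ht) as H; unfold x in H.
    assert (Hsm : 0 < s ^ m) by (apply pow_lt; lra).
    rewrite Rabs_mult, (Rabs_pos_eq (exp _)) in H by (left; apply exp_pos).
    replace ((K - l * e / 8) * t) with (K * t + - (l * e / 8 * t)) in H by ring.
    rewrite exp_plus in H; fold v in H.
    apply Rmult_le_reg_l in H; [|apply exp_pos].
    unfold Rdiv in H; rewrite Rabs_mult, Rabs_inv, (Rabs_pos_eq (s ^ m)) in H by lra.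
    apply Rmult_le_compat_r with (r := s ^ m) in H; [|lra].
    rewrite Rmult_assoc, Rinv_l, Rmult_1_r in H by lra.
    assert (s ^ m <= 2 ^ m) by (apply pow_incr; unfold s; lra); nra. }
  induction n as [|n IH].
  - rewrite Rminus_diag, Rabs_R0; simpl; lra.
  - replace (y (S n) t - y 0%nat t) with (df n t + (y n t - y 0%nat t))
      by (unfold df; ring).
    eapply Rle_trans; [apply Rabs_triang|]; specialize (Hdf n); simpl; lra.
Qed.

(** All the [y n] agree up to an exponentially small error, so an average over
    [n] can be replaced by the value at [0]. *)
Lemma weighted_close (w : nat -> R) (W W2 t : R) :
  0 <= t -> (forall n, 0 <= w n) -> is_series w W ->
  is_series (fun n => w n * 2 ^ n) W2 ->
  Rabs (Series (fun n => w n * y n t) - W * y O t) <= W2 * exp (- (l * e / 8 * t)).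
Proof.
  intros Ht Hw HW HW2; set (v := exp (- (l * e / 8 * t))).
  assert (Hle : forall n, Rabs (w n * (y n t - y O t)) <= v * (w n * 2 ^ n)).
  { intro n; rewrite Rabs_mult, (Rabs_pos_eq (w n)) by auto.
    pose proof (y_close n t Ht) as H; fold v in H; specialize (Hw n); nra. }
  assert (Hex : ex_series (fun n => v * (w n * 2 ^ n))).
  { apply (ex_series_scal (V := R_NormedModule) v (fun n => w n * 2 ^ n)).
    now exists W2. }
  assert (Hex1 : ex_series (fun n => Rabs (w n * (y n t - y O t)))).
  { apply (ex_series_le (V := R_CompleteNormedModule)) with (fun n => v * (w n * 2 ^ n)); auto.
    intro n; unfold norm; simpl; unfold abs; simpl; rewrite Rabs_Rabsolu; auto. }
  assert (Hex2 : ex_series (fun n => w n * y O t)).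
  { apply ex_series_ext with (fun n => scal (y O t) (w n)).
    - intro n; unfold scal; simpl; unfold mult; simpl; ring.
    - apply (ex_series_scal (V := R_NormedModule)); now exists W. }
  replace (Series (fun n => w n * y n t) - W * y O t)
    with (Series (fun n => w n * (y n t - y O t))).
  - eapply Rle_trans; [apply Series_Rabs; auto|].
    rewrite Rmult_comm, <- (is_series_unique _ _ HW2), <- Series_scal_l.
    apply Series_le; auto; intro n; split; [apply Rabs_pos | apply Hle].
  - rewrite <- (is_series_unique _ _ HW), <- Series_scal_r.
    apply Rplus_eq_reg_r with (Series (fun n => w n * y 0%nat t)).
    rewrite <- Series_plus; auto using ex_series_Rabs.
    unfold Rminus; rewrite Rplus_assoc, Rplus_opp_l, Rplus_0_r.
    apply Series_ext; intro n; ring.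
Qed.

(** [mass] and the conserved ground state component are both averages of [y].
    Comparing each of them with the value [y 0] identifies the limit of [mass],
    with an exponential error. *)
Lemma mass_gap t : 0 <= t ->
  Rabs (mass u t * exp (- (l * t)) - ground_weight d)
    <= 3 * exp (2 * a) * exp (- (l * e / 8 * t)).
Proof.
  intro Ht; set (v := exp (- (l * e / 8 * t))).
  assert (Hv : 0 < v) by apply exp_pos.
  set (b := d / l).
  assert (Hb : 0 < b) by (apply Rdiv_lt_0_compat; auto).
  assert (Hab : a = 1 + b) by apply rate_inv_sq.
  assert (H1 : Rabs (mass u t * exp (- (l * t)) - exp b * y O t) <= exp (2 * b) * v).
  { rewrite (mass_series d); auto; rewrite <- Series_scal_r.
    rewrite (Series_ext _ (fun n => b ^ n / INR (fact n) * y n t)).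
    - apply weighted_close; auto using exp_series.
      + intro n; apply Rdiv_le_0_compat; [apply pow_le; lra | apply fact_pos].
      + apply is_series_ext with (fun n => (2 * b) ^ n / INR (fact n));
          [|apply exp_series].
        intro n; rewrite Rpow_mult_distr; unfold Rdiv; in_R; ring.
    - intro n; unfold b, y; unfold Rdiv; rewrite Rpow_mult_distr, pow_inv.
      assert (l ^ n <> 0) by (apply pow_nonzero; lra).
      pose proof (fact_pos n); field; split; auto; lra. }
  (* [exp b] is the conserved ground state component. *)
  assert (H2 : Rabs (exp b - (1 + a) * exp a * y O t) <= (1 + 2 * a) * exp (2 * a) * v).
  { replace (exp b) with (Series (fun n => wt n * a ^ n * y n t)).
    - apply weighted_close; auto using wt_series.
      + intro n; apply Rmult_le_pos; [left; apply wt_pos | apply pow_le; lra].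
      + apply is_series_ext with (fun n => wt n * (2 * a) ^ n); [|apply wt_series].
        intro n; rewrite Rpow_mult_distr; in_R; ring.
    - transitivity (exp (- (l * t)) * ip (fun n => u n t) (fun n => (/ l) ^ n)).
      + unfold ip; rewrite <- Series_scal_l; apply Series_ext; intro n.
        unfold y, a.
        replace (((/ l) ^ 2) ^ n) with (/ l ^ n * / l ^ n)
          by (rewrite <- pow_mult, Nat.mul_comm, pow_mult, pow_inv; ring).
        assert (l ^ n <> 0) by (apply pow_nonzero; lra).
        rewrite pow_inv; field; auto.
      + unfold l at 2; rewrite (queue_ground d u t Hd Hq Ht); fold l; fold b.
        rewrite exp_Ropp; field; apply not_eq_sym, Rlt_not_eq, exp_pos. }
  (* Eliminate [y 0] between the two comparisons. *)
  assert (H3 : Rabs (exp b * y O t - ground_weight d) <= 2 * exp (2 * a) * v).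
  { set (c := exp b / ((1 + a) * exp a)).
    pose proof (exp_pos a) as Hea; pose proof (exp_pos b) as Heb.
    replace (exp b * y O t - ground_weight d)
      with (- c * (exp b - (1 + a) * exp a * y O t)).
    - assert (Hc : 0 < c) by (apply Rdiv_lt_0_compat; nra).
      rewrite Rabs_mult, Rabs_Ropp, (Rabs_pos_eq c) by lra.
      apply Rle_trans with (c * ((1 + 2 * a) * exp (2 * a) * v)).
      + apply Rmult_le_compat_l; auto; lra.
      + assert (c * (1 + 2 * a) <= 2).
        { assert (exp b <= exp a) by (apply exp_le; lra).
          unfold c; apply Rmult_le_reg_r with ((1 + a) * exp a); [nra|].
          replace (exp b / ((1 + a) * exp a) * (1 + 2 * a) * ((1 + a) * exp a))
            with (exp b * (1 + 2 * a)) by (field; lra).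
          nra. }
        pose proof (exp_pos (2 * a)).
        replace (c * ((1 + 2 * a) * exp (2 * a) * v))
          with ((c * (1 + 2 * a)) * (exp (2 * a) * v)) by ring.
        replace (2 * exp (2 * a) * v) with (2 * (exp (2 * a) * v)) by ring.
        apply Rmult_le_compat_r; nra.
    - unfold c, ground_weight; fold l; fold b.
      replace (exp (b - 1)) with (exp b * exp b / exp a).
      + replace (2 + b) with (1 + a) by lra; field; lra.
      + unfold Rdiv; rewrite <- exp_Ropp, <- !exp_plus; f_equal; lra. }
  replace (mass u t * exp (- (l * t)) - ground_weight d)
    with ((mass u t * exp (- (l * t)) - exp b * y O t)
          + (exp b * y O t - ground_weight d)) by ring.
  eapply Rle_trans; [apply Rabs_triang|].
  assert (exp (2 * b) * v <= exp (2 * a) * v).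
  { apply Rmult_le_compat_r; [lra|]; apply exp_le; lra. }
  lra.
Qed.

End Gap.

(** * The tree function and the Borel distribution *)

(** An [N]-th difference annihilates polynomials of degree below [N].  Splitting
    [(c + k)^(p + 1) = (c + k) (c + k)^p] and absorbing [k] into the factorial
    lowers [p], and in the part with [k] also [N]. *)
Lemma finite_difference_pow (N p : nat) (c : R) : (p < N)%nat ->
  sum_f_R0 (fun k => (-1) ^ k * (c + INR k) ^ p / (INR (fact k) * INR (fact (N - k)))) N
  = 0.
Proof.
  revert N c; induction p as [|p IH]; intros N c HpN.
  - transitivity (/ INR (fact N) * (-1 + 1) ^ N).
    + rewrite binomial, scal_sum; apply sum_eq; intros k Hk.
      unfold Binomial.C; rewrite pow1; simpl.
      pose proof (fact_pos k); pose proof (fact_pos (N - k)); pose proof (fact_pos N).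
      field; lra.
    + replace (-1 + 1) with 0 by ring; rewrite pow_i by lia; ring.
  - destruct N as [|N]; [lia|].
    transitivity (c * sum_f_R0 (fun k => (-1) ^ k * (c + INR k) ^ p
        / (INR (fact k) * INR (fact (S N - k)))) (S N)
      - sum_f_R0 (fun k => (-1) ^ k * (c + 1 + INR k) ^ p
        / (INR (fact k) * INR (fact (N - k)))) N).
    + rewrite (scal_sum _ _ c), decomp_sum by lia.
      rewrite (decomp_sum (fun i => _ * c)) by lia; cbn [pred].
      enough (H : sum_f_R0 (fun i => (-1) ^ S i * (c + INR (S i)) ^ S p
          / (INR (fact (S i)) * INR (fact (S N - S i)))) N
        = sum_f_R0 (fun i => (-1) ^ S i * (c + INR (S i)) ^ p
          / (INR (fact (S i)) * INR (fact (S N - S i))) * c) N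
          - sum_f_R0 (fun k => (-1) ^ k * (c + 1 + INR k) ^ p
              / (INR (fact k) * INR (fact (N - k)))) N).
      { rewrite H; change (INR 0) with 0; rewrite !Rplus_0_r; unfold Rdiv.
        replace (c ^ S p) with (c * c ^ p) by reflexivity; ring. }
      rewrite <- minus_sum; apply sum_eq; intros k Hk.
      rewrite fact_S_INR, S_INR; simpl Nat.sub.
      replace (c + 1 + INR k) with (c + (INR k + 1)) by ring.
      pose proof (fact_pos k); pose proof (fact_pos (N - k)); pose proof (pos_INR k).
      simpl; field; lra.
    + rewrite !IH by lia; ring.
Qed.

(** Abel's generalization of the binomial theorem.  Differentiating the left side
    in [y] reproduces the identity for [n - 1], and at [y = 0] the sum is a finite
    difference of a power of too small degree. *)
Lemma abel_identity (n : nat) (y : R) : 0 <= y ->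
  sum_f_R0 (fun j => (INR j + 1) ^ j / INR (fact (S j))
    * ((y - (INR j + 1)) ^ (n - j) / INR (fact (n - j)))) n
  = y ^ n / INR (fact n).
Proof.
  revert y; induction n as [|n IH]; intros y Hy; [simpl; field|].
  set (f := fun (y : R) j => (INR j + 1) ^ j / INR (fact (S j))
    * ((y - (INR j + 1)) ^ (S n - j) / INR (fact (S n - j)))).
  assert (H0 : sum_f_R0 (f 0) (S n) = 0).
  { set (g := fun j => (-1) ^ S j * (0 + INR (S j)) ^ S n
      / (INR (fact (S j)) * INR (fact (S (S n) - S j)))).
    assert (Hg : sum_f_R0 g (S n) = 0).
    { pose proof (finite_difference_pow (S (S n)) (S n) 0 ltac:(lia)) as Hf.
      rewrite decomp_sum in Hf by lia; cbn [pred] in Hf; fold g in Hf.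
      replace (0 + INR 0) with 0 in Hf by (simpl; ring).
      rewrite pow_i in Hf by lia; unfold Rdiv in Hf; lra. }
    transitivity (- (-1) ^ S n * sum_f_R0 g (S n)); [|rewrite Hg; ring].
    rewrite scal_sum.
    apply sum_eq; intros j Hj; unfold f, g.
    replace (S (S n) - S j)%nat with (S n - j)%nat by lia.
    rewrite S_INR.
    replace (0 - (INR j + 1)) with (-1 * (INR j + 1)) by ring.
    rewrite Rpow_mult_distr, Rplus_0_l.
    replace ((INR j + 1) ^ S n) with ((INR j + 1) ^ j * (INR j + 1) ^ (S n - j))
      by (rewrite <- pow_add; f_equal; lia).
    assert (Hs : (-1) ^ (S n - j) = - (-1) ^ S n * (-1) ^ S j).
    { replace (S n) with (j + (S n - j))%nat at 2 by lia.
      rewrite pow_add; change ((-1) ^ S j) with (-1 * (-1) ^ j).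
      assert ((-1) ^ j * (-1) ^ j = 1)
        by (rewrite <- Rpow_mult_distr; replace (-1 * -1) with 1 by ring; apply pow1).
      rewrite <- (Rmult_1_l ((-1) ^ (S n - j))) at 1; rewrite <- H; ring. }
    rewrite Hs.
    pose proof (fact_pos (S j)); pose proof (fact_pos (S n - j)).
    field; lra. }
  assert (Hd : forall t, 0 <= t <= y ->
    is_derive (fun y => sum_f_R0 (f y) (S n) - y ^ S n / INR (fact (S n))) t 0).
  { intros t Ht.
    apply is_derive_ext with
      (fun y => sum_n (f y) (S n) - y ^ S n / INR (fact (S n))).
    { intro z; now rewrite sum_n_Reals. }
    set (f' := fun j => if Nat.leb j n then (INR j + 1) ^ j / INR (fact (S j))
      * ((t - (INR j + 1)) ^ (n - j) / INR (fact (n - j))) else 0).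
    evar_last.
    - apply (is_derive_minus (V := R_NormedModule)).
      + apply (is_derive_sum_n (fun j y => f y j) (S n) t f').
        intros j Hj; unfold f, f'.
        destruct (Nat.leb_spec j n) as [Hjn|Hjn].
        * replace (S n - j)%nat with (S (n - j)) by lia.
          apply is_derive_scal; auto_derive; auto.
          change (Init.Nat.pred (S (n - j))) with (n - j)%nat.
          change (fact (n - j) + (n - j) * fact (n - j))%nat with (fact (S (n - j))).
          change (match (n - j)%nat with O => 1 | S _ => INR (n - j) + 1 end)
            with (INR (S (n - j))).
          rewrite fact_S_INR, S_INR.
          pose proof (fact_pos (n - j)); pose proof (pos_INR (n - j)).
          change (t + - (INR j + 1)) with (t - (INR j + 1)); field; lra.
        * replace (S n - j)%nat with O by lia; simpl.
          evar_last; [apply (is_derive_const (V := R_NormedModule))|reflexivity].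
      + instantiate (1 := t ^ n / INR (fact n)).
        auto_derive; auto.
        change (Init.Nat.pred (S n)) with n.
        change (fact n + n * fact n)%nat with (fact (S n)).
        change (match n with O => 1 | S _ => INR n + 1 end) with (INR (S n)).
        rewrite fact_S_INR, S_INR.
        pose proof (fact_pos n); pose proof (pos_INR n); field; lra.
    - rewrite sum_n_succ, sum_n_Reals.
      rewrite (sum_eq f' (fun j => (INR j + 1) ^ j / INR (fact (S j))
        * ((t - (INR j + 1)) ^ (n - j) / INR (fact (n - j))))).
      + rewrite IH by lra; unfold f'; rewrite (proj2 (Nat.leb_gt (S n) n)) by lia.
        unfold minus, plus, opp; simpl; ring.
      + intros j Hj; unfold f'; now rewrite (proj2 (Nat.leb_le j n)). }
  pose proof (derive_zero _ y Hy Hd) as H; cbv beta in H.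
  rewrite H0, (pow_i (S n)) in H by lia.
  assert (Hz : 0 / INR (fact (S n)) = 0) by (unfold Rdiv; ring).
  rewrite Hz in H; change (sum_f_R0 (f y) (S n) = y ^ S n / INR (fact (S n))); lra.
Qed.

(** [u * sum_k tree k u^k] is the tree function, the inverse of [x e^(-x)] near
    zero; [tree_deriv] lists the coefficients of its derivative. *)
Definition tree (k : nat) : R := (INR k + 1) ^ k / INR (fact (S k)).

Definition tree_deriv (k : nat) : R := (INR k + 1) ^ k / INR (fact k).

Lemma tree_deriv_coef k : tree_deriv k = (INR k + 1) * tree k.
Proof.
  unfold tree, tree_deriv; rewrite fact_S_INR.
  pose proof (fact_pos k); pose proof (INR_succ_pos k); field; lra.
Qed.

Lemma tree_pos k : 0 < tree k.
Proof.
  apply Rdiv_lt_0_compat; [apply pow_lt, INR_succ_pos | apply fact_pos].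
Qed.

Lemma tree_convolution n : PS_derive tree n = PS_mult tree tree_deriv n.
Proof.
  unfold PS_mult, PS_derive.
  transitivity ((INR n + 2) ^ n / INR (fact n)).
  - unfold tree; rewrite !fact_S_INR, S_INR.
    pose proof (fact_pos n); pose proof (pos_INR n); simpl.
    replace (INR n + 1 + 1) with (INR n + 2) by ring; field; lra.
  - rewrite <- abel_identity by (pose proof (pos_INR n); lra).
    apply sum_eq; intros j Hj; unfold tree, tree_deriv.
    rewrite minus_INR by auto.
    replace (INR n + 2 - (INR j + 1)) with (INR n - INR j + 1) by ring.
    reflexivity.
Qed.

Lemma exp_pow_nat (x : R) (n : nat) : exp (x * INR n) = exp x ^ n.
Proof.
  induction n as [|n IH]; [simpl; rewrite Rmult_0_r; apply exp_0|].
  rewrite S_INR, Rmult_plus_distr_l, exp_plus, IH, Rmult_1_r; simpl; ring.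
Qed.

Lemma tree_deriv_bound k : tree_deriv k <= exp 1 * exp 1 ^ k.
Proof.
  change (exp 1 * exp 1 ^ k) with (exp 1 ^ S k).
  replace (exp 1 ^ S k) with (exp (INR k + 1)).
  - apply Rle_trans with (sum_n (fun n => (INR k + 1) ^ n / INR (fact n)) k).
    + assert (Hp : forall n, 0 <= (INR k + 1) ^ n / INR (fact n)).
      { intro n; apply Rdiv_le_0_compat;
          [apply pow_le; pose proof (INR_succ_pos k); lra | apply fact_pos]. }
      rewrite sum_n_Reals; unfold tree_deriv; revert Hp; generalize (INR k + 1).
      intros z Hz; destruct k as [|k]; [apply Rle_refl|].
      rewrite tech5.
      pose proof (cond_pos_sum (fun n => z ^ n / INR (fact n)) k Hz); lra.
    + apply partial_sum_le; [|apply exp_series].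
      intro n; apply Rdiv_le_0_compat;
        [apply pow_le; pose proof (INR_succ_pos k); lra | apply fact_pos].
  - rewrite <- exp_pow_nat, S_INR; f_equal; ring.
Qed.

Lemma tree_bound k : tree k <= exp 1 * exp 1 ^ k.
Proof.
  eapply Rle_trans; [|apply tree_deriv_bound]; rewrite tree_deriv_coef.
  pose proof (tree_pos k); pose proof (pos_INR k); nra.
Qed.

Lemma radius_lower (a : nat -> R) :
  (forall k, Rabs (a k) <= exp 1 * exp 1 ^ k) ->
  forall u, Rabs u < exp (-1) -> Rbar_lt (Rabs u) (CV_radius a).
Proof.
  intros Ha u Hu; apply Rbar_lt_le_trans with (exp (-1)); [exact Hu|].
  apply (proj1 (CV_radius_bounded a)); exists (exp 1); intro n.
  rewrite Rabs_mult, <- RPow_abs, (Rabs_pos_eq (exp (-1))) by (left; apply exp_pos).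
  replace (exp 1) with (exp 1 * exp 1 ^ n * exp (-1) ^ n).
  - apply Rmult_le_compat_r; auto; apply pow_le; left; apply exp_pos.
  - rewrite Rmult_assoc, <- Rpow_mult_distr, <- exp_plus.
    replace (1 + -1) with 0 by ring; rewrite exp_0, pow1; ring.
Qed.

Lemma tree_radius u : Rabs u < exp (-1) -> Rbar_lt (Rabs u) (CV_radius tree).
Proof.
  apply radius_lower; intro k; rewrite Rabs_pos_eq by (left; apply tree_pos).
  apply tree_bound.
Qed.

Lemma tree_deriv_radius u : Rabs u < exp (-1) -> Rbar_lt (Rabs u) (CV_radius tree_deriv).
Proof.
  apply radius_lower; intro k; rewrite Rabs_pos_eq; [apply tree_deriv_bound|].
  rewrite tree_deriv_coef; apply Rmult_le_pos;
    [pose proof (INR_succ_pos k); lra | left; apply tree_pos].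
Qed.

(** Abel's identity says that the coefficient sequence of the derivative is the
    convolution of [tree] with [tree_deriv]. *)
Lemma tree_ode u : Rabs u < exp (-1) ->
  PSeries (PS_derive tree) u
  = PSeries tree u * (PSeries tree u + u * PSeries (PS_derive tree) u).
Proof.
  intro Hu.
  assert (H : PSeries tree_deriv u = PSeries tree u + u * PSeries (PS_derive tree) u).
  { rewrite <- PSeries_incr_1, <- PSeries_plus.
    - apply PSeries_ext; intro k; rewrite tree_deriv_coef.
      unfold PS_plus, PS_incr_1, PS_derive.
      destruct k as [|k]; [unfold plus, zero; simpl; ring|].
      change (plus ?p ?q) with (p + q); rewrite S_INR; ring.
    - now apply CV_radius_inside, tree_radius.
    - apply ex_pseries_incr_1, CV_radius_inside.
      rewrite CV_radius_derive; now apply tree_radius. }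
  rewrite <- H, <- PSeries_mult by (auto using tree_radius, tree_deriv_radius).
  apply PSeries_ext, tree_convolution.
Qed.

(** By [tree_ode] the left side has derivative zero, and its value at [u = 0]
    is [1]. *)
Lemma tree_functional u : 0 <= u < exp (-1) ->
  PSeries tree u * exp (- (u * PSeries tree u)) = 1.
Proof.
  intro Hu; set (b := PSeries tree); set (b' := PSeries (PS_derive tree)).
  assert (Hd : forall t, 0 <= t <= u ->
    is_derive (fun t => b t * exp (- (t * b t))) t 0).
  { intros t Ht.
    assert (Hr : Rabs t < exp (-1)) by (rewrite Rabs_pos_eq; lra).
    pose proof (is_derive_PSeries tree t (tree_radius t Hr)) as Hb.
    fold b b' in Hb.
    pose proof (tree_ode t Hr) as Ho; fold b b' in Ho.
    evar_last.
    - apply (is_derive_mult b (fun t => exp (- (t * b t))) t (b' t)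
        (- (b t + t * b' t) * exp (- (t * b t)))); [exact Hb | | exact Rmult_comm].
      evar_last.
      + apply (is_derive_comp exp (fun t => - (t * b t))); [apply is_derive_exp|].
        apply (is_derive_opp (V := R_NormedModule)).
        apply (is_derive_mult (fun t => t) b t 1 (b' t)); [|exact Hb | exact Rmult_comm].
        apply (is_derive_id (K := R_AbsRing)).
      + unfold scal, opp, plus, mult; simpl; unfold mult; simpl; ring.
    - match goal with |- @eq _ (plus (mult ?p ?q) (mult ?v ?w)) ?r =>
        change (p * q + v * w = r) end.
      replace (b' t) with (b t * (b t + t * b' t)) at 1 by auto; ring. }
  pose proof (derive_zero _ u (proj1 Hu) Hd) as H; cbv beta in H.
  assert (Hb0 : b 0 = 1) by (unfold b; rewrite PSeries_0; unfold tree; simpl; field).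
  rewrite Hb0, Rmult_0_l, Ropp_0, exp_0, Rmult_1_r in H; exact H.
Qed.

Lemma x_exp_lt x y : x < y -> y <= 1 -> 0 < y -> x * exp (- x) < y * exp (- y).
Proof.
  intros Hxy Hy Hy0.
  replace (exp (- y)) with (exp (- x) * exp (- (y - x)))
    by (rewrite <- exp_plus; f_equal; ring).
  pose proof (exp_pos (- x)).
  assert (1 + - (y - x) < exp (- (y - x))) by (apply exp_ineq1; lra).
  assert (x < y * exp (- (y - x))).
  { apply Rle_lt_trans with (y * (1 + - (y - x))); [nra|].
    apply Rmult_lt_compat_l; auto. }
  nra.
Qed.

Lemma tree_inverse x : 0 < x < 1 ->
  x * exp (- x) * PSeries tree (x * exp (- x)) = x.
Proof.
  intro Hx; set (u := x * exp (- x)).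
  assert (Hu : 0 < u < exp (-1)).
  { split; [unfold u; pose proof (exp_pos (- x)); nra|].
    rewrite <- (Rmult_1_l (exp (-1))); apply x_exp_lt; lra. }
  set (T := fun u => u * PSeries tree u).
  assert (HT : forall v, 0 <= v <= u -> T v * exp (- T v) = v).
  { intros v Hv; unfold T; rewrite Rmult_assoc, tree_functional by lra; ring. }
  assert (Hnn : forall v, 0 <= v <= u -> 0 <= T v).
  { intros v Hv; specialize (HT v Hv); pose proof (exp_pos (- T v)).
    destruct (Rle_lt_dec 0 (T v)); auto; nra. }
  assert (Hlt : T u < 1).
  { destruct (Rlt_le_dec (T u) 1) as [|Hge]; auto; exfalso.
    (* The value [1] would be attained at [e^(-1)], beyond [u]; so [T] stays
       below [1] by continuity. *)
    assert (Hne : forall v, 0 <= v <= u -> T v <> 1).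
    { intros v Hv H1; pose proof (HT v Hv) as H; rewrite H1 in H.
      replace (- (1)) with (-1) in H by ring; lra. }
    destruct (IVT_interv (fun v => T v - 1) 0 u) as (v & Hv & HTv); try lra.
    - intros v Hv; apply derivable_continuous_pt, ex_derive_Reals_0.
      assert (Hr : Rabs v < exp (-1)) by (rewrite Rabs_pos_eq; lra).
      unfold T; auto_derive; eexists; apply is_derive_PSeries, tree_radius, Hr.
    - unfold T; lra.
    - pose proof (Hne u ltac:(lra)); lra.
    - apply (Hne v Hv); lra. }
  change (T u = x); pose proof (HT u ltac:(lra)) as H.
  pose proof (Hnn u ltac:(lra)); unfold u in H at 3.
  destruct (Rtotal_order (T u) x) as [Hc|[Hc|Hc]]; auto; exfalso;
    apply x_exp_lt in Hc; lra.
Qed.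

(** The Borel distribution with parameter one at [k + 1], that is
    [m^(m-1) e^(-m) / m!] with [m = k + 1]; these are the coefficients of [Q0]. *)
Definition borel (k : nat) : R := tree k * exp (- (INR k + 1)).

Lemma borel_pos k : 0 < borel k.
Proof. apply Rmult_lt_0_compat; [apply tree_pos | apply exp_pos]. Qed.

Lemma tree_partial_sum x N : 0 < x < 1 ->
  sum_n (fun k => tree k * (x * exp (- x)) ^ S k) N <= x.
Proof.
  intro Hx; set (u := x * exp (- x)).
  assert (Hu : 0 < u < exp (-1)).
  { split; [unfold u; pose proof (exp_pos (- x)); nra|].
    rewrite <- (Rmult_1_l (exp (-1))); apply x_exp_lt; lra. }
  apply partial_sum_le.
  - intro k; apply Rmult_le_pos; [left; apply tree_pos | apply pow_le; lra].
  - rewrite <- (tree_inverse x Hx); fold u.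
    apply is_series_ext with (fun k => scal u (tree k * u ^ k)).
    + intro k; unfold scal; simpl; unfold mult; simpl; ring.
    + apply (is_series_scal_l (V := R_NormedModule) u (fun k => tree k * u ^ k)).
      apply Series_correct, ex_pseries_R, CV_radius_inside, tree_radius.
      rewrite Rabs_pos_eq; lra.
Qed.

Lemma bernoulli_le (z : R) (n : nat) : 0 <= z <= 1 -> 1 - INR n * z <= (1 - z) ^ n.
Proof.
  intro Hz; induction n as [|n IH]; [simpl; lra|].
  rewrite S_INR; simpl; pose proof (pos_INR n).
  apply Rle_trans with ((1 - z) * (1 - INR n * z)); nra.
Qed.

(** Letting [x] tend to [1] in [tree_partial_sum]. *)
Lemma borel_partial_sum N : sum_n borel N <= 1.
Proof.
  assert (Hx : forall x, 0 < x < 1 -> x ^ S N * sum_n borel N <= 1).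
  { intros x Hx; apply Rle_trans with x; [|lra].
    eapply Rle_trans; [|apply (tree_partial_sum x N Hx)].
    rewrite !sum_n_Reals, scal_sum; apply sum_Rle; intros k Hk.
    unfold borel; rewrite Rpow_mult_distr, Rmult_assoc.
    apply Rmult_le_compat_l; [left; apply tree_pos|].
    replace (exp (- x) ^ S k) with (exp (- (x * (INR k + 1)))).
    - rewrite Rmult_comm; apply Rmult_le_compat; try (left; apply exp_pos).
      + apply pow_le; lra.
      + replace (S N) with (S k + (N - k))%nat by lia; rewrite pow_add.
        assert (x ^ (N - k) <= 1 ^ (N - k)) by (apply pow_incr; lra).
        rewrite pow1 in *; assert (0 < x ^ S k) by (apply pow_lt; lra); nra.
      + apply exp_le; pose proof (INR_succ_pos k); nra.
    - rewrite <- exp_pow_nat, S_INR; f_equal; ring. }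
  assert (Hp : 0 <= sum_n borel N).
  { rewrite sum_n_Reals; apply cond_pos_sum; intro; left; apply borel_pos. }
  revert Hx Hp; generalize (sum_n borel N : R); intros s Hx Hp.
  destruct (Rle_lt_dec s 1) as [|Hgt]; auto; exfalso.
  set (m := INR (S N)); assert (Hm : 1 <= m) by (unfold m; rewrite S_INR; pose proof (pos_INR N); lra).
  (* With [x = 1 - z] the Bernoulli bound leaves [s - m z s = (s + 1) / 2 > 1]. *)
  set (z := (s - 1) / (2 * m * s)).
  assert (Hz : 0 < z < 1).
  { split; [apply Rdiv_lt_0_compat; nra|].
    apply Rmult_lt_reg_r with (2 * m * s); [nra|]; unfold z; field_simplify; nra. }
  pose proof (Hx (1 - z) ltac:(lra)) as H.
  pose proof (bernoulli_le z (S N) ltac:(lra)) as Hb; fold m in Hb.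
  assert (Hmz : m * z * s = (s - 1) / 2) by (unfold z; field; nra).
  nra.
Qed.

(** At the edge [u = e^(-1)] of the disc of convergence the tree function equals
    [1]: its values [x] at [x e^(-x)] approach [1] and bound the sum from below.
    Below, this is what makes the eigenvectors exhaust the initial state. *)
Lemma borel_mass : is_series borel 1.
Proof.
  assert (Hex : ex_finite_lim_seq (sum_n borel)).
  { apply ex_finite_lim_seq_incr with 1; [|apply borel_partial_sum].
    intro n; rewrite sum_n_succ; pose proof (borel_pos (S n)); lra. }
  destruct Hex as (S & HS); replace 1 with S; [exact HS|].
  apply Rle_antisym.
  - exact (is_lim_seq_le _ (fun _ => 1) S 1 borel_partial_sum HS (is_lim_seq_const 1)).
  - assert (Hx : forall x, 0 < x < 1 -> x <= S).
    { intros x Hx; rewrite <- (tree_inverse x Hx) at 1; unfold PSeries.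
      rewrite <- Series_scal_l, <- (is_series_unique _ _ HS).
      apply Series_le; [|now exists S].
      intro k; unfold borel.
      assert (Hu : 0 <= x * exp (- x) <= exp (-1)).
      { pose proof (exp_pos (- x)); split; [nra|].
        rewrite <- (Rmult_1_l (exp (-1))); left; apply x_exp_lt; lra. }
      pose proof (tree_pos k).
      replace (exp (- (INR k + 1))) with (exp (-1) ^ Datatypes.S k)
        by (rewrite <- exp_pow_nat, S_INR; f_equal; ring).
      replace (x * exp (- x) * (tree k * (x * exp (- x)) ^ k))
        with (tree k * (x * exp (- x)) ^ Datatypes.S k) by (simpl; ring).
      split; [apply Rmult_le_pos; [lra | apply pow_le; lra]|].
      apply Rmult_le_compat_l; [lra | apply pow_incr; lra]. }
    destruct (Rle_lt_dec 1 S) as [|Hlt]; auto.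
    pose proof (Hx (Rmax (/ 2) ((1 + S) / 2))
      ltac:(split; [apply Rlt_le_trans with (/ 2); [lra | apply Rmax_l]
                   | apply Rmax_lub_lt; lra])).
    pose proof (Rmax_r (/ 2) ((1 + S) / 2)); lra.
Qed.

(** * Eigenvectors at load zero *)

(** The Charlier polynomial of degree [N] for the Poisson law of mean [a], in the
    variable [n], generated by its raising operator.  The junk value at
    [pred 0] is multiplied by [INR 0]. *)
Fixpoint charlier (a : R) (N n : nat) : R :=
  match N with
  | O => 1
  | S M => charlier a M n - INR n / a * charlier a M (pred n)
  end.

Lemma charlier_0 a N : charlier a N 0 = 1.
Proof. induction N as [|N IH]; simpl; auto; rewrite IH; unfold Rdiv; ring. Qed.

Lemma charlier_diff a N n : 0 < a ->
  charlier a N (S n) - charlier a N n = - (INR N / a) * charlier a (pred N) n.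
Proof.
  intro Ha; revert n; induction N as [|N IH]; intro n; [simpl; field; lra|].
  cbn [charlier pred]; rewrite !S_INR.
  replace (charlier a N (S n) - (INR n + 1) / a * charlier a N n
      - (charlier a N n - INR n / a * charlier a N (pred n)))
    with (charlier a N (S n) - charlier a N n - charlier a N n / a
          - INR n / a * (charlier a N n - charlier a N (pred n))) by (field; lra).
  rewrite IH; destruct n as [|n]; cbn [pred].
  - destruct N as [|N]; cbn [pred charlier]; simpl INR; [field; lra|].
    rewrite !charlier_0; field; lra.
  - rewrite IH; destruct N as [|N]; cbn [pred charlier]; simpl (INR 0); field; lra.
Qed.

(** The self-duality of the Charlier polynomials: they are eigenfunctions of the
    Poisson birth-death generator.  For [a = N + 1] the right side becomes
    [(n + 1) C n], the eigenvalue equation of [flow 0]. *)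
Lemma charlier_difference_equation a N n : 0 < a ->
  a * charlier a N (S n) + INR n * charlier a N (pred n)
  = (INR n + a - INR N) * charlier a N n.
Proof.
  intro Ha; pose proof (charlier_diff a N n Ha) as H.
  replace (charlier a N (S n))
    with (charlier a N n + - (INR N / a) * charlier a (pred N) n) by lra.
  destruct N as [|N]; [simpl; field; lra|]; cbn [pred].
  destruct n as [|n].
  - rewrite !charlier_0; simpl (INR 0); field; lra.
  - pose proof (charlier_diff a (S N) n Ha) as H'; cbn [pred] in *.
    replace (charlier a (S N) n)
      with (charlier a (S N) (S n) + INR (S N) / a * charlier a N n) by lra.
    cbn [charlier pred]; field; lra.
Qed.

Lemma geo_charlier a N : geo (charlier a N).
Proof.
  induction N as [|N IH].
  - destruct (geo_pow 1) as (B & r & HB & Hr & H); exists B, r; repeat split; auto.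
    intro n; specialize (H n); now rewrite pow1 in H.
  - apply (geo_plus (charlier a N) (fun n => - (INR n / a * charlier a N (pred n)))); auto.
    destruct (geo_scal (- / a) _ (geo_mult _ _ geo_INR (geo_pred _ IH)))
      as (B & r & HB & Hr & H).
    exists B, r; repeat split; auto; intro n; specialize (H n).
    now replace (- (INR n / a * charlier a N (pred n)))
      with (- / a * (INR n * charlier a N (pred n))) by (unfold Rdiv; ring).
Qed.

(** The Poisson mean, without the normalization [e^(-a)]. *)
Definition poisson (a : R) (f : nat -> R) : R := Series (fun n => a ^ n / INR (fact n) * f n).

Lemma poisson_summable a f : geo f -> ex_series (fun n => a ^ n / INR (fact n) * f n).
Proof.
  intros (B & r & HB & Hr & Hf).
  apply (ex_series_le (V := R_CompleteNormedModule))
    with (fun n => scal B ((Rabs a * r) ^ n / INR (fact n))).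
  - intro n; unfold norm, scal; simpl; unfold abs, mult; simpl.
    unfold Rdiv; rewrite !Rabs_mult, Rabs_inv, (Rabs_pos_eq (INR _))
      by (left; apply fact_pos).
    rewrite Rpow_mult_distr, <- RPow_abs; specialize (Hf n).
    assert (0 <= Rabs a ^ n * / INR (fact n)).
    { apply Rmult_le_pos; [apply pow_le, Rabs_pos |].
      left; apply Rinv_0_lt_compat, fact_pos. }
    replace (B * (Rabs a ^ n * r ^ n * / INR (fact n)))
      with (Rabs a ^ n * / INR (fact n) * (B * r ^ n)) by ring.
    apply Rmult_le_compat_l; auto.
  - apply (ex_series_scal (V := R_NormedModule)); eexists; apply exp_series.
Qed.

Lemma poisson_ext a f g : (forall n, f n = g n) -> poisson a f = poisson a g.
Proof. intro H; apply Series_ext; intro n; now rewrite H. Qed.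

Lemma poisson_scal a c f : poisson a (fun n => c * f n) = c * poisson a f.
Proof. unfold poisson; rewrite <- Series_scal_l; apply Series_ext; intro; ring. Qed.

Lemma poisson_plus a f g : geo f -> geo g ->
  poisson a (fun n => f n + g n) = poisson a f + poisson a g.
Proof.
  intros Hf Hg; unfold poisson.
  rewrite <- Series_plus by (now apply poisson_summable).
  apply Series_ext; intro; ring.
Qed.

Lemma poisson_index a f : geo f ->
  poisson a (fun n => INR n * f n) = a * poisson a (fun n => f (S n)).
Proof.
  intro Hf; unfold poisson; rewrite Series_incr_1.
  - simpl (INR 0); rewrite Rmult_0_l, Rmult_0_r, Rplus_0_l, <- Series_scal_l.
    apply Series_ext; intro n; rewrite fact_S_INR, S_INR.
    pose proof (fact_pos n); pose proof (INR_succ_pos n); simpl; field; lra.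
  - apply (poisson_summable a (fun n => INR n * f n)), geo_mult; auto using geo_INR.
Qed.

(** The raising operator is minus the adjoint of the forward difference, by the
    Stein identity [poisson_index].  All norms follow from this and
    [charlier_diff] by induction on the degree. *)
Lemma charlier_adjoint a N g : 0 < a -> geo g ->
  poisson a (fun n => charlier a (S N) n * g n)
  = - poisson a (fun n => charlier a N n * (g (S n) - g n)).
Proof.
  intros Ha Hg; pose proof (geo_charlier a N) as HC.
  set (h := fun n => charlier a N (pred n) * g n).
  assert (Hh : geo h) by (apply geo_mult; auto; now apply geo_pred).
  pose proof (poisson_index a h Hh) as Hi.
  rewrite (poisson_ext a _ (fun n => charlier a N n * g n + - / a * (INR n * h n)))
    by (intro; unfold h; simpl; unfold Rdiv; ring).
  rewrite poisson_plus, poisson_scal, Hi;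
    [| now apply geo_mult | apply geo_scal, geo_mult; auto using geo_INR].
  rewrite (poisson_ext a (fun n => charlier a N n * (g (S n) - g n))
    (fun n => charlier a N n * g (S n) + -1 * (charlier a N n * g n))) by (intro; ring).
  rewrite poisson_plus, poisson_scal;
    [| apply geo_mult; auto; now apply geo_succ | apply geo_scal; now apply geo_mult].
  unfold h; cbn [pred]; field; lra.
Qed.

Lemma charlier_step a N g : 0 < a ->
  poisson a (fun n => g n * (charlier a (S N) (S n) - charlier a (S N) n))
  = - ((INR N + 1) / a) * poisson a (fun n => g n * charlier a N n).
Proof.
  intro Ha; rewrite <- poisson_scal; apply poisson_ext; intro n.
  rewrite charlier_diff by auto; cbn [pred]; rewrite S_INR; unfold Rdiv; ring.
Qed.

Lemma charlier_norm a N : 0 < a ->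
  poisson a (fun n => charlier a N n * charlier a N n) = exp a * INR (fact N) / a ^ N.
Proof.
  intro Ha; induction N as [|N IH].
  - rewrite (poisson_ext a _ (fun _ => 1)) by (intro; simpl; ring).
    unfold poisson; simpl; rewrite (Series_ext _ (fun n => a ^ n / INR (fact n)))
      by (intro; ring).
    rewrite (is_series_unique _ _ (exp_series a)); field.
  - rewrite charlier_adjoint by (auto using geo_charlier).
    rewrite charlier_step, IH, fact_S_INR by auto; simpl.
    assert (a ^ N <> 0) by (apply pow_nonzero; lra); field; split; auto; lra.
Qed.

Lemma charlier_consecutive a N : 0 < a ->
  poisson a (fun n => charlier a (S N) n * charlier a N n) = 0.
Proof.
  intro Ha; induction N as [|N IH].
  - rewrite charlier_adjoint by (auto using geo_charlier).
    rewrite (poisson_ext a _ (fun n => 0 * 1)) by (intro; simpl; ring).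
    rewrite poisson_scal; ring.
  - rewrite charlier_adjoint by (auto using geo_charlier).
    rewrite charlier_step, IH by auto; ring.
Qed.

(** Apply [charlier_adjoint] to [(n + 1) C] and use the product rule: the
    difference of the factor [n + 1] produces a cross term, which vanishes by
    [charlier_consecutive], and the difference of [C] lowers the degree. *)
Lemma charlier_weighted_norm a N : 0 < a ->
  poisson a (fun n => (INR n + 1) * (charlier a N n * charlier a N n))
  = (a + INR N + 1) * (exp a * INR (fact N) / a ^ N).
Proof.
  intro Ha; induction N as [|N IH].
  - rewrite (poisson_ext a _ (fun n => INR n * 1 + 1 * 1)) by (intro; simpl; ring).
    assert (H1 : geo (fun _ => 1)) by apply (geo_charlier 1 0).
    rewrite poisson_plus; [| apply geo_mult; auto using geo_INR | now apply geo_scal].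
    rewrite (poisson_index a (fun _ => 1)), poisson_scal by auto.
    unfold poisson; rewrite (Series_ext _ (fun n => a ^ n / INR (fact n))) by (intro; ring).
    rewrite (is_series_unique _ _ (exp_series a)); simpl; field.
  - pose proof (geo_charlier a (S N)) as HS; pose proof (geo_charlier a N) as HN.
    set (g := fun n => INR n * charlier a (S N) n + charlier a (S N) n).
    assert (Hg : geo g).
    { apply (geo_plus (fun n => INR n * charlier a (S N) n)); auto.
      apply geo_mult; auto using geo_INR. }
    rewrite (poisson_ext a _ (fun n => charlier a (S N) n * g n))
      by (intro; unfold g; ring).
    rewrite charlier_adjoint by auto.
    set (c := (INR N + 1) / a).
    assert (HNN : geo (fun n => charlier a N n * charlier a N n)) by now apply geo_mult.
    rewrite (poisson_ext a _ (fun n => charlier a (S N) n * charlier a N n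
      + - c * ((INR n + 1) * (charlier a N n * charlier a N n)
               + charlier a N n * charlier a N n))).
    + assert (HW : geo (fun n => (INR n + 1) * (charlier a N n * charlier a N n))).
      { apply (geo_mult (fun n => INR n + 1)); auto.
        apply (geo_plus INR (fun _ => 1)); [apply geo_INR | apply (geo_charlier 1 0)]. }
      rewrite poisson_plus; [| now apply geo_mult | now apply geo_scal, geo_plus].
      rewrite charlier_consecutive, poisson_scal, poisson_plus, IH, charlier_norm by auto.
      rewrite fact_S_INR, S_INR; unfold c; simpl.
      assert (a ^ N <> 0) by (apply pow_nonzero; lra); field; split; auto; lra.
    + intro n; pose proof (charlier_diff a (S N) n Ha) as H; cbn [pred] in H.
      unfold g; rewrite !S_INR in *; fold c in H.
      replace (charlier a (S N) (S n))
        with (charlier a (S N) n + - c * charlier a N n) by lra.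
      ring.
Qed.

(** The eigenvectors of the system with load zero, for the eigenvalues
    [s / sqrt m] with [m = k + 1] and a sign [s]. *)
Definition phi (k : nat) (s : R) (n : nat) : R :=
  (s * sqrt (INR k + 1)) ^ n * charlier (INR k + 1) k n.

Definition phi_rate (k : nat) (s : R) : R := s / sqrt (INR k + 1).

Lemma sqrt_succ_pos k : 0 < sqrt (INR k + 1).
Proof. apply sqrt_lt_R0, INR_succ_pos. Qed.

Lemma sqrt_succ_sq k : sqrt (INR k + 1) * sqrt (INR k + 1) = INR k + 1.
Proof. apply sqrt_def; pose proof (INR_succ_pos k); lra. Qed.

Lemma phi_0 k s : phi k s 0 = 1.
Proof. unfold phi; rewrite charlier_0; simpl; ring. Qed.

Lemma phi_eigenvector k s : s * s = 1 -> eigenvector 0 (phi_rate k s) (phi k s).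
Proof.
  intro Hs; split.
  - apply geo_mult; [apply geo_pow | apply geo_charlier].
  - intro n; unfold flow, phi, phi_rate.
    pose proof (sqrt_succ_pos k) as Hr; pose proof (sqrt_succ_sq k) as Hr2.
    pose proof (INR_succ_pos k) as Hk.
    pose proof (charlier_difference_equation (INR k + 1) k n Hk) as H.
    set (m := INR k + 1) in *; set (r := sqrt m) in *.
    set (c := charlier m k) in *; fold c in H.
    replace (INR n + m - INR k) with (INR n + 1) in H by (unfold m; ring).
    assert (Hmu : s / r * (s * r) = 1) by (field_simplify; [nra | lra]).
    assert (Hmu2 : (s * r) * (s * r) = m) by (rewrite <- Hr2; nra).
    pose proof (INR_succ_pos n).
    apply Rmult_eq_reg_r with (INR n + 1); [|lra].
    replace ((INR n * ((s * r) ^ pred n * c (pred n)) - 0 * ((s * r) ^ n * c n)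
       + (s * r) ^ S n * c (S n)) / (INR n + 1) * (INR n + 1))
      with (INR n * ((s * r) ^ pred n * c (pred n)) + (s * r) ^ S n * c (S n))
      by (field; lra).
    replace (s / r * ((s * r) ^ n * c n) * (INR n + 1))
      with (s / r * (s * r) ^ n * (m * c (S n) + INR n * c (pred n)))
      by (rewrite H; ring).
    rewrite <- Hmu2; destruct n as [|n]; cbn [pred pow].
    + simpl (INR 0); generalize (s / r) Hmu; intros z Hz.
      transitivity ((z * (s * r)) * (s * r * c 1%nat)); [rewrite Hz; ring | ring].
    + generalize (s / r) Hmu; intros z Hz.
      transitivity ((z * (s * r)) * (INR (S n) * ((s * r) ^ n * c n)
        + s * r * (s * r * (s * r) ^ n) * c (S (S n)))); [rewrite Hz; ring | ring].
Qed.

Lemma phi_norm k s : s * s = 1 -> ip (phi k s) (phi k s) = 2 / borel k.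
Proof.
  intro Hs; pose proof (INR_succ_pos k) as Hk.
  transitivity (poisson (INR k + 1)
    (fun n => (INR n + 1) * (charlier (INR k + 1) k n * charlier (INR k + 1) k n))).
  - apply Series_ext; intro n; unfold wt, phi.
    replace ((INR k + 1) ^ n)
      with ((s * sqrt (INR k + 1)) ^ n * (s * sqrt (INR k + 1)) ^ n).
    + field; apply not_eq_sym, Rlt_not_eq, fact_pos.
    + rewrite <- Rpow_mult_distr; f_equal; pose proof (sqrt_succ_sq k); nra.
  - rewrite charlier_weighted_norm by auto.
    unfold borel, tree; rewrite fact_S_INR, exp_Ropp.
    pose proof (fact_pos k); pose proof (exp_pos (INR k + 1)).
    assert ((INR k + 1) ^ k <> 0) by (apply pow_nonzero; lra).
    field; repeat split; lra.
Qed.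

(** Pairing the two exponential solutions at times [0] and [1] gives
    [e^l] and [e^l'] times the same inner product. *)
Lemma eigenvectors_orthogonal d l l' f f' :
  eigenvector d l f -> eigenvector d l' f' -> l <> l' -> ip f f' = 0.
Proof.
  intros Hf Hf' Hne.
  pose proof (pairing_sym d 1 _ _ ltac:(lra) (eigenvector_solution _ _ _ Hf)
    (eigenvector_solution _ _ _ Hf') (eigenvector_tame _ _ _ Hf)
    (eigenvector_tame _ _ _ Hf')) as H.
  assert (He : forall c c', ip (fun n => f n * c) (fun n => f' n * c') = c * c' * ip f f').
  { intros c c'; unfold ip; rewrite <- Series_scal_l; apply Series_ext; intro; ring. }
  cbv beta in H; rewrite !He, !Rmult_1_r, !Rmult_0_r, exp_0 in H.
  assert (Hexp : exp l <> exp l') by (intro Heq; apply exp_inv in Heq; auto).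
  apply Rmult_eq_reg_l with (exp l - exp l'); lra.
Qed.

Lemma phi_orthogonal k k' s s' : s * s = 1 -> s' * s' = 1 -> k <> k' \/ s <> s' ->
  ip (phi k s) (phi k' s') = 0.
Proof.
  intros Hs Hs' Hne.
  apply (eigenvectors_orthogonal 0 (phi_rate k s) (phi_rate k' s'));
    auto using phi_eigenvector.
  unfold phi_rate; intro Heq.
  pose proof (sqrt_succ_pos k) as Hr; pose proof (sqrt_succ_sq k) as Hr2.
  pose proof (sqrt_succ_pos k') as Hr'; pose proof (sqrt_succ_sq k') as Hr2'.
  set (r := sqrt (INR k + 1)) in *; set (r' := sqrt (INR k' + 1)) in *.
  assert (H : s * r' = s' * r).
  { transitivity (s / r * (r * r')); [field; lra|]; rewrite Heq; field; lra. }
  assert (Hsq : r' * r' = r * r).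
  { transitivity ((s * r') * (s * r')); [nra|]; rewrite H; nra. }
  assert (Hk : k = k') by (apply INR_eq; lra).
  destruct Hne as [Hne|Hne]; auto; apply Hne.
  assert (r = r') by (unfold r, r'; now rewrite Hk).
  apply Rmult_eq_reg_r with r; [|lra]; rewrite <- H; congruence.
Qed.

Fixpoint prefix_sum (F : nat -> R) (K : nat) : R :=
  match K with O => 0 | S K => prefix_sum F K + F K end.

Lemma prefix_sum_sum_n F K : prefix_sum F (S K) = sum_n F K.
Proof.
  induction K as [|K IH]; [rewrite sum_O; simpl; ring|].
  rewrite sum_n_succ, <- IH; reflexivity.
Qed.

(** The initial state minus its projection on the first [2 K] eigenvectors, each
    of which has squared norm [2 / borel k] and value [1] at [0]. *)
Fixpoint residual (K n : nat) : R :=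
  match K with
  | O => e0 n
  | S K => residual K n - borel K / 2 * phi K 1 n - borel K / 2 * phi K (-1) n
  end.

Lemma geo_phi k s : geo (phi k s).
Proof. apply geo_mult; [apply geo_pow | apply geo_charlier]. Qed.

Lemma geo_residual K : geo (residual K).
Proof.
  induction K as [|K IH]; [apply geo_e0|].
  cbn [residual]; auto using geo_sub_scal, geo_phi.
Qed.

Definition partial_expansion (K : nat) (g : nat -> R) : R :=
  prefix_sum (fun k => borel k / 2 * (ip (phi k 1) g + ip (phi k (-1)) g)) K.

Lemma ip_residual K g : geo g -> ip (residual K) g = g O - partial_expansion K g.
Proof.
  intro Hg; unfold partial_expansion; induction K as [|K IH]; cbn [residual prefix_sum].
  - rewrite <- ip_e0, Rminus_0_r; reflexivity.
  - rewrite !ip_sub_scal_l by (auto using geo_sub_scal, geo_phi, geo_residual).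
    rewrite IH; ring.
Qed.

Lemma ip_residual_phi K k s : s * s = 1 -> (K <= k)%nat -> ip (residual K) (phi k s) = 1.
Proof.
  intros Hs HK; rewrite ip_residual, phi_0 by apply geo_phi.
  enough (partial_expansion K (phi k s) = 0) by lra.
  unfold partial_expansion; induction K as [|K IH]; [reflexivity|]; cbn [prefix_sum].
  rewrite IH, !phi_orthogonal by (auto; try lia; try lra; left; lia); ring.
Qed.

(** Equality in the Bessel inequality.  With [borel_mass], the residual tends to
    zero. *)
Lemma residual_norm K : ip (residual K) (residual K) = 1 - prefix_sum borel K.
Proof.
  induction K as [|K IH]; cbn [residual prefix_sum].
  - rewrite ip_e0; simpl; ring.
  - pose proof (geo_residual K); pose proof (geo_phi K 1); pose proof (geo_phi K (-1)).
    rewrite !ip_sub_scal_l by (auto using geo_sub_scal).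
    rewrite !ip_sub_scal_r by (auto using geo_sub_scal).
    rewrite !(ip_comm (phi K _) (residual K)).
    rewrite !ip_residual_phi, !phi_norm by (auto; lra).
    rewrite !phi_orthogonal by (try lra; right; lra).
    rewrite IH; pose proof (borel_pos K); field; lra.
Qed.

(** * Vanishing load on the slow time scale *)

Lemma expm1_le x : exp x - 1 <= x * exp x.
Proof.
  pose proof (exp_ineq1_le (- x)) as H; pose proof (exp_pos x).
  assert (exp x * (1 + - x) <= exp x * exp (- x)) by (apply Rmult_le_compat_l; lra).
  rewrite <- exp_plus, Rplus_opp_r, exp_0 in H1; lra.
Qed.

Lemma mass_initial_bounds d u : 0 < d < 1 -> queue d u -> mass u 0 <= 1 + 3 * d ^ 2.
Proof.
  intros Hd Hq; rewrite (mass_initial d) by (auto; lra).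
  pose proof (expm1_le (d ^ 2)).
  assert (exp (d ^ 2) <= 3) by (apply Rle_trans with (exp 1); [apply exp_le; nra | apply exp_le_3]).
  assert (0 < d ^ 2) by nra.
  assert (exp (d ^ 2) <= 1 + 3 * d ^ 2) by nra.
  assert (exp (d ^ 2) - 1 <= d ^ 2 * (1 + 3 * d ^ 2)) by nra.
  apply Rmult_le_reg_r with (d ^ 2); auto; field_simplify; nra.
Qed.

Lemma queue_norm_bound d u t w : 0 < d < 1 -> queue d u -> 0 <= t <= w ->
  ip (fun n => u n t) (fun n => u n t) <= (2 * exp w) ^ 2.
Proof.
  intros Hd Hq Ht; rewrite <- (mass_double d) by (auto; lra).
  eapply Rle_trans; [apply (mass_upper d); auto; lra|].
  pose proof (mass_initial_bounds d u Hd Hq).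
  assert (Hm : mass u 0 <= 4) by nra.
  assert (He : exp (rate d * (2 * t)) <= exp w * exp w).
  { rewrite <- exp_plus; apply exp_le.
    pose proof (rate_pos d); pose proof (rate_lt_1 d ltac:(lra)); nra. }
  pose proof (exp_pos (rate d * (2 * t))); nra.
Qed.

Lemma queue_initial_close d u : 0 < d < 1 -> queue d u ->
  ip (fun n => u n 0 - 1 * e0 n) (fun n => u n 0 - 1 * e0 n) <= (2 * d) ^ 2.
Proof.
  intros Hd Hq; pose proof (queue_tame d u ltac:(lra) Hq) as Tu.
  pose proof (tame_geo u 0 Tu (Rle_refl 0)) as Hg.
  rewrite ip_sub_scal_l by (auto using geo_sub_scal, geo_e0).
  rewrite !ip_sub_scal_r by (auto using geo_e0).
  rewrite (ip_comm _ e0), !ip_e0.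
  pose proof (mass_initial_bounds d u Hd Hq) as H; unfold mass in H.
  destruct Hq as (_ & _ & H0); rewrite H0; simpl e0; simpl INR; simpl pow; nra.
Qed.

Lemma partial_pairing_le f g N : geo f -> geo g ->
  Rabs (sum_n (fun n => f n * g n / INR (fact n)) N) <= ip f f + ip g g.
Proof.
  intros Hf Hg.
  eapply Rle_trans; [apply (norm_sum_n_m (V := R_NormedModule))|].
  apply Rle_trans with
    (sum_n (fun n => plus (wt n * (f n * f n)) (wt n * (g n * g n))) N).
  - apply sum_n_m_le; intro n; unfold norm; simpl; unfold abs, plus; simpl.
    unfold Rdiv; rewrite !Rabs_mult, Rabs_inv, (Rabs_pos_eq (INR _))
      by (left; apply fact_pos).
    assert (Hw : / INR (fact n) <= wt n).
    { unfold wt, Rdiv; pose proof (Rinv_0_lt_compat _ (fact_pos n)).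
      pose proof (pos_INR n); nra. }
    pose proof (Rinv_0_lt_compat _ (fact_pos n)).
    assert (Hsq : forall x, x * x = Rabs x * Rabs x).
    { intro x; rewrite <- Rabs_mult, Rabs_pos_eq; auto; apply Rle_0_sqr. }
    rewrite (Hsq (f n)), (Hsq (g n)).
    pose proof (Rabs_pos (f n)); pose proof (Rabs_pos (g n)).
    apply Rle_trans with (wt n * (Rabs (f n) * Rabs (g n))).
    + rewrite Rmult_comm; apply Rmult_le_compat_r; nra.
    + rewrite <- Rmult_plus_distr_l; apply Rmult_le_compat_l; [left; apply wt_pos | nra].
  - apply partial_sum_le.
    + intro n; unfold plus; simpl; pose proof (wt_pos n).
      assert (0 <= f n * f n) by nra; assert (0 <= g n * g n) by nra; nra.
    + apply (is_series_plus (V := R_NormedModule)); apply Series_correct;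
        now apply ip_summable.
Qed.

(** The component of the queue along an eigenvector of the system with load zero
    is a pure exponential up to an error of order [d]: [pairing] accounts for the
    perturbation of the generator, [queue_initial_close] for that of the initial
    state. *)
Lemma coefficient_limit l f w : eigenvector 0 l f -> f O = 1 -> 0 <= w ->
  exists C, 0 <= C /\ forall d u, 0 < d < 1 -> queue d u ->
    Rabs (ip f (fun n => u n w) - exp (l * w)) <= C * d.
Proof.
  intros Hf Hf0 Hw; pose proof (proj1 Hf) as Hg.
  set (F := ip f f); assert (HF : 0 <= F) by now apply ip_self_pos.
  set (D := (2 * exp w) ^ 2 + exp (Rabs l * w) ^ 2 * F).
  assert (HD : 0 <= D) by (unfold D; pose proof (pow2_ge_0 (2 * exp w));
    pose proof (pow2_ge_0 (exp (Rabs l * w))); nra).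
  exists (w * D + 2 * sqrt F * exp (l * w)); split.
  { pose proof (sqrt_pos F); pose proof (exp_pos (l * w)); nra. }
  intros d u Hd Hq; pose proof (queue_tame d u ltac:(lra) Hq) as Tu.
  pose proof (pairing d 0 D w u (fun n t => f n * exp (l * t)) Hw (proj1 Hq)
    (eigenvector_solution _ _ _ Hf) Tu (eigenvector_tame _ _ _ Hf)) as H.
  cbv beta in H.
  assert (Hip : forall c g, ip g (fun n => f n * c) = c * ip f g).
  { intros c g; rewrite <- ip_scal_l, ip_comm; apply ip_ext; intro; ring. }
  assert (Hip_l : forall c, ip f (fun n => f n * c) = c * ip f f) by auto.
  rewrite !Hip, Rmult_0_r, exp_0, Rmult_1_l, Rminus_0_r, (Rabs_pos_eq d) in H by lra.
  assert (H1 : Rabs (ip f (fun n => u n w) - exp (l * w) * ip f (fun n => u n 0))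
    <= w * (d * D)).
  { apply H; intros N s Hs.
    eapply Rle_trans; [apply (partial_pairing_le (fun n => u n (w - s)))|].
    - apply tame_geo; auto; lra.
    - apply (tame_geo (fun n t => f n * exp (l * t))); [|lra].
      now apply (eigenvector_tame 0).
    - unfold D; apply Rplus_le_compat; [apply (queue_norm_bound d); auto; lra|].
      change (ip (fun n => f n * exp (l * s)) (fun n => f n * exp (l * s))
        <= exp (Rabs l * w) ^ 2 * F).
      rewrite Hip, Hip_l.
      assert (exp (l * s) <= exp (Rabs l * w)).
      { apply exp_le; pose proof (Rle_abs l); pose proof (Rabs_pos l); nra. }
      pose proof (exp_pos (l * s)); fold F.
      simpl; rewrite Rmult_1_r, <- Rmult_assoc; apply Rmult_le_compat_r; [auto|].
      apply Rmult_le_compat; lra. }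
  assert (H2 : Rabs (ip f (fun n => u n 0) - 1) <= 2 * sqrt F * d).
  { pose proof (tame_geo u 0 Tu (Rle_refl 0)) as Hg0.
    rewrite <- Hf0, <- (ip_e0 f), (ip_comm e0).
    replace (ip f (fun n => u n 0) - ip f e0)
      with (ip (fun n => u n 0 - 1 * e0 n) f)
      by (rewrite ip_sub_scal_l, !(ip_comm _ f) by (auto using geo_e0); ring).
    replace (2 * sqrt F * d) with (2 * d * sqrt F) by ring.
    apply ip_le; auto using geo_sub_scal, geo_e0, sqrt_pos; try lra.
    - now apply queue_initial_close.
    - simpl; rewrite Rmult_1_r, sqrt_def; auto; unfold F; lra. }
  replace (ip f (fun n => u n w) - exp (l * w))
    with ((ip f (fun n => u n w) - exp (l * w) * ip f (fun n => u n 0))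
          + exp (l * w) * (ip f (fun n => u n 0) - 1)) by ring.
  eapply Rle_trans; [apply Rabs_triang|].
  rewrite Rabs_mult, (Rabs_pos_eq (exp _)) by (left; apply exp_pos).
  pose proof (exp_pos (l * w)); nra.
Qed.

Lemma partial_expansion_limit K w : 0 <= w ->
  exists C, 0 <= C /\ forall d u, 0 < d < 1 -> queue d u ->
    Rabs (partial_expansion K (fun n => u n w)
          - prefix_sum (fun k => borel k * cosh (w / sqrt (INR k + 1))) K) <= C * d.
Proof.
  intro Hw; induction K as [|K (C & HC & IH)].
  - exists 0; split; [lra|]; intros d u Hd Hq; unfold partial_expansion; simpl.
    rewrite Rminus_0_r, Rabs_R0; lra.
  - destruct (coefficient_limit _ _ w (phi_eigenvector K 1 ltac:(lra)) (phi_0 K 1) Hw)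
      as (C1 & HC1 & H1).
    destruct (coefficient_limit _ _ w (phi_eigenvector K (-1) ltac:(lra)) (phi_0 K (-1)) Hw)
      as (C2 & HC2 & H2).
    pose proof (borel_pos K) as Hb.
    exists (C + borel K / 2 * (C1 + C2)); split; [nra|].
    intros d u Hd Hq; specialize (IH d u Hd Hq).
    specialize (H1 d u Hd Hq); specialize (H2 d u Hd Hq).
    unfold partial_expansion in *; cbn [prefix_sum].
    unfold phi_rate in H1, H2.
    change (cosh (w / sqrt (INR K + 1)))
      with ((exp (w / sqrt (INR K + 1)) + exp (- (w / sqrt (INR K + 1)))) / 2).
    pose proof (sqrt_succ_pos K).
    replace (1 / sqrt (INR K + 1) * w) with (w / sqrt (INR K + 1)) in H1 by (field; lra).
    replace (-1 / sqrt (INR K + 1) * w) with (- (w / sqrt (INR K + 1))) in H2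
      by (field; lra).
    apply Rabs_le_between in IH; apply Rabs_le_between in H1.
    apply Rabs_le_between in H2; apply Rabs_le_between.
    set (X := prefix_sum (fun k => borel k / 2 * _) K) in *.
    set (Y := prefix_sum (fun k => borel k * cosh _) K) in *.
    set (e1 := exp (w / _)) in *; set (e2 := exp (- (w / _))) in *.
    set (p1 := ip (phi K 1) _) in *; set (p2 := ip (phi K (-1)) _) in *.
    replace (X + borel K / 2 * (p1 + p2) - (Y + borel K * ((e1 + e2) / 2)))
      with ((X - Y) + borel K / 2 * ((p1 - e1) + (p2 - e2))) by field.
    assert (Hb2 : 0 <= borel K / 2) by lra.
    pose proof (Rmult_le_compat_l _ ((p1 - e1) + (p2 - e2)) ((C1 + C2) * d) Hb2 ltac:(lra)).
    pose proof (Rmult_le_compat_l _ (- ((C1 + C2) * d)) ((p1 - e1) + (p2 - e2)) Hb2 ltac:(lra)).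
    split; lra.
Qed.

Lemma Q0_series w : is_series (fun k => borel k * cosh (w / sqrt (INR k + 1))) (Q0 w).
Proof.
  assert (Hc : forall x, 0 <= cosh x) by
    (intro x; unfold cosh; pose proof (exp_pos x); pose proof (exp_pos (- x)); lra).
  replace (Q0 w) with (Series (fun k => borel k * cosh (w / sqrt (INR k + 1)))).
  - apply Series_correct.
    apply (ex_series_le (V := R_CompleteNormedModule))
      with (fun k => scal (exp (Rabs w)) (borel k)).
    + intro k; unfold norm, scal; simpl; unfold abs, mult; simpl.
      pose proof (borel_pos k).
      rewrite Rabs_mult, (Rabs_pos_eq (borel k)), (Rabs_pos_eq (cosh _)) by (auto; lra).
      rewrite Rmult_comm; apply Rmult_le_compat_r; [lra|].
      assert (Hb : Rabs (w / sqrt (INR k + 1)) <= Rabs w).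
      { pose proof (sqrt_succ_pos k); pose proof (sqrt_succ_sq k); pose proof (pos_INR k).
        assert (1 <= sqrt (INR k + 1)) by (rewrite <- sqrt_1 at 1; apply sqrt_le_1_alt; lra).
        unfold Rdiv; rewrite Rabs_mult, (Rabs_pos_eq (/ _))
          by (left; now apply Rinv_0_lt_compat).
        assert (/ sqrt (INR k + 1) <= 1)
          by (apply Rle_trans with (/ 1); [apply Rinv_le_contravar; lra | rewrite Rinv_1; lra]).
        pose proof (Rabs_pos w); nra. }
      apply Rabs_le_between in Hb; unfold cosh.
      pose proof (exp_le (w / sqrt (INR k + 1)) (Rabs w) ltac:(lra)).
      pose proof (exp_le (- (w / sqrt (INR k + 1))) (Rabs w) ltac:(lra)); lra.
    + apply (ex_series_scal (V := R_NormedModule)); exists 1; apply borel_mass.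
  - apply Series_ext; intro k; cbv zeta.
    rewrite S_INR; simpl Nat.sub; rewrite Nat.sub_0_r; reflexivity.
Qed.

(** Expand the initial state in finitely many eigenvectors.  The residual is
    small uniformly in [d], by the norm bound on the solution; then [d] is chosen
    small for the finitely many components. *)
Lemma mass_limit w eps : 0 <= w -> 0 < eps ->
  exists eta, 0 < eta <= 1 /\ forall d u, 0 < d < eta -> queue d u ->
    Rabs (mass u w - Q0 w) < eps.
Proof.
  intros Hw Heps.
  set (M := 2 * exp w); assert (HM : 0 < M) by (unfold M; pose proof (exp_pos w); lra).
  (* The residual contributes at most [e M = eps / 8]. *)
  set (e := eps / (8 * M)).
  assert (He : 0 < e) by (apply Rdiv_lt_0_compat; lra).
  destruct (proj2 (is_lim_seq_spec (sum_n borel) 1) borel_mass (mkposreal (e ^ 2) ltac:(nra)))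
    as (N1 & HN1).
  destruct (proj2 (is_lim_seq_spec _ (Q0 w)) (Q0_series w) (mkposreal (eps / 4) ltac:(lra)))
    as (N2 & HN2).
  simpl in HN1, HN2; set (N := max N1 N2).
  specialize (HN1 N ltac:(lia)); specialize (HN2 N ltac:(lia)).
  rewrite <- prefix_sum_sum_n in HN1, HN2.
  destruct (partial_expansion_limit (S N) w Hw) as (C & HC & HCd).
  exists (Rmin 1 (eps / (4 * (C + 2 * M)))); split.
  { split; [|apply Rmin_l].
    apply Rmin_pos; [lra | apply Rdiv_lt_0_compat; lra]. }
  intros d u Hd Hq.
  pose proof (Rmin_l 1 (eps / (4 * (C + 2 * M)))).
  pose proof (Rmin_r 1 (eps / (4 * (C + 2 * M)))).
  assert (Hd1 : 0 < d < 1) by lra.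
  assert (Hd2 : d * (C + 2 * M) < eps / 4).
  { apply Rlt_le_trans with (eps / (4 * (C + 2 * M)) * (C + 2 * M)).
    - apply Rmult_lt_compat_r; lra.
    - right; field; lra. }
  specialize (HCd d u Hd1 Hq).
  pose proof (queue_tame d u ltac:(lra) Hq) as Tu.
  pose proof (tame_geo u w Tu Hw) as Hg; pose proof (tame_geo u 0 Tu (Rle_refl 0)) as Hg0.
  pose proof (queue_norm_bound d u w w Hd1 Hq ltac:(lra)) as HuM; fold M in HuM.
  assert (H1 : Rabs (mass u w - u O w) <= 2 * d * M).
  { replace (mass u w - u O w) with (ip (fun n => u n 0 - 1 * e0 n) (fun n => u n w)).
    - apply ip_le; auto using geo_sub_scal, geo_e0; try lra.
      now apply queue_initial_close.
    - rewrite ip_sub_scal_l, ip_e0 by (auto using geo_e0); unfold mass; ring. }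
  assert (H2 : Rabs (u O w - partial_expansion (S N) (fun n => u n w)) <= e * M).
  { pose proof (ip_residual (S N) _ Hg) as Hr; cbv beta in Hr; rewrite <- Hr.
    apply ip_le; auto using geo_residual; try lra.
    rewrite residual_norm; apply Rabs_lt_between in HN1; lra. }
  assert (HeM : e * M = eps / 8) by (unfold e; field; lra).
  apply Rabs_le_between in H1; apply Rabs_le_between in H2.
  apply Rabs_le_between in HCd; apply Rabs_lt_between in HN2; apply Rabs_lt_between.
  set (X := partial_expansion _ _) in *; set (Y := prefix_sum _ (S N)) in *.
  split; lra.
Qed.

(** * From sojourn times to the slow-time system *)

Lemma is_derive_nonneg_eps f t l : is_derive_nonneg f t l ->
  forall eps, 0 < eps -> exists delta, 0 < delta /\
    forall s, Rabs (s - t) < delta -> s <> t -> 0 <= s ->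
      Rabs ((f s - f t) / (s - t) - l) < eps.
Proof.
  intros H eps Heps.
  destruct (H (fun y => Rabs (y - l) < eps)) as (delta & Hd).
  - exists (mkposreal eps Heps); intros y Hy; exact Hy.
  - exists delta; split; [apply cond_pos|]; intros s Hs Hne Hs0.
    apply (Hd s); auto.
Qed.

Lemma is_derive_nonneg_unique f t l l' :
  0 <= t -> is_derive_nonneg f t l -> is_derive_nonneg f t l' -> l = l'.
Proof.
  intros Ht H H'; destruct (Req_dec l l') as [|Hne]; auto; exfalso.
  set (eps := Rabs (l - l') / 2).
  assert (Heps : 0 < eps) by (assert (0 < Rabs (l - l')) by (apply Rabs_pos_lt; lra);
    unfold eps; lra).
  destruct (is_derive_nonneg_eps f t l H eps Heps) as (d & Hd & H1).
  destruct (is_derive_nonneg_eps f t l' H' eps Heps) as (d' & Hd' & H2).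
  set (s := t + Rmin d d' / 2).
  assert (Hm : 0 < Rmin d d') by now apply Rmin_pos.
  pose proof (Rmin_l d d'); pose proof (Rmin_r d d').
  assert (Hs : Rabs (s - t) = Rmin d d' / 2).
  { unfold s; replace (t + Rmin d d' / 2 - t) with (Rmin d d' / 2) by ring.
    apply Rabs_pos_eq; lra. }
  specialize (H1 s ltac:(lra) ltac:(unfold s; lra) ltac:(unfold s; lra)).
  specialize (H2 s ltac:(lra) ltac:(unfold s; lra) ltac:(unfold s; lra)).
  assert (Rabs (l - l') < eps + eps); [|unfold eps in *; lra].
  replace (l - l') with (- ((f s - f t) / (s - t) - l) + ((f s - f t) / (s - t) - l'))
    by ring.
  eapply Rle_lt_trans; [apply Rabs_triang|]; rewrite Rabs_Ropp; lra.
Qed.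

(** Continuing a function linearly to negative times turns the one-sided
    derivative at [0] into an ordinary one, so that the mean value theorem can be
    used up to the boundary. *)
Definition extend (f : R -> R) (l t : R) : R :=
  if Rle_dec 0 t then f t else f 0 + t * l.

Lemma extend_nonneg f l t : 0 <= t -> extend f l t = f t.
Proof. intro Ht; unfold extend; destruct (Rle_dec 0 t); auto; contradiction. Qed.

Lemma extend_derive f (f' : R -> R) t :
  (forall s, 0 <= s -> is_derive_nonneg f s (f' s)) -> 0 <= t ->
  is_derive (extend f (f' 0)) t (f' t).
Proof.
  intros Hf Ht; apply is_derive_Reals; intros eps Heps.
  destruct (is_derive_nonneg_eps f t _ (Hf t Ht) eps Heps) as (d & Hd & H).
  assert (Hd' : 0 < (if Rlt_dec 0 t then Rmin d t else d))
    by (destruct (Rlt_dec 0 t); auto; now apply Rmin_pos).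
  exists (mkposreal _ Hd'); intros h Hh Hhd; simpl in Hhd.
  rewrite (extend_nonneg f _ t) by auto.
  destruct (Rle_dec 0 (t + h)) as [Hth|Hth].
  - rewrite extend_nonneg by auto.
    specialize (H (t + h)); replace (t + h - t) with h in H by ring.
    apply H; auto; [|lra].
    destruct (Rlt_dec 0 t); auto; eapply Rlt_le_trans; [exact Hhd | apply Rmin_l].
  - assert (t = 0).
    { destruct (Rlt_dec 0 t) as [Hp|Hp]; [|lra].
      pose proof (Rmin_r d t); apply Rabs_def2 in Hhd; lra. }
    subst t; unfold extend; destruct (Rle_dec 0 (0 + h)); [contradiction|].
    replace ((f 0 + (0 + h) * f' 0 - f 0) / h - f' 0) with 0 by (field; auto).
    now rewrite Rabs_R0.
Qed.

Definition density_flow (rho : R) (P : nat -> R -> R) (n : nat) (t : R) : R :=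
  INR n / (INR n + 1) * P (pred n) t - (1 + rho * balking n) * P n t
  + rho * balking n * P (S n) t.

(** The tail equations express the density as a bounded linear combination of
    the tails, so it is bounded and differentiable; differentiating this
    combination gives the equations of the densities. *)
Lemma density_extension (rho : R) (V p : nat -> R -> R) :
  0 < rho -> sojourn_tail rho V -> sojourn_density V p ->
  exists P : nat -> R -> R,
    (forall n t, 0 <= t -> P n t = p n t) /\
    (forall n t, 0 <= t -> is_derive (P n) t (density_flow rho P n t)) /\
    (forall n t, 0 <= t -> Rabs (P n t) <= 2 + 2 * rho) /\
    (forall n, P n 0 = 1 / (INR n + 1)).
Proof.
  intros Hrho HV Hp.
  set (W := fun n => extend (V n) (- p n 0)).
  assert (HWV : forall n t, 0 <= t -> W n t = V n t) by (intros; now apply extend_nonneg).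
  assert (HW : forall n t, 0 <= t -> is_derive (W n) t (- p n t)).
  { intros n t Ht; apply (extend_derive (V n) (fun t => - p n t)); auto; intros; apply Hp; auto. }
  set (P := fun n t => - density_flow rho W n t).
  assert (HP : forall n t, 0 <= t -> P n t = p n t).
  { intros n t Ht; unfold P, density_flow; rewrite !HWV by auto.
    destruct (HV n) as (_ & H); destruct (H t Ht) as (_ & Hd).
    pose proof (is_derive_nonneg_unique _ _ _ _ Ht Hd (Hp n t Ht)); lra. }
  exists P; split; [exact HP|]; split; [|split].
  - intros n t Ht; unfold density_flow; rewrite !HP by auto.
    unfold P, density_flow; evar_last.
    + apply (is_derive_opp (V := R_NormedModule)), (is_derive_plus (V := R_NormedModule));
        [apply (is_derive_minus (V := R_NormedModule))|]; apply is_derive_scal; now apply HW.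
    + unfold opp, plus, minus, opp, plus; simpl; unfold opp, plus; simpl; ring.
  - intros n t Ht; unfold P, density_flow, balking; rewrite !HWV by auto.
    destruct (HV n) as (_ & H1); destruct (H1 t Ht) as (B1 & _).
    destruct (HV (S n)) as (_ & H2); destruct (H2 t Ht) as (B2 & _).
    destruct (HV (pred n)) as (_ & H3); destruct (H3 t Ht) as (B3 & _).
    pose proof (pos_INR n) as Hn.
    set (a := INR n / (INR n + 1)); set (b := 1 / (INR n + 1)).
    assert (Ha : 0 <= a <= 1).
    { split; [apply Rdiv_le_0_compat; lra|].
      apply Rmult_le_reg_r with (INR n + 1); [lra|]; unfold a; field_simplify; lra. }
    assert (Hb : 0 <= b <= 1).
    { split; [apply Rdiv_le_0_compat; lra|].
      apply Rmult_le_reg_r with (INR n + 1); [lra|]; unfold b; field_simplify; lra. }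
    assert (Hrb : 0 <= rho * b <= rho) by nra.
    apply Rabs_le; split; nra.
  - intro n; unfold P, density_flow, balking; rewrite !HWV by lra.
    rewrite (proj1 (HV n)), (proj1 (HV (S n))), (proj1 (HV (pred n))).
    pose proof (INR_succ_pos n); field; lra.
Qed.

Lemma queue_of_density (rho : R) (V p : nat -> R -> R) :
  0 < rho -> sojourn_tail rho V -> sojourn_density V p ->
  exists u, queue (sqrt rho) u /\
    forall t, 0 <= t ->
      pPS rho p t = exp (- rho) * exp (- t) * mass u (sqrt rho * t).
Proof.
  intros Hrho HV Hp.
  destruct (density_extension rho V p Hrho HV Hp) as (P & HPp & HPd & HPb & HP0).
  pose proof (sqrt_lt_R0 rho Hrho) as Hd.
  pose proof (sqrt_def rho ltac:(lra)) as Hdd; set (d := sqrt rho) in *.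
  set (u := fun n w => d ^ n * (exp (w / d) * P n (w / d))).
  assert (Hq : queue d u).
  { split; [|split].
    - intros n w Hw.
      assert (Ht : 0 <= w / d) by (apply Rdiv_le_0_compat; auto).
      evar_last.
      + apply is_derive_scal.
        apply (is_derive_mult (fun w => exp (w / d)) (fun w => P n (w / d)) w
          (exp (w / d) / d) (density_flow rho P n (w / d) / d));
          [auto_derive; auto; unfold Rdiv; ring | | exact Rmult_comm].
        evar_last.
        * apply (is_derive_comp (P n) (fun w => w / d)); [now apply HPd|].
          auto_derive; auto.
        * unfold scal; simpl; unfold mult; simpl; field; lra.
      + match goal with |- @eq _ (?c * plus (mult ?x ?y) (mult ?v ?w)) ?r =>
          change (c * (x * y + v * w) = r) end.
        unfold flow, u, density_flow, balking; rewrite <- Hdd.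
        destruct n as [|n]; cbn [pred pow].
        * simpl (INR 0); field; lra.
        * rewrite S_INR; pose proof (pos_INR n); field; lra.
    - intros T HT; exists (exp (T / d) * (2 + 2 * rho)); split.
      { pose proof (exp_pos (T / d)); nra. }
      intros n w Hw; unfold u; rewrite !Rabs_mult.
      rewrite (Rabs_pos_eq (d ^ n)) by (apply pow_le; lra).
      rewrite (Rabs_pos_eq (exp _)) by (left; apply exp_pos).
      rewrite (Rmult_comm _ (d ^ n)).
      apply Rmult_le_compat_l; [apply pow_le; lra|].
      apply Rmult_le_compat; auto using Rabs_pos; [left; apply exp_pos | |].
      + apply exp_le; apply Rmult_le_compat_r; [left; now apply Rinv_0_lt_compat | lra].
      + apply HPb; apply Rdiv_le_0_compat; lra.
    - intro n; unfold u; unfold Rdiv at 1 2; rewrite Rmult_0_l, exp_0, HP0.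
      unfold Rdiv; ring. }
  exists u; split; auto; intros t Ht.
  rewrite (mass_series d) by auto; unfold pPS; rewrite <- Series_scal_l.
  apply Series_ext; intro n; unfold u.
  replace (d * t / d) with t by (field; lra).
  rewrite HPp by auto.
  replace (rho ^ n) with (d ^ n * d ^ n) by (rewrite <- Rpow_mult_distr, Hdd; auto).
  assert (exp (- t) * exp t = 1) by (rewrite <- exp_plus, Rplus_opp_l; apply exp_0).
  pose proof (fact_pos n).
  transitivity (exp (- t) * exp t * (d ^ n * d ^ n / INR (fact n) * exp (- rho) * p n t));
    [rewrite H; ring | field; lra].
Qed.

(** * Vanishing load at fixed times *)

Lemma exp_neg_1 x : 0 <= x -> Rabs (exp (- x) - 1) <= x.
Proof.
  intro Hx; pose proof (exp_ineq1_le (- x)).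
  assert (exp (- x) <= 1) by (rewrite <- exp_0; apply exp_le; lra).
  apply Rabs_le; lra.
Qed.

Lemma exp_neg_2 x : 0 <= x -> Rabs (exp (- x) - 1 + x) <= x ^ 2.
Proof.
  intro Hx.
  replace (exp (- x) - 1 + x)
    with ((exp (- x) - 1 + x) - (exp (- 0) - 1 + 0)) by (rewrite Ropp_0, exp_0; ring).
  replace (x ^ 2) with (x * x) by ring.
  apply (derive_bounded (fun x => exp (- x) - 1 + x) (fun x => - (exp (- x) - 1))); auto.
  - intros t _; auto_derive; auto; ring.
  - intros t Ht; rewrite Rabs_Ropp; eapply Rle_trans; [apply exp_neg_1; lra | lra].
Qed.

Lemma exp_neg_3 x : 0 <= x -> Rabs (exp (- x) - 1 + x - x ^ 2 / 2) <= x ^ 3.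
Proof.
  intro Hx.
  replace (exp (- x) - 1 + x - x ^ 2 / 2)
    with ((exp (- x) - 1 + x - x ^ 2 / 2) - (exp (- 0) - 1 + 0 - 0 ^ 2 / 2))
    by (rewrite Ropp_0, exp_0; field).
  replace (x ^ 3) with (x * x ^ 2) by ring.
  apply (derive_bounded (fun x => exp (- x) - 1 + x - x ^ 2 / 2)
    (fun x => - (exp (- x) - 1 + x))); auto.
  - intros t _; auto_derive; auto; field.
  - intros t Ht; rewrite Rabs_Ropp; eapply Rle_trans; [apply exp_neg_2; lra|].
    apply pow_incr; lra.
Qed.

(** Integrate the first two equations successively, inserting in each the
    expansion obtained so far.  The states [n >= 2] have Poisson weight of order
    [rho^2]; the constant depends only on [t]. *)
Lemma short_time (t : R) : 0 <= t -> exists C, forall rho V p,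
  0 < rho <= 1 -> sojourn_tail rho V -> sojourn_density V p ->
  Rabs (exp t * pPS rho p t - 1 - rho / 4 * (t ^ 2 - 2)) <= C * rho ^ 2.
Proof.
  intro Ht; set (B := 4 * exp t).
  assert (HB : 0 < B) by (unfold B; pose proof (exp_pos t); lra).
  set (C1 := t * B * (t + 1)).
  set (C0 := t * (C1 + 2 * B * t)).
  set (C2 := C0 + C1 + 3 * B).
  exists (1 + t ^ 2 + 2 + C2); intros rho V p Hrho HV Hp.
  destruct (density_extension rho V p ltac:(lra) HV Hp) as (P & HPp & HPd & HPb & HP0).
  set (q := fun n t => exp t * P n t).
  assert (Hq : forall n s, 0 <= s -> is_derive (q n) s
    ((INR n * q (pred n) s - rho * q n s + rho * q (S n) s) / (INR n + 1))).
  { intros n s Hs; evar_last.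
    - apply (is_derive_mult exp (P n) s (exp s) (density_flow rho P n s));
        [apply is_derive_exp | now apply HPd | exact Rmult_comm].
    - match goal with |- @eq _ (plus (mult ?x ?y) (mult ?v ?w)) ?r =>
        change (x * y + v * w = r) end.
      unfold q, density_flow, balking; pose proof (INR_succ_pos n); field; lra. }
  assert (Hqb : forall n s, 0 <= s <= t -> Rabs (q n s) <= B).
  { intros n s Hs; unfold q, B; rewrite Rabs_mult, (Rabs_pos_eq (exp s))
      by (left; apply exp_pos).
    pose proof (HPb n s ltac:(lra)); pose proof (Rabs_pos (P n s)).
    pose proof (exp_pos s); pose proof (exp_le s t ltac:(lra)); nra. }
  assert (Hq0 : forall n, q n 0 = 1 / (INR n + 1)).
  { intro n; unfold q; rewrite exp_0, HP0; ring. }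
  (* Successive approximation: state [0] up to order [rho], then state [1],
     then state [0] up to order [rho^2]. *)
  assert (E0 : forall s, 0 <= s <= t -> Rabs (q O s - 1) <= 2 * B * t * rho).
  { intros s Hs; replace 1 with (q O 0) by (rewrite Hq0; simpl; field).
    apply Rle_trans with (s * (2 * B * rho)); [|assert (0 <= B * rho) by nra; nra].
    apply (derive_bounded _ (fun s => rho * (q 1%nat s - q O s))); [lra| |].
    - intros r Hr; evar_last; [apply Hq; lra | simpl; field].
    - intros r Hr; pose proof (Hqb O r ltac:(lra)) as H0.
      pose proof (Hqb 1%nat r ltac:(lra)) as H1.
      apply Rabs_le_between in H0; apply Rabs_le_between in H1; apply Rabs_le; nra. }
  assert (E1 : forall s, 0 <= s <= t -> Rabs (q 1%nat s - / 2 - s / 2) <= C1 * rho).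
  { intros s Hs.
    replace (q 1%nat s - / 2 - s / 2) with (q 1%nat s - s / 2 - (q 1%nat 0 - 0 / 2))
      by (rewrite Hq0; simpl; field).
    apply Rle_trans with (s * (B * (t + 1) * rho)).
    2: { unfold C1; assert (0 <= B * (t + 1) * rho) by (apply Rmult_le_pos; nra); nra. }
    apply (derive_bounded (fun s => q 1%nat s - s / 2)
      (fun s => (q O s - 1 - rho * q 1%nat s + rho * q 2%nat s) / 2)); [lra| |].
    - intros r Hr; evar_last.
      + apply (is_derive_minus (V := R_NormedModule)); [apply Hq; lra|].
        instantiate (1 := / 2); auto_derive; auto; field.
      + unfold minus, plus, opp; simpl; field.
    - intros r Hr; pose proof (E0 r ltac:(lra)) as H0.
      pose proof (Hqb 1%nat r ltac:(lra)) as H1; pose proof (Hqb 2%nat r ltac:(lra)) as H2.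
      apply Rabs_le_between in H0; apply Rabs_le_between in H1.
      apply Rabs_le_between in H2; apply Rabs_le; nra. }
  assert (E2 : Rabs (q O t - 1 + rho * t / 2 - rho * t ^ 2 / 4) <= C0 * rho ^ 2).
  { replace (q O t - 1 + rho * t / 2 - rho * t ^ 2 / 4)
      with (q O t + rho * t / 2 - rho * t ^ 2 / 4
            - (q O 0 + rho * 0 / 2 - rho * 0 ^ 2 / 4)) by (rewrite Hq0; simpl; field).
    replace (C0 * rho ^ 2) with (t * ((C1 + 2 * B * t) * rho ^ 2)) by (unfold C0; ring).
    apply (derive_bounded (fun s => q O s + rho * s / 2 - rho * s ^ 2 / 4)
      (fun s => rho * ((q 1%nat s - / 2 - s / 2) - (q O s - 1)))); [lra| |].
    - intros r Hr; evar_last.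
      + apply (is_derive_minus (V := R_NormedModule));
          [apply (is_derive_plus (V := R_NormedModule)); [apply Hq; lra|]|].
        * instantiate (1 := rho / 2); auto_derive; auto; field.
        * instantiate (1 := rho * r / 2); auto_derive; auto; field.
      + unfold minus, plus, opp; simpl; field.
    - intros r Hr; pose proof (E0 r Hr) as H0; pose proof (E1 r Hr) as H1.
      apply Rabs_le_between in H0; apply Rabs_le_between in H1; apply Rabs_le; nra. }
  set (F := fun n => rho ^ n / INR (fact n) * q n t).
  assert (HFb : forall n, Rabs (F n) <= B * (rho ^ n / INR (fact n))).
  { intro n; unfold F; rewrite Rabs_mult, Rabs_pos_eq, Rmult_comm.
    - apply Rmult_le_compat_r; [|apply Hqb; lra].
      apply Rdiv_le_0_compat; [apply pow_le; lra | apply fact_pos].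
    - apply Rdiv_le_0_compat; [apply pow_le; lra | apply fact_pos]. }
  assert (HF : ex_series F).
  { apply (ex_series_le (V := R_CompleteNormedModule))
      with (fun n => scal B (rho ^ n / INR (fact n))); [exact HFb|].
    apply (ex_series_scal (V := R_NormedModule)); eexists; apply exp_series. }
  assert (HF1 : ex_series (fun n => F (S n)))
    by (apply (ex_series_incr_1 (V := R_NormedModule) F); exact HF).
  assert (HS : Series F = q O t + rho * q 1%nat t + Series (fun n => F (S (S n)))).
  { rewrite Series_incr_1, (Series_incr_1 (fun n => F (S n))) by auto.
    unfold F; simpl; field. }
  assert (HR : Rabs (Series (fun n => F (S (S n)))) <= 3 * B * rho ^ 2).
  { assert (Hle : forall n, Rabs (F (S (S n))) <= B * rho ^ 2 * (1 ^ n / INR (fact n))).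
    { intro n; eapply Rle_trans; [apply HFb|].
      rewrite Rmult_assoc; apply Rmult_le_compat_l; [lra|].
      rewrite pow1; change (rho ^ S (S n)) with (rho * (rho * rho ^ n)).
      unfold Rdiv; replace (rho * (rho * rho ^ n) * / INR (fact (S (S n))))
        with (rho ^ 2 * (rho ^ n * / INR (fact (S (S n))))) by ring.
      apply Rmult_le_compat_l; [nra|].
      assert (0 <= rho ^ n <= 1).
      { split; [apply pow_le; lra|]; rewrite <- (pow1 n); apply pow_incr; lra. }
      assert (/ INR (fact (S (S n))) <= / INR (fact n)).
      { apply Rinv_le_contravar; [apply fact_pos|].
        rewrite !fact_S_INR, S_INR; pose proof (pos_INR n); pose proof (fact_pos n).
        assert (0 <= INR n * INR (fact n)) by nra; nra. }
      pose proof (Rinv_0_lt_compat _ (fact_pos (S (S n)))); nra. }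
    assert (Hex : ex_series (fun n => B * rho ^ 2 * (1 ^ n / INR (fact n)))).
    { apply (ex_series_scal (V := R_NormedModule) (B * rho ^ 2)
        (fun n => 1 ^ n / INR (fact n))); eexists; apply exp_series. }
    assert (Hexa : ex_series (fun n => Rabs (F (S (S n))))).
    { apply (ex_series_le (V := R_CompleteNormedModule))
        with (fun n => B * rho ^ 2 * (1 ^ n / INR (fact n))); auto.
      intro n; unfold norm; simpl; unfold abs; simpl; rewrite Rabs_Rabsolu; auto. }
    eapply Rle_trans; [apply Series_Rabs; auto|].
    apply Rle_trans with (Series (fun n => B * rho ^ 2 * (1 ^ n / INR (fact n)))).
    - apply Series_le; auto; intro n; split; [apply Rabs_pos | apply Hle].
    - rewrite Series_scal_l, (is_series_unique _ _ (exp_series 1)).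
      pose proof exp_le_3; assert (0 <= B * rho ^ 2) by nra; nra. }
  assert (HpPS : exp t * pPS rho p t = exp (- rho) * Series F).
  { unfold pPS, F, q; rewrite <- !Series_scal_l; apply Series_ext; intro n.
    rewrite HPp by auto; ring. }
  rewrite HpPS, HS.
  pose proof (E1 t ltac:(lra)) as E1t.
  pose proof (exp_neg_2 rho ltac:(lra)) as Ee; pose proof (exp_pos (- rho)) as He0.
  assert (He1 : exp (- rho) <= 1) by (rewrite <- exp_0; apply exp_le; lra).
  set (Rm := Series (fun n => F (S (S n)))) in *.
  set (r0 := q O t - 1 + rho * t / 2 - rho * t ^ 2 / 4) in *.
  set (r1 := q 1%nat t - / 2 - t / 2) in *.
  set (e := exp (- rho)) in *; set (r2 := e - 1 + rho) in *.
  set (s1 := / 2 + t ^ 2 / 4).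
  replace (e * (q O t + rho * q 1%nat t + Rm) - 1 - rho / 4 * (t ^ 2 - 2))
    with (- rho ^ 2 * s1 + r2 * (1 + rho * s1) + e * (r0 + rho * r1 + Rm))
    by (unfold r2, r0, r1, s1; field).
  assert (Hs1 : 0 <= s1) by (unfold s1; nra).
  eapply Rle_trans; [apply Rabs_triang|].
  apply Rle_trans with ((rho ^ 2 * s1 + rho ^ 2 * (1 + rho * s1))
    + 1 * (C0 * rho ^ 2 + rho * (C1 * rho) + 3 * B * rho ^ 2)).
  - apply Rplus_le_compat.
    + eapply Rle_trans; [apply Rabs_triang|]; apply Rplus_le_compat.
      * rewrite Rabs_mult, Rabs_Ropp, !Rabs_pos_eq; nra.
      * rewrite Rabs_mult, (Rabs_pos_eq (1 + rho * s1)) by nra.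
        apply Rmult_le_compat_r; nra.
    + rewrite Rabs_mult, (Rabs_pos_eq e) by lra.
      apply Rmult_le_compat; try lra; auto using Rabs_pos.
      eapply Rle_trans; [apply Rabs_triang|]; apply Rplus_le_compat; auto.
      eapply Rle_trans; [apply Rabs_triang|]; apply Rplus_le_compat; auto.
      rewrite Rabs_mult, (Rabs_pos_eq rho) by lra; apply Rmult_le_compat_l; lra.
  - assert (rho ^ 2 * (rho * s1) <= rho ^ 2 * s1) by (apply Rmult_le_compat_l; nra).
    unfold C2, s1 in *; nra.
Qed.

(** * Asymptotic equivalences *)

Lemma squeeze (F : (R -> Prop) -> Prop) {FF : Filter F} (lo f hi : R -> R) (l : R) :
  F (fun x => lo x <= f x <= hi x) ->
  filterlim lo F (locally l) -> filterlim hi F (locally l) -> filterlim f F (locally l).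
Proof.
  intros Hf Hlo Hhi P (eps & HP).
  assert (H1 : F (fun x => Rabs (lo x - l) < eps)) by (apply (Hlo (fun y => Rabs (y - l) < eps)); now exists eps).
  assert (H2 : F (fun x => Rabs (hi x - l) < eps)) by (apply (Hhi (fun y => Rabs (y - l) < eps)); now exists eps).
  unfold filtermap.
  apply (filter_imp (fun x => (lo x <= f x <= hi x) /\
    (Rabs (lo x - l) < eps /\ Rabs (hi x - l) < eps))).
  - intros x (Hx & H3 & H4); apply HP; change (Rabs (f x - l) < eps).
    apply Rabs_lt_between in H3; apply Rabs_lt_between in H4.
    apply Rabs_lt_between; lra.
  - apply filter_and; auto; now apply filter_and.
Qed.

Lemma filterlim_Rmult (F : (R -> Prop) -> Prop) {FF : Filter F} (f g : R -> R) (a b : R) :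
  filterlim f F (locally a) -> filterlim g F (locally b) ->
  filterlim (fun x => f x * g x) F (locally (a * b)).
Proof.
  intros Hf Hg; apply (filterlim_comp_2 f g Rmult Hf Hg).
  apply (filterlim_mult (K := R_AbsRing) a b).
Qed.

Lemma filterlim_of_derivable (F : (R -> Prop) -> Prop) {FF : Filter F}
  (f g : R -> R) (a : R) :
  filterlim f F (locally a) -> ex_derive g a ->
  filterlim (fun x => g (f x)) F (locally (g a)).
Proof.
  intros Hf Hg; apply (filterlim_comp _ _ _ f g F (locally a) (locally (g a)) Hf).
  exact (ex_derive_continuous (V := R_NormedModule) g a Hg).
Qed.

Lemma filterlim_Rinv_1 (F : (R -> Prop) -> Prop) {FF : Filter F} (f : R -> R) :
  filterlim f F (locally 1) -> filterlim (fun x => / f x) F (locally 1).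
Proof.
  intro Hf; replace (locally 1) with (locally (/ 1)) by (now rewrite Rinv_1).
  apply (filterlim_of_derivable F f Rinv 1 Hf); auto_derive; lra.
Qed.

Lemma sqrt_lim_0 : filterlim sqrt (at_right 0) (locally 0).
Proof.
  replace (locally 0) with (locally (sqrt 0)) by (now rewrite sqrt_0).
  eapply filterlim_filter_le_1; [apply filter_le_within|].
  apply continuity_pt_filterlim, continuity_pt_sqrt; lra.
Qed.

Lemma id_lim_0 : filterlim (fun x : R => x) (at_right 0) (locally 0).
Proof. eapply filterlim_filter_le_1; [apply filter_le_within | apply filterlim_id]. Qed.

Lemma inv_lim_infty : filterlim Rinv (Rbar_locally p_infty) (locally 0).
Proof. apply (filterlim_Rbar_inv p_infty); easy. Qed.

Lemma at_right_positive : at_right 0 (fun x => 0 < x).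
Proof. exists (mkposreal 1 Rlt_0_1); auto. Qed.

Lemma at_right_lt (eta : R) : 0 < eta -> at_right 0 (fun x => 0 < x < eta).
Proof.
  intro H; exists (mkposreal eta H); intros y Hy Hy0; split; auto.
  change (Rabs (y - 0) < eta) in Hy; rewrite Rminus_0_r in Hy.
  apply Rabs_lt_between in Hy; lra.
Qed.

Lemma infty_gt (M : R) : Rbar_locally p_infty (fun x => M < x).
Proof. exists M; auto. Qed.

Lemma busy_prob_ratio x : 0 < x -> 1 - x <= (1 - exp (- x)) / x <= 1.
Proof.
  intro Hx; pose proof (exp_ineq1_le (- x)).
  pose proof (exp_neg_2 x ltac:(lra)) as H2; apply Rabs_le_between in H2.
  split; apply Rmult_le_reg_r with x; auto; field_simplify; nra.
Qed.

Lemma busy_prob_pos x : 0 < x -> 0 < 1 - exp (- x).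
Proof. intro Hx; assert (exp (- x) < exp 0) by (apply exp_increasing; lra); rewrite exp_0 in *; lra. Qed.

Lemma busy_prob_ratio_lim : filterlim (fun x => (1 - exp (- x)) / x) (at_right 0) (locally 1).
Proof.
  apply (squeeze _ (fun x => 1 - x) _ (fun _ => 1)).
  - apply (filter_imp (fun x => 0 < x)); [|apply at_right_positive].
    intros x Hx; now apply busy_prob_ratio.
  - replace (locally 1) with (locally (1 - 0)) by (f_equal; ring).
    apply (filterlim_of_derivable _ (fun x => x) (fun x => 1 - x) 0 id_lim_0).
    auto_derive; auto.
  - apply filterlim_const.
Qed.

Lemma exp_neg_le_inv x : 0 < x -> exp (- x) <= / x.
Proof.
  intro Hx; rewrite exp_Ropp; apply Rinv_le_contravar; auto.
  pose proof (exp_ineq1_le x); lra.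
Qed.

Lemma busy_prob_lim : filterlim (fun x => 1 - exp (- x)) (Rbar_locally p_infty) (locally 1).
Proof.
  apply (squeeze _ (fun x => 1 - / x) _ (fun _ => 1)).
  - apply (filter_imp (fun x => 0 < x)); [|apply infty_gt].
    intros x Hx; pose proof (exp_pos (- x)); pose proof (exp_neg_le_inv x Hx); lra.
  - replace (locally 1) with (locally (1 - 0)) by (f_equal; ring).
    apply (filterlim_of_derivable _ Rinv (fun x => 1 - x) 0 inv_lim_infty).
    auto_derive; auto.
  - apply filterlim_const.
Qed.

Lemma Lambda0_rate rho : 0 < rho -> Lambda0 rho = sqrt rho * rate (sqrt rho).
Proof.
  intro Hr; unfold Lambda0, rate.
  pose proof (sqrt_def rho ltac:(lra)) as Hd.
  replace (sqrt rho ^ 2 + 4) with (rho + 4) by (simpl; lra).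
  replace (rho ^ 2 + 4 * rho) with (rho * (rho + 4)) by ring.
  rewrite sqrt_mult by lra; nra.
Qed.

Lemma rate_sqrt rho : 0 < rho -> rate (sqrt rho) = (sqrt (rho + 4) - sqrt rho) / 2.
Proof.
  intro Hr; unfold rate; pose proof (sqrt_def rho ltac:(lra)).
  do 3 f_equal; simpl; lra.
Qed.

(** Uses [1 / (2 + d / l) = (s - d) / (2 s)] with [s = sqrt (d^2 + 4)] and
    [l = (s - d) / 2]. *)
Lemma prefactor_eq rho : 0 < rho ->
  (sqrt (rho + 4) - sqrt rho) / (2 * sqrt (rho + 4)) * exp (- 1 - rho)
    * exp (rho / Lambda0 rho) = exp (- rho) * ground_weight (sqrt rho).
Proof.
  intro Hr; unfold ground_weight.
  pose proof (sqrt_lt_R0 rho Hr) as Hd; pose proof (sqrt_def rho ltac:(lra)) as Hdd.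
  pose proof (rate_pos (sqrt rho)) as Hl.
  replace (rho / Lambda0 rho) with (sqrt rho / rate (sqrt rho)).
  - replace ((sqrt (rho + 4) - sqrt rho) / (2 * sqrt (rho + 4)))
      with (/ (2 + sqrt rho / rate (sqrt rho))).
    + replace (exp (sqrt rho / rate (sqrt rho) - 1))
        with (exp (sqrt rho / rate (sqrt rho)) * exp (- 1)) by (rewrite <- exp_plus; f_equal).
      replace (exp (- 1 - rho)) with (exp (- 1) * exp (- rho))
        by (rewrite <- exp_plus; f_equal).
      unfold Rdiv; ring.
    + rewrite rate_sqrt in * by auto.
      assert (0 < sqrt (rho + 4)) by (apply sqrt_lt_R0; lra).
      field; repeat split; lra.
  - rewrite Lambda0_rate by auto; rewrite <- Hdd at 3; field; lra.
Qed.

(** As the load vanishes, the decay rate in [mass_gap] stays bounded below and the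
    constant bounded above, while the slow time [zeta / d] tends to infinity. *)
Lemma light_load_gap d u zeta : 0 < d < 1 -> queue d u -> 0 < zeta ->
  Rabs (mass u (zeta / d) * exp (- (rate d * (zeta / d))) - ground_weight d)
    <= 816 * exp 8 / zeta * d.
Proof.
  intros Hd Hu Hz; pose proof (rate_pos d) as Hl; pose proof (rate_eq d) as Heq.
  set (l := rate d) in *.
  (* For [d < 1]: [l > 1 / 2], so [a <= 4], [1 + a^2 <= 17], and [816 = 3 * 272]. *)
  assert (Hl2 : / 2 < l) by nra.
  set (a := (/ l) ^ 2).
  assert (Ha : 0 < a <= 4).
  { assert (/ l < 2) by (replace 2 with (/ / 2) by field; apply Rinv_lt_contravar; nra).
    assert (0 < / l) by now apply Rinv_0_lt_compat.
    unfold a; nra. }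
  eapply Rle_trans; [apply (mass_gap d u); auto; try lra|].
  { apply Rdiv_le_0_compat; lra. }
  fold l; fold a.
  set (k := l * / (1 + a ^ 2) / 8).
  assert (Hk : / 272 <= k).
  { assert (/ 17 <= / (1 + a ^ 2)) by (apply Rinv_le_contravar; nra).
    unfold k; nra. }
  assert (He : exp (- (k * (zeta / d))) <= 272 / zeta * d).
  { eapply Rle_trans; [apply exp_neg_le_inv|].
    - apply Rmult_lt_0_compat; [lra | apply Rdiv_lt_0_compat; lra].
    - replace (/ (k * (zeta / d))) with (/ k * (d / zeta)) by (field; lra).
      replace (272 / zeta * d) with (272 * (d / zeta)) by (field; lra).
      apply Rmult_le_compat_r; [apply Rdiv_le_0_compat; lra|].
      replace 272 with (/ / 272) by field; apply Rinv_le_contravar; lra. }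
  assert (He8 : exp (2 * a) <= exp 8) by (apply exp_le; lra).
  pose proof (exp_pos (2 * a)); pose proof (exp_pos (- (k * (zeta / d)))).
  replace (816 * exp 8 / zeta * d) with (3 * exp 8 * (272 / zeta * d)) by (field; lra).
  apply Rmult_le_compat; lra.
Qed.

Lemma Q0_pos w : 0 < Q0 w.
Proof.
  assert (Hc : forall x, 0 < cosh x) by
    (intro x; unfold cosh; pose proof (exp_pos x); pose proof (exp_pos (- x)); lra).
  eapply Rlt_le_trans; [|apply (partial_sum_le _ _ 0) with (2 := Q0_series w)].
  - rewrite sum_O; apply Rmult_lt_0_compat; [apply borel_pos | apply Hc].
  - intro n; apply Rmult_le_pos; left; [apply borel_pos | apply Hc].
Qed.

Section Asymptotics.

Context (V p : R -> nat -> R -> R)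
  (HV : forall rho : R, 0 < rho -> sojourn_tail rho (V rho))
  (Hp : forall rho : R, 0 < rho -> sojourn_density (V rho) (p rho)).

Let queue_of rho (Hr : 0 < rho) :=
  queue_of_density rho (V rho) (p rho) Hr (HV rho Hr) (Hp rho Hr).

Lemma pPS_pos rho t : 0 < rho -> 0 <= t -> 0 < pPS rho (p rho) t.
Proof.
  intros Hr Ht; destruct (queue_of rho Hr) as (u & Hu & HE); rewrite HE by auto.
  pose proof (sqrt_lt_R0 rho Hr) as Hd.
  assert (Hw : 0 <= sqrt rho * t) by nra.
  pose proof (mass_lower _ u _ Hd Hu Hw); pose proof (ground_weight_pos _ Hd).
  pose proof (exp_pos (rate (sqrt rho) * (sqrt rho * t))).
  pose proof (exp_pos (- rho)); pose proof (exp_pos (- t)).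
  repeat apply Rmult_lt_0_compat; auto; nra.
Qed.

(** The relative error in [mass_gap] decays exponentially, hence faster than
    [A / t]. *)
Lemma fixed_load rho : 0 < rho ->
  asymp_equiv (Rbar_locally p_infty)
    (fun t => pPS rho (p rho) t)
    (fun t => (sqrt (rho + 4) - sqrt rho) / (2 * sqrt (rho + 4))
              * exp (- 1 - rho) * exp (rho / Lambda0 rho)
              * exp (- t) * exp (Lambda0 rho * t)).
Proof.
  intro Hr; destruct (queue_of rho Hr) as (u & Hu & HE).
  pose proof (sqrt_lt_R0 rho Hr) as Hd; set (d := sqrt rho) in *.
  pose proof (ground_weight_pos d Hd) as Hg; pose proof (rate_pos d) as Hl.
  set (k := rate d * / (1 + ((/ rate d) ^ 2) ^ 2) / 8 * d).
  assert (Hk : 0 < k).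
  { apply Rmult_lt_0_compat; auto; apply Rdiv_lt_0_compat; [|lra].
    apply Rmult_lt_0_compat; auto; apply Rinv_0_lt_compat.
    pose proof (pow2_ge_0 ((/ rate d) ^ 2)); lra. }
  set (A := 3 * exp (2 * (/ rate d) ^ 2) / (ground_weight d * k)).
  unfold asymp_equiv.
  apply (squeeze _ (fun t => 1 - A * / t) _ (fun t => 1 + A * / t)).
  - apply (filter_imp (fun t => 0 < t)); [|apply infty_gt]; intros t Ht.
    rewrite HE, prefactor_eq, Lambda0_rate by (auto; lra); fold d.
    pose proof (mass_gap d u Hd Hu (d * t) ltac:(nra)) as H.
    replace (rate d * / (1 + ((/ rate d) ^ 2) ^ 2) / 8 * (d * t)) with (k * t) in H
      by (unfold k; ring).
    replace (exp (- rho) * exp (- t) * mass u (d * t)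
      / (exp (- rho) * ground_weight d * exp (- t) * exp (d * rate d * t)))
      with (mass u (d * t) * exp (- (rate d * (d * t))) / ground_weight d).
    + assert (Hb : Rabs (mass u (d * t) * exp (- (rate d * (d * t))) - ground_weight d)
        <= ground_weight d * (A * / t)).
      { eapply Rle_trans; [exact H|].
        apply Rle_trans with (3 * exp (2 * (/ rate d) ^ 2) * / (k * t)).
        - apply Rmult_le_compat_l; [pose proof (exp_pos (2 * (/ rate d) ^ 2)); lra|].
          apply exp_neg_le_inv; nra.
        - right; unfold A; field; repeat split; lra. }
      apply Rabs_le_between in Hb.
      split; apply Rmult_le_reg_r with (ground_weight d); auto; unfold Rdiv;
        rewrite ?(Rmult_assoc _ (/ ground_weight d)), ?Rinv_l, ?Rmult_1_r by lra; lra.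
    + replace (d * rate d * t) with (rate d * (d * t)) by ring.
      rewrite (exp_Ropp (rate d * (d * t))).
      pose proof (exp_pos (rate d * (d * t))); pose proof (exp_pos (- rho)).
      pose proof (exp_pos (- t)); field; lra.
  - replace (locally 1) with (locally (1 - A * 0)) by (f_equal; ring).
    apply (filterlim_of_derivable _ Rinv (fun x => 1 - A * x) 0 inv_lim_infty).
    auto_derive; auto.
  - replace (locally 1) with (locally (1 + A * 0)) by (f_equal; ring).
    apply (filterlim_of_derivable _ Rinv (fun x => 1 + A * x) 0 inv_lim_infty).
    auto_derive; auto.
Qed.

(** Positivity of [pPS] is needed for the quotient to be [rho / (1 - e^(- rho))]. *)
Lemma light_load_PS_ROS (T : R -> R) :
  (forall rho, 0 < rho -> 0 <= T rho) ->
  asymp_equiv (at_right 0)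
    (fun rho => pPS rho (p rho) (T rho))
    (fun rho => / rho * pROS rho (p rho) (T rho)).
Proof.
  intro HT; unfold asymp_equiv.
  apply filterlim_within_ext with (fun rho => / ((1 - exp (- rho)) / rho)).
  - intros rho Hr; unfold pROS.
    pose proof (pPS_pos rho (T rho) Hr (HT rho Hr)); pose proof (busy_prob_pos rho Hr).
    field; repeat split; lra.
  - apply (filterlim_Rinv_1 (at_right 0)), busy_prob_ratio_lim.
Qed.

Lemma exp_neg_lim_0 : filterlim (fun x => exp (- x)) (at_right 0) (locally 1).
Proof.
  replace (locally 1) with (locally (exp (- 0))) by (rewrite Ropp_0, exp_0; auto).
  apply (filterlim_of_derivable _ (fun x => x) (fun x => exp (- x)) 0 id_lim_0).
  auto_derive; auto.
Qed.

Lemma rate_0 : rate 0 = 1.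
Proof.
  unfold rate; replace (0 ^ 2 + 4) with (2 * 2) by ring.
  rewrite sqrt_square by lra; field.
Qed.

Lemma ground_weight_0 : ground_weight 0 = / 2 * exp (- 1).
Proof.
  unfold ground_weight; rewrite rate_0.
  replace (exp (0 / 1 - 1)) with (exp (- 1)) by (f_equal; field); field.
Qed.

Lemma ex_derive_rate d : ex_derive rate d.
Proof. unfold rate; auto_derive; nra. Qed.

Lemma ex_derive_ground_weight : ex_derive ground_weight 0.
Proof.
  pose proof rate_0; unfold ground_weight; auto_derive.
  rewrite rate_0; repeat split; auto using ex_derive_rate; lra.
Qed.

Lemma light_load_long zeta : 0 < zeta ->
  asymp_equiv (at_right 0)
    (fun rho => / rho * pROS rho (p rho) (zeta / rho))
    (fun rho => / 2 * exp (- 1) * exp (- zeta / 2)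
                * exp (- (1 - sqrt rho) * (zeta / rho))).
Proof.
  intro Hz; unfold asymp_equiv.
  set (m := fun rho => exp rho * exp (zeta / rho) * pPS rho (p rho) (zeta / rho)
    * exp (- (rate (sqrt rho) * (zeta / sqrt rho)))).
  apply filterlim_within_ext with (fun rho =>
    (1 - exp (- rho)) / rho * exp (- rho) * (m rho * / (/ 2 * exp (- 1)))
    * exp (zeta * (/ 2 - rate (sqrt rho) / (1 + rate (sqrt rho))))).
  - intros rho Hr; unfold m, pROS.
    pose proof (sqrt_lt_R0 rho Hr) as Hd; pose proof (sqrt_def rho ltac:(lra)) as Hdd.
    pose proof (rate_pos (sqrt rho)) as Hl; pose proof (rate_eq (sqrt rho)) as Heq.
    set (d := sqrt rho) in *; set (l := rate d) in *.
    replace (zeta * (/ 2 - l / (1 + l)))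
      with (zeta / 2 + l * (zeta / d) - zeta / d).
    (* [1 - l^2 = d l] turns the large difference of exponents into a bounded one. *)
    2: { assert (Hl1 : 1 - l = d * l / (1 + l)).
         { apply Rmult_eq_reg_r with (1 + l); [field_simplify; nra | lra]. }
         replace (zeta / 2 + l * (zeta / d) - zeta / d)
           with (zeta / 2 - (1 - l) * (zeta / d)) by (field; lra).
         rewrite Hl1; field; lra. }
    replace (- (1 - d) * (zeta / rho)) with (zeta / d - zeta / rho)
      by (rewrite <- Hdd; field; lra).
    replace (- zeta / 2) with (- (zeta / 2)) by field.
    unfold Rminus; rewrite !exp_plus, !exp_Ropp.
    pose proof (exp_pos rho); pose proof (exp_pos (zeta / rho)).
    pose proof (exp_pos (zeta / d)); pose proof (exp_pos (zeta / 2)).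
    pose proof (exp_pos (l * (zeta / d))); pose proof (exp_pos 1).
    pose proof (exp_pos (- 1)); field; repeat split; lra.
  - replace (locally 1) with (locally (1 * 1 * ((/ 2 * exp (- 1)) * / (/ 2 * exp (- 1))) * 1)).
    2: { pose proof (exp_pos (- 1)); f_equal; field; lra. }
    apply (filterlim_Rmult (at_right 0)).
    + apply (filterlim_Rmult (at_right 0)).
      * apply (filterlim_Rmult (at_right 0)); [apply busy_prob_ratio_lim | apply exp_neg_lim_0].
      * apply (filterlim_Rmult (at_right 0)); [|apply filterlim_const].
        set (C := 816 * exp 8 / zeta).
        rewrite <- ground_weight_0.
        apply (squeeze _ (fun rho => ground_weight (sqrt rho) - C * sqrt rho) _
          (fun rho => ground_weight (sqrt rho) + C * sqrt rho)).
        -- apply (filter_imp (fun rho => 0 < rho < 1)); [|apply at_right_lt; lra].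
           intros rho Hr; unfold m.
           destruct (queue_of rho (proj1 Hr)) as (u & Hu & HE).
           pose proof (sqrt_lt_R0 rho (proj1 Hr)) as Hd.
           pose proof (sqrt_def rho ltac:(lra)) as Hdd.
           rewrite HE by (apply Rdiv_le_0_compat; lra).
           set (d := sqrt rho) in *; assert (Hd1 : d < 1) by nra.
           replace (d * (zeta / rho)) with (zeta / d) by (rewrite <- Hdd; field; lra).
           pose proof (light_load_gap d u zeta ltac:(lra) Hu Hz) as Hb; fold C in Hb.
           apply Rabs_le_between in Hb.
           replace (exp rho * exp (zeta / rho)
               * (exp (- rho) * exp (- (zeta / rho)) * mass u (zeta / d))
               * exp (- (rate d * (zeta / d))))
             with (mass u (zeta / d) * exp (- (rate d * (zeta / d)))); [lra|].
           rewrite (exp_Ropp rho), (exp_Ropp (zeta / rho)).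
           pose proof (exp_pos rho); pose proof (exp_pos (zeta / rho)); field; lra.
        -- replace (locally (ground_weight 0)) with (locally (ground_weight 0 - C * 0))
             by (f_equal; ring).
           apply (filterlim_of_derivable _ sqrt (fun d => ground_weight d - C * d) 0 sqrt_lim_0).
           auto_derive; auto using ex_derive_ground_weight.
        -- replace (locally (ground_weight 0)) with (locally (ground_weight 0 + C * 0))
             by (f_equal; ring).
           apply (filterlim_of_derivable _ sqrt (fun d => ground_weight d + C * d) 0 sqrt_lim_0).
           auto_derive; auto using ex_derive_ground_weight.
    + replace (locally 1) with (locally (exp (zeta * (/ 2 - rate 0 / (1 + rate 0))))).
      * apply (filterlim_of_derivable _ sqrt
          (fun d => exp (zeta * (/ 2 - rate d / (1 + rate d)))) 0 sqrt_lim_0).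
        auto_derive; rewrite rate_0; repeat split; auto using ex_derive_rate; lra.
      * f_equal; rewrite rate_0.
        replace (zeta * (/ 2 - 1 / (1 + 1))) with 0 by field; apply exp_0.
Qed.

Lemma light_load_medium omega : 0 < omega ->
  asymp_equiv (at_right 0)
    (fun rho => / rho * pROS rho (p rho) (omega / sqrt rho))
    (fun rho => exp (- (omega / sqrt rho)) * Q0 omega).
Proof.
  intro Hw; pose proof (Q0_pos omega) as HQ; unfold asymp_equiv.
  set (m := fun rho => exp rho * exp (omega / sqrt rho)
    * pPS rho (p rho) (omega / sqrt rho)).
  apply filterlim_within_ext with (fun rho =>
    (1 - exp (- rho)) / rho * exp (- rho) * (m rho * / Q0 omega)).
  - intros rho Hr; unfold m, pROS; rewrite !exp_Ropp.
    pose proof (exp_pos rho); pose proof (exp_pos (omega / sqrt rho)).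
    field; repeat split; lra.
  - replace (locally 1) with (locally (1 * 1 * (Q0 omega * / Q0 omega)))
      by (f_equal; field; lra).
    apply (filterlim_Rmult (at_right 0)).
    + apply (filterlim_Rmult (at_right 0)); [apply busy_prob_ratio_lim | apply exp_neg_lim_0].
    + apply (filterlim_Rmult (at_right 0)); [|apply filterlim_const].
      intros P (eps & HP).
      destruct (mass_limit omega eps ltac:(lra) (cond_pos eps)) as (eta & Heta & Hlim).
      unfold filtermap; apply (filter_imp (fun rho => 0 < rho < eta ^ 2));
        [|apply at_right_lt; nra].
      intros rho Hr; apply HP; change (Rabs (m rho - Q0 omega) < eps); unfold m.
      destruct (queue_of rho (proj1 Hr)) as (u & Hu & HE).
      pose proof (sqrt_lt_R0 rho (proj1 Hr)) as Hd.
      pose proof (sqrt_def rho ltac:(lra)) as Hdd.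
      rewrite HE by (apply Rdiv_le_0_compat; lra).
      set (d := sqrt rho) in *; assert (Hd1 : d < eta) by nra.
      replace (d * (omega / d)) with omega by (field; lra).
      specialize (Hlim d u ltac:(lra) Hu).
      replace (exp rho * exp (omega / d) * (exp (- rho) * exp (- (omega / d)) * mass u omega))
        with (mass u omega); auto.
      rewrite (exp_Ropp rho), (exp_Ropp (omega / d)).
      pose proof (exp_pos rho); pose proof (exp_pos (omega / d)); field; lra.
Qed.

Lemma light_load_short_PS (t : R) : 0 <= t -> exists r : R -> R,
  is_bigO (at_right 0) r (fun rho => rho ^ 2) /\
  forall rho : R, 0 < rho ->
    pPS rho (p rho) t = exp (- t) * (1 + rho / 4 * (t ^ 2 - 2) + r rho).
Proof.
  intro Ht; exists (fun rho => exp t * pPS rho (p rho) t - 1 - rho / 4 * (t ^ 2 - 2)).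
  split.
  - destruct (short_time t Ht) as (C & HC); exists C.
    apply (filter_imp (fun rho => 0 < rho < 1)); [|apply at_right_lt; lra].
    intros rho Hr; rewrite (Rabs_pos_eq (rho ^ 2)) by apply pow2_ge_0.
    apply (HC rho (V rho)); [lra | apply HV; lra | apply Hp; lra].
  - intros rho Hr; rewrite exp_Ropp; pose proof (exp_pos t); field; lra.
Qed.

Lemma light_load_short_ROS (t : R) : 0 <= t -> exists r : R -> R,
  is_bigO (at_right 0) r (fun rho => rho ^ 2) /\
  forall rho : R, 0 < rho ->
    pROS rho (p rho) t = rho * exp (- t) * (1 + rho / 4 * (t ^ 2 - 4) + r rho).
Proof.
  intro Ht; exists (fun rho => exp t * pROS rho (p rho) t / rho - 1 - rho / 4 * (t ^ 2 - 4)).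
  split.
  - destruct (short_time t Ht) as (C & HC).
    set (D := Rabs (t ^ 2 - 2)); exists (Rabs C + D + (1 + D)).
    apply (filter_imp (fun rho => 0 < rho < 1)); [|apply at_right_lt; lra].
    intros rho Hr; rewrite (Rabs_pos_eq (rho ^ 2)) by apply pow2_ge_0.
    pose proof (HC rho (V rho) (p rho) ltac:(lra) (HV rho (proj1 Hr)) (Hp rho (proj1 Hr))) as H.
    set (r := exp t * pPS rho (p rho) t - 1 - rho / 4 * (t ^ 2 - 2)) in *.
    pose proof (exp_neg_3 rho ltac:(lra)) as H3.
    set (s := (exp (- rho) - 1 + rho - rho ^ 2 / 2)) in *.
    replace (exp t * pROS rho (p rho) t / rho - 1 - rho / 4 * (t ^ 2 - 4))
      with (r * ((1 - exp (- rho)) / rho) + - rho ^ 2 / 8 * (t ^ 2 - 2)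
            + - (s / rho) * (1 + rho / 4 * (t ^ 2 - 2)))
      by (unfold r, s, pROS; field; lra).
    pose proof (busy_prob_ratio rho (proj1 Hr)) as Hb.
    assert (HD : 0 <= D) by apply Rabs_pos.
    assert (Hrho2 : 0 <= rho ^ 2) by apply pow2_ge_0.
    assert (A1 : Rabs (r * ((1 - exp (- rho)) / rho)) <= Rabs C * rho ^ 2).
    { rewrite Rabs_mult, (Rabs_pos_eq ((1 - exp (- rho)) / rho)) by lra.
      pose proof (Rabs_pos r); pose proof (Rle_abs C).
      apply Rle_trans with (Rabs r * 1); [apply Rmult_le_compat_l; lra|].
      rewrite Rmult_1_r; eapply Rle_trans; [exact H|]; apply Rmult_le_compat_r; lra. }
    assert (A2 : Rabs (- rho ^ 2 / 8 * (t ^ 2 - 2)) <= D * rho ^ 2).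
    { rewrite Rabs_mult; fold D; unfold Rdiv.
      rewrite Rabs_mult, Rabs_Ropp, (Rabs_pos_eq (rho ^ 2)), (Rabs_pos_eq (/ 8)) by lra.
      assert (0 <= rho ^ 2 * D) by (apply Rmult_le_pos; lra); lra. }
    assert (A3 : Rabs (- (s / rho) * (1 + rho / 4 * (t ^ 2 - 2))) <= (1 + D) * rho ^ 2).
    { rewrite Rabs_mult, Rabs_Ropp, Rmult_comm.
      apply Rmult_le_compat; auto using Rabs_pos.
      - eapply Rle_trans; [apply Rabs_triang|].
        rewrite Rabs_R1, Rabs_mult, (Rabs_pos_eq (rho / 4)) by lra; fold D; nra.
      - unfold Rdiv; rewrite Rabs_mult, Rabs_inv, (Rabs_pos_eq rho) by lra.
        apply Rmult_le_reg_r with rho; [lra|].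
        rewrite Rmult_assoc, Rinv_l, Rmult_1_r by lra.
        eapply Rle_trans; [exact H3 | right; ring]. }
    eapply Rle_trans; [apply Rabs_triang|].
    eapply Rle_trans; [apply Rplus_le_compat_r, Rabs_triang|]; lra.
  - intros rho Hr; rewrite exp_Ropp; pose proof (exp_pos t); field; lra.
Qed.

Lemma heavy_load_PS_ROS T : 0 < T ->
  asymp_equiv (Rbar_locally p_infty)
    (fun rho => pPS rho (p rho) (T * rho))
    (fun rho => pROS rho (p rho) (T * rho)).
Proof.
  intro HT; unfold asymp_equiv.
  apply filterlim_ext_loc with (fun rho => / (1 - exp (- rho))).
  - apply (filter_imp (fun rho => 0 < rho)); [|apply infty_gt].
    intros rho Hr; unfold pROS.
    pose proof (pPS_pos rho (T * rho) Hr ltac:(nra)); pose proof (busy_prob_pos rho Hr).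
    field; lra.
  - apply (filterlim_Rinv_1 (Rbar_locally p_infty)), busy_prob_lim.
Qed.

(** The spectral gap is of the order of the inverse of the time considered, so the
    two-sided bounds replace it: both [ground_weight] and the initial value of
    [mass] are equivalent to [e^rho / rho], that is, almost all of the initial
    vector lies along the ground state. *)
Lemma heavy_load T : 0 < T ->
  asymp_equiv (Rbar_locally p_infty)
    (fun rho => pROS rho (p rho) (T * rho))
    (fun rho => 1 / rho * exp (- T)).
Proof.
  intro HT; unfold asymp_equiv.
  set (R := fun rho => rho * exp T * pPS rho (p rho) (T * rho)).
  apply filterlim_ext_loc with (fun rho => (1 - exp (- rho)) * R rho).
  { apply (filter_imp (fun rho => 0 < rho)); [|apply infty_gt].
    intros rho Hr; unfold pROS, R; rewrite !exp_Ropp.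
    pose proof (exp_pos T); pose proof (exp_pos rho); field; lra. }
  replace (locally 1) with (locally (1 * 1)) by (f_equal; ring).
  apply (filterlim_Rmult (Rbar_locally p_infty)); [apply busy_prob_lim|].
  apply (squeeze _ (fun rho => 1 - 4 * / rho) _ (fun rho => exp (2 * T * / rho))).
  - apply (filter_imp (fun rho => 0 < rho)); [|apply infty_gt]; intros rho Hr.
    destruct (queue_of rho Hr) as (u & Hu & HE).
    pose proof (sqrt_lt_R0 rho Hr) as Hd; pose proof (sqrt_def rho ltac:(lra)) as Hdd.
    unfold R; rewrite HE by nra; set (d := sqrt rho) in *.
    pose proof (rate_pos d) as Hl; pose proof (rate_eq d) as Heq.
    set (l := rate d) in *; set (L := d * l).
    (* [L] is [Lambda0 rho]; hence [rho L = rho - L^2], and the exponent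
       differs from [- T] by [T (1 - L^2)], of order [/ rho]. *)
    assert (HL : L ^ 2 + rho * L = rho) by (unfold L; rewrite <- Hdd; nra).
    assert (HL0 : 0 < L) by (unfold L; nra).
    assert (HL1 : L < 1) by nra.
    assert (Hdl : d / l = rho + L).
    { apply Rmult_eq_reg_r with l; [|lra]; unfold Rdiv; rewrite Rmult_assoc, Rinv_l by lra.
      unfold L; rewrite <- Hdd; nra. }
    assert (Hw : 0 <= d * (T * rho)) by (apply Rmult_le_pos; nra).
    assert (Hexp : l * (d * (T * rho)) = T * rho - T * L ^ 2).
    { replace (l * (d * (T * rho))) with (T * (rho * L)) by (unfold L; ring).
      replace (rho * L) with (rho - L ^ 2) by lra; ring. }
    set (w := d * (T * rho)) in *.
    set (M := mass u w * exp (- (l * w))).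
    replace (rho * exp T * (exp (- rho) * exp (- (T * rho)) * mass u w))
      with (rho * exp (- rho) * M * exp (T * (1 - L ^ 2))).
    2: { unfold M; rewrite Hexp.
         transitivity (rho * exp (- rho) * mass u w
           * (exp (- (T * rho - T * L ^ 2)) * exp (T * (1 - L ^ 2)))); [ring|].
         rewrite <- exp_plus.
         replace (- (T * rho - T * L ^ 2) + T * (1 - L ^ 2)) with (T + - (T * rho)) by ring.
         rewrite exp_plus; ring. }
    assert (HM : ground_weight d <= M <= mass u 0).
    { pose proof (mass_lower d u w Hd Hu Hw) as H1; fold l in H1.
      pose proof (mass_upper d u w Hd Hu Hw) as H2; fold l in H2.
      unfold M; rewrite exp_Ropp; pose proof (exp_pos (l * w)).
      split; apply Rmult_le_reg_r with (exp (l * w)); auto;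
        rewrite Rmult_assoc, Rinv_l, Rmult_1_r by lra; lra. }
    assert (HL2 : 0 <= 1 - L ^ 2 <= 2 * / rho).
    { split; [nra|]; apply Rmult_le_reg_r with rho; auto.
      rewrite Rmult_assoc, Rinv_l by lra.
      assert (L * (L ^ 2 + rho * L) = L * rho) by (rewrite HL; ring).
      replace ((1 - L ^ 2) * rho) with (L ^ 2 + L ^ 3) by lra.
      assert (L ^ 2 <= 1) by nra; assert (L ^ 3 <= 1) by (simpl; nra); lra. }
    assert (HE1 : 1 <= exp (T * (1 - L ^ 2)) <= exp (2 * T * / rho)).
    { split; [rewrite <- exp_0 at 1; apply exp_le, Rmult_le_pos; lra|].
      apply exp_le; rewrite (Rmult_comm 2), Rmult_assoc; apply Rmult_le_compat_l; lra. }
    assert (Hlow : 1 - 4 * / rho <= rho * exp (- rho) * M).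
    { apply Rle_trans with (rho * exp (- rho) * ground_weight d).
      - unfold ground_weight; fold l; rewrite Hdl.
        replace (rho * exp (- rho) * (exp (rho + L - 1) / (2 + (rho + L))))
          with (rho * exp (L - 1) / (2 + rho + L)).
        + pose proof (exp_ineq1_le (L - 1)).
          apply Rle_trans with ((rho - 1) / (2 + rho + L)).
          * apply Rmult_le_reg_r with (rho * (2 + rho + L)); [nra|].
            replace ((1 - 4 * / rho) * (rho * (2 + rho + L)))
              with ((rho - 4) * (2 + rho + L)) by (field; lra).
            replace ((rho - 1) / (2 + rho + L) * (rho * (2 + rho + L)))
              with ((rho - 1) * rho) by (field; lra).
            nra.
          * apply Rmult_le_compat_r; [left; apply Rinv_0_lt_compat; lra | nra].
        + replace (rho + L - 1) with (rho + (L - 1)) by ring.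
          rewrite exp_plus, exp_Ropp; pose proof (exp_pos rho); field; lra.
      - apply Rmult_le_compat_l; [|lra].
        pose proof (exp_pos (- rho)); nra. }
    assert (Hup : rho * exp (- rho) * M <= 1).
    { apply Rle_trans with (rho * exp (- rho) * mass u 0).
      - apply Rmult_le_compat_l; [pose proof (exp_pos (- rho)); nra | lra].
      - rewrite (mass_initial d u Hd Hu).
        replace (d ^ 2) with rho by (simpl; lra).
        rewrite exp_Ropp; pose proof (exp_pos rho).
        replace (rho * / exp rho * ((exp rho - 1) / rho)) with (1 - / exp rho)
          by (field; lra).
        pose proof (Rinv_0_lt_compat (exp rho)); lra. }
    assert (Hpos : 0 <= rho * exp (- rho) * M).
    { pose proof (ground_weight_pos d Hd); pose proof (exp_pos (- rho)).
      apply Rmult_le_pos; [nra | lra]. }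
    split; [nra|].
    apply Rle_trans with (1 * exp (T * (1 - L ^ 2))); [|lra].
    apply Rmult_le_compat_r; lra.
  - replace (locally 1) with (locally (1 - 4 * 0)) by (f_equal; ring).
    apply (filterlim_of_derivable _ Rinv (fun x => 1 - 4 * x) 0 inv_lim_infty).
    auto_derive; auto.
  - replace (locally 1) with (locally (exp (2 * T * 0)))
      by (f_equal; rewrite Rmult_0_r; apply exp_0).
    apply (filterlim_of_derivable _ Rinv (fun x => exp (2 * T * x)) 0 inv_lim_infty).
    auto_derive; auto.
Qed.

End Asymptotics.

Theorem theorem2p7 (V p : R -> nat -> R -> R)
  (HV : forall rho : R, 0 < rho -> sojourn_tail rho (V rho))
  (Hp : forall rho : R, 0 < rho -> sojourn_density (V rho) (p rho)) :
  (* rho fixed, t -> oo *)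
  (forall rho : R, 0 < rho ->
     (forall t : R, 0 <= t ->
        pPS rho (p rho) t = pROS rho (p rho) t / (1 - exp (- rho))) /\
     asymp_equiv (Rbar_locally p_infty)
       (fun t => pPS rho (p rho) t)
       (fun t => (sqrt (rho + 4) - sqrt rho) / (2 * sqrt (rho + 4))
                 * exp (- 1 - rho) * exp (rho / Lambda0 rho)
                 * exp (- t) * exp (Lambda0 rho * t)))
  /\
  (* rho -> 0+, t = zeta / rho *)
  (forall zeta : R, 0 < zeta ->
     asymp_equiv (at_right 0)
       (fun rho => pPS rho (p rho) (zeta / rho))
       (fun rho => / rho * pROS rho (p rho) (zeta / rho)) /\
     asymp_equiv (at_right 0)
       (fun rho => / rho * pROS rho (p rho) (zeta / rho))
       (fun rho => / 2 * exp (- 1) * exp (- zeta / 2)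
                   * exp (- (1 - sqrt rho) * (zeta / rho))))
  /\
  (* rho -> 0+, t = omega / sqrt rho *)
  (forall omega : R, 0 < omega ->
     asymp_equiv (at_right 0)
       (fun rho => pPS rho (p rho) (omega / sqrt rho))
       (fun rho => / rho * pROS rho (p rho) (omega / sqrt rho)) /\
     asymp_equiv (at_right 0)
       (fun rho => / rho * pROS rho (p rho) (omega / sqrt rho))
       (fun rho => exp (- (omega / sqrt rho)) * Q0 omega))
  /\
  (* rho -> 0+, t fixed *)
  (forall t : R, 0 <= t ->
     (exists r : R -> R,
        is_bigO (at_right 0) r (fun rho => rho ^ 2) /\
        forall rho : R, 0 < rho ->
          pPS rho (p rho) t
          = exp (- t) * (1 + rho / 4 * (t ^ 2 - 2) + r rho)) /\
     (exists r : R -> R,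
        is_bigO (at_right 0) r (fun rho => rho ^ 2) /\
        forall rho : R, 0 < rho ->
          pROS rho (p rho) t
          = rho * exp (- t) * (1 + rho / 4 * (t ^ 2 - 4) + r rho)))
  /\
  (* rho -> oo, t = T rho *)
  (forall T : R, 0 < T ->
     asymp_equiv (Rbar_locally p_infty)
       (fun rho => pPS rho (p rho) (T * rho))
       (fun rho => pROS rho (p rho) (T * rho)) /\
     asymp_equiv (Rbar_locally p_infty)
       (fun rho => pROS rho (p rho) (T * rho))
       (fun rho => 1 / rho * exp (- T))).
Proof.
  split; [|split; [|split; [|split]]].
  - intros rho Hr; split; [|now apply (fixed_load V p HV Hp)].
    intros t _; unfold pROS; pose proof (busy_prob_pos rho Hr); field; lra.
  - intros zeta Hz; split; [|now apply (light_load_long V p HV Hp)].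
    apply (light_load_PS_ROS V p HV Hp (fun rho => zeta / rho)).
    intros rho Hr; apply Rdiv_le_0_compat; lra.
  - intros omega Hw; split; [|now apply (light_load_medium V p HV Hp)].
    apply (light_load_PS_ROS V p HV Hp (fun rho => omega / sqrt rho)).
    intros rho Hr; apply Rdiv_le_0_compat; [lra | now apply sqrt_lt_R0].
  - intros t Ht; split; [now apply (light_load_short_PS V p HV Hp)
                        | now apply (light_load_short_ROS V p HV Hp)].
  - intros T HT; split; [now apply (heavy_load_PS_ROS V p HV Hp)
                        | now apply (heavy_load V p HV Hp)].
Qed.
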